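(* Let $F$ be a non-archimedean local field with ring of integers $\mathfrak{o}$, maximal ideal $\mathfrak{p}$, uniformizer $\varpi$ and residue field of cardinality $q$. Let $\alpha$ be a real number with $0<\alpha<1/2$, let $\mu_2$ be a ramified unitary character of $F^\times$, and let $$\pi=\mathrm{Ind}_{B_3}^{\mathrm{GL}_3(F)}(|\cdot|^{\alpha}\otimes\mu_2\otimes|\cdot|^{-\alpha})$$ (normalized induction from the upper triangular Borel subgroup $B_3$). Let $\psi$ be an unramified additive character of $F$, let $c$ be the conductor of $\pi$, and let $W_c\in\mathcal{W}(\pi,\psi)$ be the Whittaker function of a nonzero vector of $\pi^{K_c}$ (unique up to scalar). Put $t_1=|\varpi|^{\alpha}$. Then $W_c(1)\neq 0$ and, for every integer $m\ge 0$, $$W_c(\mathrm{diag}(\varpi^m,1,\varpi^{-m}))=\frac{q^{-2m}}{t_1-t_1^{-1}}\left(t_1^{2m+1}-t_1^{-(2m+1)}\right)W_c(1).$$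
   Context: For $n\ge 1$, $$K_n=\begin{pmatrix}\mathfrak{o}&\mathfrak{o}&\mathfrak{p}^{-n}\\ \mathfrak{p}^n&1+\mathfrak{p}^n&\mathfrak{o}\\ \mathfrak{p}^n&\mathfrak{p}^n&\mathfrak{o}\end{pmatrix}^{\times},$$ where for a subset $A$ of $3\times3$ matrices over $F$ closed under multiplication, $A^\times$ is the group of invertible $a\in A$ with $a^{-1}\in A$. The conductor $c$ of an irreducible generic representation $\pi$ is the one of Jacquet--Piatetski-Shapiro--Shalika: the least $n$ such that $\pi$ has a nonzero vector fixed by $\begin{pmatrix}\mathfrak{o}&\mathfrak{o}&\mathfrak{o}\\ \mathfrak{o}&\mathfrak{o}&\mathfrak{o}\\ \mathfrak{p}^n&\mathfrak{p}^n&1+\mathfrak{p}^n\end{pmatrix}^\times$; then $\dim\pi^{K_c}=1$. An additive character is unramified if it is trivial on $\mathfrak{o}$ but not on $\mathfrak{p}^{-1}$. $\mathcal{W}(\pi,\psi)$ is the Whittaker model of $\pi$: functions $W$ with $W(ug)=\psi(u_{12}+u_{23})W(g)$ for upper triangular unipotent $u$. *)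

(* Defs.v *)
From HB Require Import structures.
From mathcomp Require Import all_boot all_order all_algebra.
From mathcomp Require Import complex.
From mathcomp Require Import all_classical all_reals all_analysis.

Set Implicit Arguments.
Unset Strict Implicit.
Unset Printing Implicit Defensive.

Import Order.TTheory GRing.Theory Num.Theory.
Local Open Scope classical_set_scope.
Local Open Scope ring_scope.
Local Open Scope complex_scope.

(* {x | v x >= n}; the value of v at 0 is irrelevant, 0 having valuation +oo. *)
Definition val_ball (K : fieldType) (v : K -> int) (n : int) : set K :=
  [set x | x = 0 \/ n <= v x].

(* A field complete for a normalised discrete valuation v, with finite residue
   field of cardinality q; the residue field is the set of cosets x + p with x
   in o. *)
Record localField := LocalField {
  lf_sort :> fieldType;
  ord : lf_sort -> int;
  resq : nat;
  ordM : forall x y, x != 0 -> y != 0 -> ord (x * y) = ord x + ord y;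
  ordD : forall x y, x != 0 -> y != 0 -> x + y != 0 ->
    Num.min (ord x) (ord y) <= ord (x + y);
  ord_surj : exists2 x, x != 0 & ord x = 1;
  ord_complete : forall u : nat -> lf_sort,
    (forall n : int, exists N : nat, forall i j : nat,
       (N <= i)%N -> (N <= j)%N -> val_ball ord n (u i - u j)) ->
    exists l, forall n : int, exists N : nat, forall i : nat,
       (N <= i)%N -> val_ball ord n (u i - l);
  card_residue :
    ([set [set y | val_ball ord 1 (y - x)] | x in val_ball ord 0]
       #= `I_resq)%card
}.

Section LocalField.
Variables (R : realType) (F : localField).

Definition pid (n : int) : set F := val_ball (@ord F) n.
Definition oring : set F := pid 0.
Definition one_pid (n : int) : set F := [set x | pid n (x - 1)].

Definition uniformizer (x : F) : Prop := x != 0 /\ ord x = 1.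

Definition absv (x : F) : R :=
  if x == 0 then 0 else ((resq F)%:R : R) ^ (- ord x).

(* Characters of F^* are functions on F whose value at 0 is irrelevant. *)
Definition unitary_character (mu : F -> R[i]) : Prop :=
  [/\ forall x y, x != 0 -> y != 0 -> mu (x * y) = mu x * mu y,
      forall x, x != 0 -> `|mu x| = 1
    & forall x, x != 0 -> forall e : R, 0 < e ->
        exists n : int, forall y, y != 0 -> pid n (y - x) ->
          `|mu y - mu x| < e%:C].

Definition ramified (mu : F -> R[i]) : Prop :=
  exists x, [/\ x != 0, ord x = 0 & mu x != 1].

Definition abs_power (s : R) : F -> R[i] := fun x => (absv x `^ s)%:C.

Definition additive_character (psi : F -> R[i]) : Prop :=
  [/\ forall x y, psi (x + y) = psi x * psi y,
      forall x, `|psi x| = 1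
    & forall x, forall e : R, 0 < e ->
        exists n : int, forall y, pid n (y - x) -> `|psi y - psi x| < e%:C].

Definition unramified_additive (psi : F -> R[i]) : Prop :=
  (forall x, oring x -> psi x = 1) /\ (exists2 x, pid (- 1) x & psi x != 1).

End LocalField.

Record GL3 (F : fieldType) := MkGL3 {
  gl3_mx :> 'M[F]_3;
  gl3_unit : gl3_mx \in unitmx
}.
HB.instance Definition _ (F : fieldType) := [isSub for @gl3_mx F].
HB.instance Definition _ (F : fieldType) := [Choice of GL3 F by <:].

Section GL3Group.
Variable F : fieldType.
Implicit Types g h : GL3 F.

Lemma gl3_mul_subproof g h : gl3_mx g *m gl3_mx h \in unitmx.
Proof. by rewrite unitmx_mul !gl3_unit. Qed.
Lemma gl3_inv_subproof g : invmx g \in unitmx.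
Proof. by rewrite unitmx_inv gl3_unit. Qed.

Definition gl3_mul g h : GL3 F := MkGL3 (gl3_mul_subproof g h).
Definition gl3_one : GL3 F := MkGL3 (unitmx1 F 3).
Definition gl3_inv g : GL3 F := MkGL3 (gl3_inv_subproof g).

Lemma gl3_mulA : associative gl3_mul.
Proof. by move=> g h k; apply: val_inj; rewrite /= mulmxA. Qed.
Lemma gl3_mul1 : left_id gl3_one gl3_mul.
Proof. by move=> g; apply: val_inj; rewrite /= mul1mx. Qed.
Lemma gl3_mulr1 : right_id gl3_one gl3_mul.
Proof. by move=> g; apply: val_inj; rewrite /= mulmx1. Qed.
Lemma gl3_mulV : left_inverse gl3_one gl3_inv gl3_mul.
Proof. by move=> g; apply: val_inj; rewrite /= mulVmx // gl3_unit. Qed.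
Lemma gl3_mulrV : right_inverse gl3_one gl3_inv gl3_mul.
Proof. by move=> g; apply: val_inj; rewrite /= mulmxV // gl3_unit. Qed.

HB.instance Definition _ := isGroup.Build (GL3 F)
  gl3_mulA gl3_mul1 gl3_mulr1 gl3_mulV gl3_mulrV.

Definition diag3 (a b c : F) : 'M[F]_3 :=
  diag_mx (\row_(j < 3) [:: a; b; c]`_j).

(* Equal to 1 (a junk value) unless a, b, c are all nonzero. *)
Definition diagGL (a b c : F) : GL3 F := insubd (1%g : GL3 F) (diag3 a b c).

Lemma val_diagGL (a b c : F) : a != 0 -> b != 0 -> c != 0 ->
  diagGL a b c = diag3 a b c :> 'M[F]_3.
Proof.
move=> a0 b0 c0; rewrite /diagGL -[LHS]/(val _) val_insubd unitmxE det_diag.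
rewrite !big_ord_recl big_ord0 !mxE /= mulr1 unitfE.
by rewrite !mulf_neq0.
Qed.

Definition borel : set (GL3 F) :=
  [set g : GL3 F | forall i j : 'I_3, (j < i)%N -> g i j = 0].

Definition unipotent : set (GL3 F) :=
  [set g : GL3 F | borel g /\ forall i : 'I_3, g i i = 1].

Definition mx_of_sets (a11 a12 a13 a21 a22 a23 a31 a32 a33 : set F) :
    set 'M[F]_3 :=
  [set g | [/\ [/\ a11 (g 0 0), a12 (g 0 1) & a13 (g 0 2)],
               [/\ a21 (g 1 0), a22 (g 1 1) & a23 (g 1 2)]
             & [/\ a31 (g 2 0), a32 (g 2 1) & a33 (g 2 2)]]].

Definition units_of (A : set 'M[F]_3) : set (GL3 F) :=
  [set g : GL3 F | A g /\ A (g^-1)%g].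

End GL3Group.

Section Representations.
Variables (R : realType) (F : localField).
Implicit Types (V : set (GL3 F -> R[i])) (f : GL3 F -> R[i]).

Definition K_group (n : nat) : set (GL3 F) :=
  let o := @oring F in let p := @pid F in
  units_of (mx_of_sets
    o     o                (p (- n%:Z))
    (p n) (one_pid n)    o
    (p n) (p n)            o).

(* The group of Jacquet, Piatetski-Shapiro and Shalika. *)
Definition JPSS_group (n : nat) : set (GL3 F) :=
  let o := @oring F in let p := @pid F in
  units_of (mx_of_sets
    o     o     o
    o     o     o
    (p n) (p n) (one_pid n)).

Definition rtrans (h : GL3 F) f : GL3 F -> R[i] := fun g => f (g * h)%g.

(* Invariance under right translation by a principal congruence subgroup. *)
Definition smooth f : Prop :=
  exists n : nat, forall k : GL3 F,
    (forall i j : 'I_3, pid n.+1 ((gl3_mx k - 1%:M) i j)) -> rtrans k f = f.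

(* The modulus character of the Borel subgroup. *)
Definition modulus (b : GL3 F) : R :=
  (absv R (b 0 0) / absv R (b 2 2)) ^+ 2.

(* The space of the normalised induced representation; as for all the
   representations below, the group acts on it by right translation. *)
Definition Ind (chi1 chi2 chi3 : F -> R[i]) : set (GL3 F -> R[i]) :=
  [set f | smooth f /\ forall b g : GL3 F, borel b ->
    f (b * g)%g = chi1 (b 0 0) * chi2 (b 1 1) * chi3 (b 2 2)
                  * (Num.sqrt (modulus b))%:C * f g].

Definition invariants V (H : set (GL3 F)) : set (GL3 F -> R[i]) :=
  [set f | V f /\ forall h, H h -> rtrans h f = f].

Definition has_fixed_vector V (H : set (GL3 F)) : Prop :=
  exists2 f, invariants V H f & f <> (fun=> 0).

Definition is_conductor V (n : nat) : Prop :=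
  has_fixed_vector V (JPSS_group n) /\
  forall m : nat, has_fixed_vector V (JPSS_group m) -> (n <= m)%N.

(* Phi embeds V equivariantly into the space of Whittaker functions for psi;
   the Whittaker model is the image of V. *)
Definition whittaker_embedding (psi : F -> R[i]) V
    (Phi : (GL3 F -> R[i]) -> (GL3 F -> R[i])) : Prop :=
  [/\ forall (a : R[i]) f1 f2, V f1 -> V f2 ->
        Phi (fun g => a * f1 g + f2 g) = (fun g => a * Phi f1 g + Phi f2 g),
      forall h f, V f -> Phi (rtrans h f) = rtrans h (Phi f),
      forall f, V f -> Phi f = (fun=> 0) -> f = (fun=> 0)
    & forall f (u g : GL3 F), V f -> unipotent u ->
        Phi f (u * g)%g = psi (u 0 1 + u 1 2) * Phi f g].

End Representations.

(* Main.v *)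
Require Import Defs.
From mathcomp Require Import all_boot all_order all_algebra.
From mathcomp Require Import complex.
From mathcomp Require Import all_classical all_reals all_analysis.
From mathcomp Require Import ring zify.

Import Order.TTheory GRing.Theory Num.Theory.
Local Open Scope classical_set_scope.
Local Open Scope ring_scope.
Local Open Scope complex_scope.

Set Implicit Arguments.
Unset Strict Implicit.
Unset Printing Implicit Defensive.

(** Let n be the conductor, t1 = |varpi|^alpha, theta = t1 / q, and let chi be
    the inducing character times the square root of the modulus character, so
    that chi b = theta^(ord b00 - ord b22) mu2(b11).

    The newform. Conjugation by diag(varpi^n, 1, 1) turns K_n into the stabiliser
    Kcol n in GL_3(o) of the middle basis column modulo p^n. By the Iwasawa
    decomposition an invariant vector f is a function on the primitive columns
    modulo p^n, and it vanishes at a column on whose stabiliser in B(o) the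
    character chi is nontrivial. As mu2 is nontrivial on 1 + p^(n-1), this leaves
    the B(o)-orbit of the middle basis column (newform_support), so f is explicit,
    in particular on the big cell (newform_bigcell). That n is the exponent of mu2
    has two halves: mu2 is trivial on 1 + p^n because of the invariance of f
    (mu_trivial), and if it were trivial on 1 + p^(n-1) then the function
    supported on one double coset of has_JPSS_vector would contradict the
    minimality of n.

    The Whittaker functional. The embedding Phi is given abstractly, but it is
    as good as unique: evaluate it at a torus element tr that gives psi the
    conductor p^r. The average over U(o) against psi of a vector of level r
    vanishes off B w0 U(o) (Uavg_support), so it is a multiple of one function,
    the multiple being a finite Jacquet integral. Hence Phi h tr is
    proportional to the Jacquet integral of h (functional_compare). The values of
    Phi at tr t for dominant t reduce to values at tr by sums over
    Gam t Gam / Gam, which preserve the level (hecke_level); for the same reason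
    Phi h tr cannot vanish for all h of level r, since Phi is injective
    (L_nonzero).

    The integral. For the vector that computes W_c at diag(varpi^m, 1, varpi^-m)
    the Jacquet integral is a sum over the coordinates x, y, z of U of the
    explicit f on the big cell against the inverse of
    psi (varpi^(m-n) x) psi (varpi^m y). On a shell of z the substitution
    w = 1 - x y / z and the ramification of mu2 leave indicators of balls in x,
    y, x y (sum_bigcell_shell); summing psi over balls gives a constant times
    (1 - t1^2 / q) (1 + t1^2 + ... + t1^(4m)) (jacquet_sum). This is nonzero, since
    t1 < 1, and dividing by the case m = 0 gives the formula, with W_c(1)
    nonzero. *)

Ltac ord_lia :=
  repeat match goal with
  | H : is_true (@Order.le _ _ _ _) |- _ => revert H
  | H : is_true (@Order.lt _ _ _ _) |- _ => revert H
  | H : is_true (leq _ _) |- _ => revert H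
  | H : @eq ?T _ _ |- _ => unify T int; revert H
  end; clear; intros; lia.

(** * Transversals *)

Section Transversal.

Definition equivalence (T : Type) (E : T -> T -> Prop) : Prop :=
  [/\ forall x, E x x, forall x y, E x y -> E y x
    & forall x y z, E x y -> E y z -> E x z].

Definition transversal (T : eqType) (E : T -> T -> Prop) (A : set T)
    (s : seq T) : Prop :=
  [/\ uniq s, forall x, x \in s -> A x,
      forall x y, x \in s -> y \in s -> E x y -> x = y
    & forall x, A x -> exists2 y, y \in s & E x y].

(** Every finite sum below runs over representatives of a finite quotient; by
    this lemma the representatives may be changed at will. *)
Lemma transversal_sum (M : nmodType) (T : eqType) (E : T -> T -> Prop)
    (A : set T) (s s' : seq T) (f : T -> M) :
  equivalence E -> transversal E A s -> transversal E A s' ->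
  (forall x y, A x -> A y -> E x y -> f x = f y) ->
  \sum_(x <- s) f x = \sum_(x <- s') f x.
Proof.
move=> [Er Es Et] [us sA sE sS] [us' sA' sE' sS'] fE.
have /choice[h hP] : forall x, exists y, x \in s -> y \in s' /\ E x y.
  move=> x; case: (boolP (x \in s)) => [xs|]; last by exists x.
  by have [y ys xy] := sS' x (sA x xs); exists y.
have ps : perm_eq s' (map h s).
  apply: uniq_perm => // [|y].
    rewrite map_inj_in_uniq // => x y xs ys hxy; apply: sE => //.
    have [_ e1] := hP x xs; have [_ e2] := hP y ys.
    by apply: Et e1 _; rewrite hxy; apply: Es.
  apply/idP/mapP => [ys'|[x xs ->]]; last by case: (hP x xs).
  have [x xs yx] := sS y (sA' y ys').
  exists x => //; have [hs xh] := hP x xs.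
  by apply: sE' => //; apply: Et yx xh.
rewrite (perm_big _ ps) big_map [LHS]big_seq [RHS]big_seq.
apply: eq_bigr => x xs; have [hs xh] := hP x xs.
by apply: fE => //; [exact: sA|exact: sA'].
Qed.

Lemma transversal_map (T T' : eqType) (E : T -> T -> Prop)
    (E' : T' -> T' -> Prop) (A : set T) (A' : set T') (h : T -> T')
    (s : seq T) :
  equivalence E -> equivalence E' -> transversal E A s ->
  (forall x, A x -> A' (h x)) ->
  (forall x y, A x -> A y -> E' (h x) (h y) <-> E x y) ->
  (forall y, A' y -> exists2 x, A x & E' y (h x)) ->
  transversal E' A' (map h s).
Proof.
move=> [Er _ _] [Er' _ Et'] [us sA sE sS] hA hE hS; split.
- rewrite map_inj_in_uniq // => x y xs ys hxy; apply: sE => //.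
  by apply/hE; [exact: sA|exact: sA|rewrite hxy].
- by move=> _ /mapP[x xs ->]; apply/hA/sA.
- move=> _ _ /mapP[x xs ->] /mapP[y ys ->] /hE e; congr h.
  by apply: sE => //; apply: e; exact: sA.
- move=> y /hS[x Ax yx]; have [x' xs xx'] := sS x Ax.
  exists (h x'); first exact: map_f.
  by apply: Et' yx _; apply/hE => //; exact: sA.
Qed.

Lemma transversal_filter (T : eqType) (E : T -> T -> Prop) (A : set T)
    (p : pred T) (s : seq T) :
  transversal E A s -> (forall x y, A x -> A y -> E x y -> p x = p y) ->
  transversal E [set x | A x /\ p x] [seq x <- s | p x].
Proof.
move=> [us sA sE sS] pE; split.
- exact: filter_uniq.
- by move=> x; rewrite mem_filter => /andP[px /sA].
- move=> x y; rewrite !mem_filter => /andP[_ xs] /andP[_ ys]; exact: sE.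
- move=> x [Ax px]; have [y ys xy] := sS x Ax; exists y => //.
  by rewrite mem_filter ys -(pE _ _ Ax (sA _ ys) xy) px.
Qed.

End Transversal.

(** * Valuations and balls *)

Section LocalFieldTheory.
Variable F : localField.
Implicit Types (x y z : F) (a b n : int).
Local Notation v := (@ord F).

Definition ball n x : bool := (x == 0) || (n <= v x).

Lemma ballP n x : reflect (pid n x) (ball n x).
Proof.
by apply: (iffP orP) => -[/eqP|]; [left|right|left|right] => //; apply/eqP.
Qed.

Lemma ord1 : v 1 = 0.
Proof.
have := @ordM F 1 1 (oner_neq0 _) (oner_neq0 _); rewrite mulr1 => /eqP.
by rewrite -subr_eq0 opprD addrA subrr sub0r oppr_eq0 => /eqP.
Qed.

Lemma ordN x : v (- x) = v x.
Proof.
have [->|x0] := eqVneq x 0; first by rewrite oppr0.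
have N10 : (-1 : F) != 0 by rewrite oppr_eq0 oner_neq0.
have h : v (-1) = 0.
  have := @ordM F (-1) (-1) N10 N10; rewrite mulrNN mulr1 ord1; lia.
by rewrite -mulN1r ordM // h add0r.
Qed.

Lemma ordV x : x != 0 -> v x^-1 = - v x.
Proof.
move=> x0; have := @ordM F x x^-1 x0; rewrite invr_eq0 x0 divff // ord1.
by move=> /(_ isT); lia.
Qed.

Lemma ord_div x y : x != 0 -> y != 0 -> v (x / y) = v x - v y.
Proof. by move=> x0 y0; rewrite ordM ?invr_eq0 // ordV. Qed.

Lemma ordX x (k : nat) : x != 0 -> v (x ^+ k) = v x * k%:Z.
Proof.
move=> x0; elim: k => [|k IH]; first by rewrite expr0 ord1 mulr0.
by rewrite exprS ordM ?expf_neq0 // IH -addn1 PoszD; ring.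
Qed.

Lemma ordXz x (k : int) : x != 0 -> v (x ^ k) = v x * k.
Proof.
move=> x0; case: k => k; first by rewrite -exprnP ordX.
by rewrite NegzE -exprnN ordV ?expf_neq0 // ordX //; ring.
Qed.

Lemma ball0 n : ball n 0. Proof. by rewrite /ball eqxx. Qed.
Lemma ball1 : ball 0 1. Proof. by rewrite /ball ord1 lexx orbT. Qed.

Lemma ballE n x : x != 0 -> ball n x = (n <= v x).
Proof. by rewrite /ball => /negbTE->. Qed.

Lemma ballN n x : ball n (- x) = ball n x.
Proof. by rewrite /ball oppr_eq0 ordN. Qed.

Lemma ballD n x y : ball n x -> ball n y -> ball n (x + y).
Proof.
have [->|x0] := eqVneq x 0; first by rewrite add0r.
have [->|y0] := eqVneq y 0; first by rewrite addr0.
have [->|xy0] := eqVneq (x + y) 0; first by rewrite ball0.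
rewrite !ballE // => nx ny; apply: le_trans (ordD x0 y0 xy0).
by rewrite le_min nx.
Qed.

Lemma ballB n x y : ball n x -> ball n y -> ball n (x - y).
Proof. by move=> nx ny; apply: ballD => //; rewrite ballN. Qed.

Lemma ballBC n x y : ball n (x - y) = ball n (y - x).
Proof. by rewrite -ballN opprB. Qed.

Lemma ballM a b x y : ball a x -> ball b y -> ball (a + b) (x * y).
Proof.
have [->|x0] := eqVneq x 0; first by rewrite mul0r !ball0.
have [->|y0] := eqVneq y 0; first by rewrite mulr0 !ball0.
by rewrite !ballE ?mulf_neq0 // ordM // => ? ?; lia.
Qed.

Lemma ballMl n x y : ball 0 x -> ball n y -> ball n (x * y).
Proof. by move=> hx hy; have := ballM hx hy; rewrite add0r. Qed.

Lemma ballMr n x y : ball n x -> ball 0 y -> ball n (x * y).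
Proof. by move=> hx hy; rewrite mulrC; apply: ballMl. Qed.

Lemma ballW a b x : b <= a -> ball a x -> ball b x.
Proof. by move=> ba /orP[/eqP->|h]; rewrite /ball ?eqxx ?(le_trans ba h) ?orbT. Qed.

Lemma ball_Ml n x y : x != 0 -> ball n (x * y) = ball (n - v x) y.
Proof.
move=> x0; have [->|y0] := eqVneq y 0; first by rewrite mulr0 !ball0.
by rewrite !ballE ?mulf_neq0 // ordM //; lia.
Qed.

Lemma ball_Mr n x y : x != 0 -> ball n (y * x) = ball (n - v x) y.
Proof. by rewrite mulrC; exact: ball_Ml. Qed.

Lemma ball_addl n x y : ball n x -> ball n (x + y) = ball n y.
Proof.
move=> nx; apply/idP/idP => [h|]; last exact: ballD.
by have := ballB h nx; rewrite addrAC subrr add0r.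
Qed.

Lemma ball_sum (I : Type) (r : seq I) (P : pred I) (f : I -> F) n :
  (forall i, P i -> ball n (f i)) -> ball n (\sum_(i <- r | P i) f i).
Proof.
by move=> h; apply: (big_ind (fun x => ball n x)) => //;
  [exact: ball0|exact: ballD].
Qed.

Lemma ball_prod (I : Type) (r : seq I) (P : pred I) (f : I -> F) :
  (forall i, P i -> ball 0 (f i)) -> ball 0 (\prod_(i <- r | P i) f i).
Proof.
by move=> h; apply: (big_ind (fun x => ball 0 x)) => //;
  [exact: ball1|move=> x y; exact: ballMl].
Qed.

Lemma ord_min (a b m : int) : Num.min a b <= m -> a <= m \/ b <= m.
Proof. by rewrite ge_min => /orP. Qed.

(** The term of smaller valuation decides: apply the ultrametric inequality
    to x + y and to x = (x + y) - y. *)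
Lemma ord_add x y : x != 0 -> ball (v x + 1) y ->
  x + y != 0 /\ v (x + y) = v x.
Proof.
move=> x0 hy; have xy0 : x + y != 0.
  apply: contraTneq hy => /eqP; rewrite addr_eq0 => /eqP xy.
  rewrite -ballN -xy ballE //; lia.
split => //; have [->|y0] := eqVneq y 0; first by rewrite addr0.
move: hy; rewrite ballE // => hy.
have h1 : v x <= v (x + y) \/ v y <= v (x + y) := ord_min (ordD x0 y0 xy0).
have yN0 : - y != 0 by rewrite oppr_eq0.
have xyy : (x + y) + - y != 0 by rewrite addrK.
have := ord_min (ordD xy0 yN0 xyy); rewrite addrK ordN => h2.
by case: h1; case: h2 => h2 h1; lia.
Qed.

Lemma ord_unit_add x y : x != 0 -> v x = 0 -> ball 1 y ->
  x + y != 0 /\ v (x + y) = 0.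
Proof. by move=> x0 vx hy; rewrite -vx; apply: ord_add => //; rewrite vx. Qed.

Lemma ord_near1 n x : 1 <= n -> ball n (x - 1) -> x != 0 /\ v x = 0.
Proof.
move=> n1 hx; have := @ord_unit_add 1 (x - 1) (oner_neq0 _) ord1.
by rewrite [1 + _]addrC subrK; apply; apply: ballW hx.
Qed.

Lemma notball x n : ~~ ball n x -> x != 0 /\ v x < n.
Proof. by rewrite negb_or -ltNge => /andP. Qed.

Lemma unit_ball x : ball 0 x -> ~~ ball 1 x -> x != 0 /\ v x = 0.
Proof.
by move=> x0 /notball[xn0 vx]; split => //; move: x0; rewrite ballE //; lia.
Qed.

Lemma ball_divu n x y : ball n x -> y != 0 -> v y = 0 -> ball n (x / y).
Proof. by move=> hx y0 vy; rewrite ball_Mr ?invr_eq0 // ordV // vy oppr0 subr0. Qed.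

Definition cong b x y : Prop := ball b (x - y).

Lemma cong_equiv b : equivalence (cong b).
Proof.
split=> [x|x y|x y z h1 h2]; rewrite /cong.
- by rewrite subrr ball0.
- by rewrite ballBC.
- by have := ballD h1 h2; rewrite addrA subrK.
Qed.

Lemma cong_ball a b x y : b <= a -> cong a x y -> ball b x = ball b y.
Proof.
move=> ba h; rewrite -(subrK y x) ball_addl //; exact: ballW h.
Qed.

(** ** Representatives of the quotients p^a / p^b *)

(** The cosets of p in o are counted by hypothesis; pick a point in each. *)
Lemma residue_transversal :
  exists2 s, transversal (cong 1) [set x | ball 0 x] s & size s = resq F.
Proof.
have := card_residue F; rewrite card_eq_sym => /pcard_eqP/unsquash f.
pose cos (x : F) : set F := [set y | val_ball v 1 (y - x)].
have cosP x y : cos x = cos y <-> cong 1 x y.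
  split=> [e|h].
    have : cos x x by apply/ballP; rewrite subrr ball0.
    by rewrite e => /ballP.
  rewrite /cos; apply/seteqP; split=> z /= /ballP hz; apply/ballP.
    by have := ballD hz h; rewrite addrA subrK.
  by rewrite /cong ballBC in h; have := ballD hz h; rewrite addrA subrK.
have /choice[h hP] : forall i : nat, exists x,
    (i < resq F)%N -> ball 0 x /\ cos x = f i.
  move=> i; case: (ltnP i (resq F)) => [iq|]; last by exists 0.
  have /(@funS _ _ _ _ f)[x /ballP x0 e] : `I_(resq F) i by [].
  by exists x.
have hinj i j : (i < resq F)%N -> (j < resq F)%N -> cong 1 (h i) (h j) -> i = j.
  move=> iq jq /cosP; have [_ ->] := hP i iq; have [_ ->] := hP j jq.
  by move=> e; apply: (@inj _ _ _ f) e; rewrite inE.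
exists [seq h i | i <- iota 0 (resq F)]; last by rewrite size_map size_iota.
split.
- rewrite map_inj_in_uniq ?iota_uniq // => i j; rewrite !mem_iota !add0n /=.
  by move=> iq jq e; apply: hinj => //; rewrite e /cong subrr ball0.
- by move=> x /mapP[k]; rewrite mem_iota => /hP[hk _] ->.
- move=> x y /mapP[k]; rewrite mem_iota => kq -> /mapP[l].
  by rewrite mem_iota => lq -> /hinj ->.
- move=> x x0; have [|i iq e] := @surj _ _ _ _ f (cos x).
    by exists x => //; apply/ballP.
  exists (h i); first by apply/mapP; exists i => //; rewrite mem_iota.
  by apply/cosP; have [_ ->] := hP i iq.
Qed.

Lemma resq_gt1 : (1 < resq F)%N.
Proof.
have [s [_ sA sE sS] <-] := residue_transversal.
have [x xs x0] := sS 0 (ball0 0); have [y ys y1] := sS 1 ball1.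
case: s sA sE {sS} xs ys => [|a [|b s]] //= sA sE.
rewrite !inE => /eqP xa /eqP ya; subst x y.
have [_ Es Et] := cong_equiv 1.
have := Et _ _ _ y1 (Es _ _ x0).
by rewrite /cong subr0 ballE ?oner_neq0 // ord1.
Qed.

Lemma exists_uniformizer : exists2 w : F, w != 0 & v w = 1.
Proof. exact: ord_surj. Qed.

(** Digit expansions: representatives of p^a / p^(b+1) are x + w^b d with x a
    representative of p^a / p^b and d one of o / p. *)
Lemma ball_transversal a b : a <= b ->
  exists2 s, transversal (cong b) [set x | ball a x] s
  & size s = (resq F ^ `|b - a|)%N.
Proof.
move=> ab; have [w w0 w1] := exists_uniformizer.
have [D [uD DA DE DS] sD] := residue_transversal.
have [k ->] : exists k : nat, b = a + k%:Z by exists `|b - a|%N; lia.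
have -> : absz (a + k%:Z - a)%R = k by lia.
elim: k {ab} => [|k [s [us sA sE sS] ss]].
  exists [:: 0] => //; split => //= [x|x y|x].
  - by rewrite inE => /eqP ->; exact: ball0.
  - by rewrite !inE => /eqP -> /eqP ->.
  by move=> /= ax; exists 0; rewrite ?inE // /cong !subr0.
pose c := w ^ (a + k%:Z); have c0 : c != 0 by rewrite expfz_neq0.
have vc : v c = a + k%:Z by rewrite ordXz // w1 mul1r.
have csub d : ball 0 d -> ball (a + k%:Z) (c * d).
  by move=> ?; rewrite ball_Ml // vc subrr.
have key x x' d d' : x \in s -> x' \in s -> d \in D -> d' \in D ->
    cong (a + k.+1%:Z) (x + c * d) (x' + c * d') -> x = x' /\ d = d'.
  move=> xs xs' ds ds' h.
  have e : x = x'.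
    apply: sE => //; rewrite /cong.
    have -> : x - x' = (x + c * d - (x' + c * d')) + (c * d' - c * d) by ring.
    by apply: ballD; [apply: ballW h; lia|apply: ballB; apply/csub/DA].
  split=> //; apply: DE => //; rewrite /cong; move: h; rewrite /cong e.
  have -> : x' + c * d - (x' + c * d') = c * (d - d') by ring.
  by rewrite ball_Ml // vc; apply: ballW; lia.
exists [seq x + c * d | x <- s, d <- D]; last first.
  by rewrite size_allpairs ss sD expnSr.
split.
- apply: allpairs_uniq => // -[x d] [x' d'].
  move=> /allpairsP[[? ?] /= [xs ds [-> ->]]] /allpairsP[[? ?] /= [xs' ds' [-> ->]]].
  move=> e; have [|-> ->] // := @key _ _ _ _ xs xs' ds ds'.
  by rewrite /cong e subrr ball0.
- move=> x /allpairsP[[y d] /= [ys ds ->]]; apply: ballD; first exact: sA.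
  by apply: ballW (csub _ (DA _ ds)); lia.
- move=> x y /allpairsP[[x1 d] /= [xs ds ->]] /allpairsP[[y1 d'] /= [ys ds' ->]].
  by move=> /key[]// -> ->.
- move=> x ax; have [y ys xy] := sS x ax.
  have [|d ds hd] := DS ((x - y) / c).
    by rewrite /= ball_Mr ?invr_eq0 // ordV // vc opprK add0r.
  exists (y + c * d); first by apply/allpairsP; exists (y, d).
  rewrite /cong; have -> : x - (y + c * d) = c * ((x - y) / c - d).
    by rewrite mulrBr mulrCA divff //; ring.
  rewrite ball_Ml // vc; apply: ballW hd; lia.
Qed.

(** The empty list is a junk value for b < a. *)
Definition reps a b : seq F :=
  if pselect (exists2 s, transversal (cong b) [set x | ball a x] s
      & size s = (resq F ^ `|b - a|)%N) is left e
  then projT1 (cid2 e) else [::].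

Lemma repsP a b : a <= b -> transversal (cong b) [set x | ball a x] (reps a b).
Proof.
move=> /ball_transversal e; rewrite /reps; case: pselect => // e'.
by case: (cid2 e').
Qed.

Lemma size_reps a b : a <= b -> size (reps a b) = (resq F ^ `|b - a|)%N.
Proof.
move=> /ball_transversal e; rewrite /reps; case: pselect => // e'.
by case: (cid2 e').
Qed.

Lemma mem_reps a b x : a <= b -> x \in reps a b -> ball a x.
Proof. by move=> /repsP[_ h _ _] /h. Qed.

End LocalFieldTheory.

(** * Sums over finite quotients of F *)

(** Reindexing the sum by h multiplies it by zeta. *)
Lemma transversal_kill (C : fieldType) (T : eqType) (E : T -> T -> Prop)
    (A : set T) (s : seq T) (h : T -> T) (f : T -> C) (zeta : C) :
  equivalence E -> transversal E A s -> transversal E A (map h s) ->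
  (forall x y, A x -> A y -> E x y -> f x = f y) ->
  (forall x, A x -> f (h x) = zeta * f x) -> zeta != 1 ->
  \sum_(x <- s) f x = 0.
Proof.
move=> Ee sA hsA fE fh z1.
have := transversal_sum Ee sA hsA fE; rewrite big_map.
have -> : \sum_(x <- s) f (h x) = zeta * \sum_(x <- s) f x.
  rewrite mulr_sumr [LHS]big_seq [RHS]big_seq; apply: eq_bigr => x xs.
  by apply: fh; case: sA => _ /(_ _ xs).
move=> /eqP; rewrite -subr_eq0 -{1}[X in X - _]mul1r -mulrBl mulf_eq0.
by rewrite subr_eq0 eq_sym (negbTE z1) /= => /eqP.
Qed.

Section BallSums.
Variables (F : localField) (C : numFieldType).
Implicit Types (x y z w : F) (a b : int).
Local Notation v := (@ord F).
Local Notation q := ((resq F)%:R : C).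

Lemma q_neq0 : q != 0.
Proof. by rewrite pnatr_eq0 -lt0n ltnW ?resq_gt1. Qed.

Lemma sum1_reps a b : a <= b -> \sum_(x <- reps F a b) (1 : C) = q ^ (b - a).
Proof.
move=> ab; rewrite big_const_seq count_predT size_reps // iter_addr_0.
rewrite natrX -[in RHS](gez0_abs (_ : 0 <= b - a)) ?subr_ge0 //.
Qed.

Lemma sum_reps_sub a a' b (f : F -> C) : a <= a' -> a' <= b ->
  (forall x y, ball a' x -> ball a' y -> cong b x y -> f x = f y) ->
  \sum_(x <- reps F a b | ball a' x) f x = \sum_(x <- reps F a' b) f x.
Proof.
move=> aa' a'b fE; rewrite -big_filter.
apply: (transversal_sum (cong_equiv F b) _ (repsP F a'b) fE).
have := @transversal_filter _ _ _ (fun x => ball a' x) _ (repsP F (le_trans aa' a'b)).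
move=> /(_ (fun x y _ _ => @cong_ball F b a' x y a'b)).
congr (transversal _ _ _); apply/seteqP; split=> x /= => [[]//|h].
by split=> //; exact: ballW h.
Qed.

Definition unramified_char (chi : F -> C) : Prop :=
  [/\ forall x y, chi (x + y) = chi x * chi y,
      forall x, ball 0 x -> chi x = 1
    & exists2 x, ball (-1) x & chi x != 1].

Variable chi : F -> C.
Hypothesis hchi : unramified_char chi.

(** The character x |-> chi (c x) is trivial on p^a' when 0 <= v c + a'; when
    it is not, translation by a point where it differs from 1 kills the sum.
    For a' < a the indicator is constant on p^a, whence the last hypothesis. *)
Lemma sum_char (a a' b : int) (c : F) : c != 0 -> a <= b -> a' <= b -> 0 <= v c + b ->
  a <= a' \/ v c + a < 0 ->
  \sum_(x <- reps F a b) chi (c * x) * (ball a' x)%:R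
    = q ^ (b - a') * (0 <= v c + a')%R%:R.
Proof.
case: hchi => chiD chi1 [x0 hx0 x01] c0.
have main a1 : a1 <= b -> 0 <= v c + b ->
    \sum_(x <- reps F a1 b) chi (c * x) = q ^ (b - a1) * (0 <= v c + a1)%R%:R.
  move=> ab vcb; case: (lerP 0 (v c + a1)) => h.
    rewrite mulr1 -sum1_reps // big_seq [RHS]big_seq; apply: eq_bigr => x.
    by move=> /(mem_reps ab) hx; rewrite chi1 // ball_Ml //; apply: ballW hx; lia.
  rewrite mulr0; have cK : c * (x0 / c) = x0 by rewrite mulrCA divff ?mulr1.
  have hs : ball a1 (x0 / c).
    by rewrite ball_Mr ?invr_eq0 // ordV //; apply: ballW hx0; lia.
  have inv x y : cong b x y -> chi (c * x) = chi (c * y).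
    move=> e; rewrite -(subrK y x) mulrDr chiD chi1 ?mul1r // ball_Ml //.
    by apply: ballW e; lia.
  apply: (@transversal_kill _ _ _ _ _ (fun x => x + x0 / c) _ (chi x0)
    (cong_equiv F b) (repsP F ab)) => //.
  - apply: transversal_map (cong_equiv F b) (cong_equiv F b) (repsP F ab) _ _ _ => /=.
    + by move=> x hx; exact: ballD.
    + move=> x y _ _; rewrite /cong.
      by have -> : x + x0 / c - (y + x0 / c) = x - y by ring.
    + move=> y hy; exists (y - x0 / c); first exact: ballB.
      by rewrite subrK /cong subrr ball0.
  - by move=> x y _ _; exact: inv.
  - by move=> x _; rewrite mulrDr cK chiD mulrC.
move=> ab a'b vcb haa.
case: (lerP a a') => h.
  rewrite -main // -(@sum_reps_sub a) //; last first.
    move=> x y _ _ e; rewrite -(subrK y x) mulrDr chiD chi1 ?mul1r // ball_Ml //.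
    by apply: ballW e; lia.
  rewrite [RHS]big_mkcond /=; apply: eq_bigr => x _.
  by case: ifP; rewrite ?mulr1 ?mulr0.
have va : v c + a < 0 by case: haa => //; lia.
have -> : (0 <= v c + a') = false by lia.
have e : q ^ (b - a) * (0 <= v c + a)%R%:R = 0 :> C.
  have -> : (0 <= v c + a) = false by lia.
  by rewrite mulr0.
rewrite mulr0 -[RHS]e -main // [LHS]big_seq [RHS]big_seq.
apply: eq_bigr => x /(mem_reps ab) hx.
by rewrite (@ballW F a a') ?mulr1 //; lia.
Qed.

End BallSums.

(** ** Shells *)

Section Shells.
Variables (F : localField) (C : numFieldType).
Implicit Types (x y z : F).
Local Notation v := (@ord F).
Local Notation q := ((resq F)%:R : C).

Definition shell (k : int) z : bool := (z != 0) && (v z == k).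

Lemma shellE k z : shell k z = ball k z && ~~ ball (k + 1) z.
Proof.
rewrite /shell; have [->|z0] := eqVneq z 0; first by rewrite !ball0.
by rewrite !ballE //=; lia.
Qed.

Lemma shell_cong r k x y : k < r -> cong r x y -> shell k x = shell k y.
Proof.
by move=> kr e; rewrite !shellE !(@cong_ball F r _ x y) //; lia.
Qed.

Lemma shell_transversal (a r k : int) : a <= k -> k < r ->
  transversal (cong r) [set z | shell k z] [seq z <- reps F a r | shell k z].
Proof.
move=> ak kr; have ar : a <= r by lia.
have := @transversal_filter _ _ _ (shell k) _ (repsP F ar).
move=> /(_ (fun x y _ _ => @shell_cong r k x y kr)).
congr (transversal _ _ _); apply/seteqP; split=> z /= => [[]//|h].
split=> //; move: h; rewrite shellE => /andP[h _]; exact: ballW h.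
Qed.

Lemma sum_shell (a r k : int) (f : F -> C) :
  a <= k -> k < r ->
  \sum_(z <- reps F a r | shell k z) f z =
  \sum_(z <- reps F a r | ball k z) f z - \sum_(z <- reps F a r | ball (k + 1) z) f z.
Proof.
move=> ak kr; rewrite [X in _ = X - _](bigID (fun z => ball (k + 1) z)) /=.
rewrite [X in _ = _ + X - _](eq_bigl (shell k)); last first.
  by move=> z; rewrite shellE.
rewrite [X in _ = X + _ - _](eq_bigl (fun z => ball (k + 1) z)); last first.
  by move=> z; apply: andb_idl; apply: ballW; lia.
by rewrite addrAC subrr add0r.
Qed.

Lemma card_shell (a r k : int) : a <= k -> k < r ->
  \sum_(z <- reps F a r | shell k z) 1 = q ^ (r - k - 1) * (q - 1).
Proof.
move=> ak kr; rewrite sum_shell //.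
rewrite !(@sum_reps_sub F C) //; try lia.
rewrite !sum1_reps; try lia.
have -> : q ^ (r - k) = q ^ (r - k - 1) * q.
  by rewrite -{3}[q]expr1z -expfzDr ?q_neq0 // subrK.
have -> : r - (k + 1) = r - k - 1 by ring.
by rewrite mulrBr mulr1.
Qed.

End Shells.

(** * The newform on the big cell and its integral along the centre of U *)

Section BigCell.
Variables (F : localField) (C : numFieldType).
Implicit Types (x y z w : F).
Local Notation v := (@ord F).
Local Notation q := ((resq F)%:R : C).
Variables (n : nat) (theta : C) (mu : F -> C).
Hypothesis n0 : (0 < n)%N.
Hypothesis theta0 : theta != 0.
Hypothesis muM : forall x y, x != 0 -> y != 0 -> mu (x * y) = mu x * mu y.
Hypothesis mu_n : forall x, ball n%:Z (x - 1) -> mu x = 1.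
Hypothesis mu_prim : exists a : F,
  [/\ a != 0, v a = 0, ball (n%:Z - 1) (a - 1) & mu a != 1].

(** The value at w0 (um x y z) of the newform that takes the value 1 at 1. It is
    read off from the last row (1, x, z) of that matrix and from the minors
    -1, -y, z - x y of its last two rows. *)
Definition bigcell x y z : C :=
  if ball 0 z then (ball n%:Z x && ball 0 y)%:R
  else if [&& ball (n%:Z + v z) x, z - x * y != 0, v (z - x * y) <= 0
            & ball (v (z - x * y)) y]
       then theta ^ (- v z - v (z - x * y)) * mu ((z - x * y) / z)
       else 0.

Let cong_sub1 (r : int) x y : cong r x y -> cong r (1 - x) (1 - y).
Proof.
rewrite /cong; have -> : 1 - x - (1 - y) = y - x by ring.
by rewrite ballBC.
Qed.

(* The values of bigcell along the shell ord z = -k in the coordinate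
   w = (z - x * y) / z: the second valuation in bigcell is ord w - k. *)
Let g (y : F) (k : int) w : C :=
  if [&& w != 0, v w <= k & ball (v w - k) y]
  then theta ^ (2 * k - v w) * mu w else 0.

Let g_bigcell x y z (k : int) : 0 < k -> z != 0 -> v z = - k ->
  ball (n%:Z - k) x -> bigcell x y z = g y k (1 - x * y / z).
Proof.
move=> k0 z0 vz hx; rewrite /bigcell /g ballE // vz.
have -> : (0 <= - k) = false by lia.
rewrite hx /=; have e : z - x * y = z * (1 - x * y / z).
  by rewrite mulrBr mulr1 mulrCA divff // mulr1.
have [w0|w0] := eqVneq (1 - x * y / z) 0; first by rewrite e w0 mulr0 eqxx.
rewrite e mulf_neq0 // ordM // vz /= [z * _ / z]mulrAC divff // mul1r.
have -> : (- k + v (1 - x * y / z) <= 0) = (v (1 - x * y / z) <= k) by lia.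
have -> : - k + v (1 - x * y / z) = v (1 - x * y / z) - k by ring.
by have -> : - - k - (v (1 - x * y / z) - k) = 2 * k - v (1 - x * y / z) by ring.
Qed.

(* mu is constant on w (1 + p^n). *)
Let g_cong y k w1 w2 : w1 != 0 -> cong (v w1 + n%:Z) w1 w2 -> g y k w1 = g y k w2.
Proof.
move=> w10; rewrite /cong ballBC => h.
have [w20 v2] : w2 != 0 /\ v w2 = v w1.
  rewrite -(subrK w1 w2) addrC; apply: ord_add => //; apply: ballW h; lia.
have e : w2 = w1 * (w2 / w1) by rewrite mulrCA divff // mulr1.
have hu : ball n%:Z (w2 / w1 - 1).
  rewrite -[X in _ - X](divff w10) -mulrBl ball_Mr ?invr_eq0 // ordV //.
  by apply: ballW h; lia.
have muE : mu w2 = mu w1.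
  by rewrite e muM ?mulf_neq0 ?invr_eq0 // (mu_n hu) mulr1.
by rewrite /g v2 w10 w20 muE.
Qed.

(* g vanishes beyond ord w = k, so that a fixed modulus suffices. *)
Let g_cong_far y k w1 w2 : cong (k + n%:Z) w1 w2 -> g y k w1 = g y k w2.
Proof.
move=> h; have h1 : cong (k + 1) w1 w2 by apply: ballW h; lia.
case: (boolP (ball (k + 1) w1)) => b1; last first.
  have [w10 v1] := notball b1; apply: g_cong => //; apply: ballW h; lia.
have b2 : ball (k + 1) w2 by rewrite -(cong_ball (lexx _) h1).
have z w : ball (k + 1) w -> g y k w = 0.
  rewrite /g => hw; have [//|w0] := eqVneq w 0; move: hw; rewrite ballE // => hw.
  by have -> : (v w <= k) = false by lia.
by rewrite !z.
Qed.

Let g_scale y k a w : a != 0 -> v a = 0 -> g y k (a * w) = mu a * g y k w.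
Proof.
move=> a0 va; rewrite /g; have [->|w0] := eqVneq w 0.
  by rewrite mulr0 eqxx mulr0.
rewrite mulf_neq0 // ordM // va add0r /=; case: ifP => _; last by rewrite mulr0.
by rewrite muM // mulrCA.
Qed.

Let g_near1 y k w : 0 <= k -> ball n%:Z (w - 1) ->
  g y k w = (ball (- k) y)%:R * theta ^ (2 * k).
Proof.
move=> k0 hw; have [w0 vw] := @ord_near1 F n%:Z w n0 hw.
rewrite /g w0 vw k0 /= sub0r subr0 mu_n // mulr1.
by case: ifP; rewrite ?mul1r ?mul0r.
Qed.

(* Multiplication by a unit a of 1 + p^(n-1) with mu a != 1 permutes A and
   multiplies g by mu a. *)
Let g_kill y k (r : int) (A : set F) (s : seq F) :
  transversal (cong r) A s ->
  (forall x w, A x -> A w -> cong r x w -> g y k x = g y k w) ->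
  (forall a w, a != 0 -> v a = 0 -> ball (n%:Z - 1) (a - 1) -> A w -> A (a * w)) ->
  \sum_(w <- s) g y k w = 0.
Proof.
move=> sA gA aA; have [a [a0 va ha mua]] := mu_prim.
have aV : ball (n%:Z - 1) (a^-1 - 1).
  have -> : a^-1 - 1 = a^-1 * (1 - a) by rewrite mulrBr mulr1 mulVf.
  by rewrite ball_Ml ?invr_eq0 // ordV // va oppr0 subr0 ballBC.
apply: (@transversal_kill C F (cong r) A s (fun w => a * w) _ (mu a)) => //.
- exact: cong_equiv.
- apply: transversal_map (cong_equiv F r) (cong_equiv F r) sA _ _ _.
  + by move=> w Aw; exact: aA.
  + by move=> x w _ _; rewrite /cong -mulrBr ball_Ml // va subr0.
  + move=> w Aw; exists (a^-1 * w).
      by apply: aA => //; [rewrite invr_eq0|rewrite ordV // va oppr0].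
    by rewrite mulVKf // /cong subrr ball0.
- by move=> w _; exact: g_scale.
Qed.

(* z -> 1 - x * y / z maps the shell ord z = -k bijectively onto the shell
   ord (1 - w) = ord (x * y) + k, multiplying distances by
   q^(-ord (x * y) - 2 k). *)
Let shell_invert (c : F) (a r k : int) : c != 0 -> a <= - k -> - k < r ->
  transversal (cong (r + v c + 2 * k)) [set w | shell (v c + k) (1 - w)]
    [seq 1 - c / z | z <- [seq z <- reps F a r | shell (- k) z]].
Proof.
move=> c0 ak kr; apply: transversal_map (cong_equiv F _) (cong_equiv F _)
    (shell_transversal F ak kr) _ _ _ => /=.
- move=> z /andP[z0 /eqP vz]; rewrite subKr /shell mulf_neq0 ?invr_eq0 //=.
  by rewrite ord_div // vz opprK.
- move=> x y /andP[x0 /eqP vx] /andP[y0 /eqP vy]; rewrite /cong.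
  have -> : 1 - c / x - (1 - c / y) = c / (x * y) * (x - y).
    by field; rewrite x0 y0.
  rewrite ball_Ml ?mulf_neq0 ?invr_eq0 ?mulf_neq0 // ord_div ?mulf_neq0 //.
  rewrite ordM // vx vy.
  by have -> : r + v c + 2 * k - (v c - (- k + - k)) = r by ring.
- move=> w /andP[w0 /eqP vw]; exists (c / (1 - w)).
    by rewrite /shell mulf_neq0 ?invr_eq0 //= ord_div // vw; apply/eqP; ring.
  have -> : 1 - c / (c / (1 - w)) = w by field; rewrite w0 c0.
  by rewrite /cong subrr ball0.
Qed.

(** In the coordinate w = 1 - x y / z the shell ord z = -k becomes
    ord (1 - w) = e with e = ord (x y) + k. For e >= n the character mu (w) is
    trivial and the summand is constant. For e <= n - 2 the shell is stable
    under the units in 1 + p^(n-1), on which mu is nontrivial, and the sum is 0. For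
    e = n - 1 the shell is the ball 1 + p^(n-1), which contributes 0 for the
    same reason, minus the ball 1 + p^n, on which the summand is constant. The
    two indicators in x y record these three cases. *)
Lemma sum_bigcell_shell (M r k : int) x y :
  0 < k -> k <= M -> n%:Z <= r ->
  \sum_(z <- reps F (- M) r | shell (- k) z) bigcell x y z =
  theta ^ (2 * k) * q ^ (r + k - 1) *
  ((ball (n%:Z - k) x)%:R * (ball (- k) y)%:R *
   (q * (ball (n%:Z - k) (x * y))%:R - (ball (n%:Z - k - 1) (x * y))%:R)).
Proof.
move=> k0 kM nr; have Mk : - M <= - k by lia.
have kr : - k < r by lia.
case: (boolP (ball (n%:Z - k) x)) => hx; last first.
  rewrite /= mulr0n !mul0r mulr0 big1 // => z /andP[z0 /eqP vz].
  rewrite /bigcell ballE // vz (negbTE hx) /=.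
  by have -> : (0 <= - k) = false by lia.
rewrite (eq_bigr (fun z => g y k (1 - x * y / z))); last first.
  by move=> z /andP[z0 /eqP vz]; exact: g_bigcell.
set c := x * y; case: (boolP (ball (n%:Z - k) c)) => hc.
  (* e >= n *)
  rewrite (@ballW F (n%:Z - k) (n%:Z - k - 1)) //; last by lia.
  rewrite (eq_bigr (fun z => 1 * ((ball (- k) y)%:R * theta ^ (2 * k)))).
    rewrite -mulr_suml card_shell //.
    have -> : r - - k - 1 = r + k - 1 by ring.
    by rewrite /= !mulr1n; ring.
  move=> z /andP[z0 /eqP vz]; rewrite mul1r g_near1 //; first lia.
  rewrite addrAC subrr add0r ballN ball_Mr ?invr_eq0 // ordV // vz.
  by apply: ballW hc; lia.
have [c0 vc] := notball hc.
pose e := v c + k; have en : e < n%:Z by rewrite /e; lia.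
rewrite /= mulr0n mulr0 sub0r -big_filter -(big_map (fun z => 1 - c / z) xpredT (g y k)).
have := shell_invert c0 Mk kr; rewrite -/e; set s := map _ _; set r' := r + _ + _.
move=> sA; rewrite /= ?mulr1n ?mul1r.
case: (lerP e (n%:Z - 2)) => e2.
  (* e <= n - 2 *)
  have -> : ball (n%:Z - k - 1) c = false.
    by rewrite ballE //; apply/negbTE; rewrite /e in e2; lia.
  rewrite mulr0n oppr0 !mulr0; apply: g_kill sA _ _ => /=.
    move=> w1 w2; rewrite /shell => /andP[w10 /eqP v1] _ h.
    have r'E : r' = r + e + k by rewrite /r' /e; ring.
    case: (lerP 0 e) => e0; first by apply: g_cong_far; apply: ballW h; lia.
    have [wN v1'] : w1 != 0 /\ v w1 = e.
      have [] := @ord_add F (- (1 - w1)) 1; rewrite ?oppr_eq0 // ?ordN ?v1.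
        by rewrite ballE ?oner_neq0 // ord1; lia.
      by rewrite opprB subrK.
    by apply: g_cong => //; apply: ballW h; rewrite v1'; lia.
  move=> a w a0 va ha /andP[w0 /eqP vw].
  have -> : 1 - a * w = (1 - w) - (a - 1) * w by ring.
  rewrite /shell; case: (lerP 0 e) => e0.
    have [] := @ord_add F (1 - w) (- ((a - 1) * w)) w0.
      rewrite ballN vw; apply: ballW (_ : ball (n%:Z - 1) _); first lia.
      apply: ballMr => //; rewrite -[w](subKr 1); apply: ballB; first exact: ball1.
      by rewrite ballE // vw.
    by move=> -> ->; rewrite vw eqxx.
  have [wN v1'] : w != 0 /\ v w = e.
    have [] := @ord_add F (- (1 - w)) 1; rewrite ?oppr_eq0 // ?ordN ?vw.
      by rewrite ballE ?oner_neq0 // ord1; lia.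
    by rewrite opprB subrK.
  have -> : 1 - w - (a - 1) * w = - (a * w) + 1 by ring.
  have [] := @ord_add F (- (a * w)) 1; rewrite ?oppr_eq0 ?mulf_neq0 //.
    by rewrite ordN ordM // va v1' ballE ?oner_neq0 // ord1; lia.
  by move=> -> ->; rewrite ordN ordM // va v1' add0r eqxx.
(* e = n - 1 *)
have eE : e = n%:Z - 1 by lia.
have r'E : r' = r + k + (n%:Z - 1) by rewrite -eE /r' /e; ring.
have -> : ball (n%:Z - k - 1) c by rewrite ballE // -/e; move: eE; rewrite /e; lia.
have er' : e <= r' by lia.
have nr' : n%:Z <= r' by lia.
have gA x1 x2 : cong r' x1 x2 -> g y k x1 = g y k x2.
  by move=> h; apply: g_cong_far; apply: ballW h; lia.
have tB b : b <= r' ->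
    transversal (cong r') [set w | ball b (1 - w)] [seq 1 - z | z <- reps F b r'].
  move=> br'; apply: transversal_map (cong_equiv F _) (cong_equiv F _)
    (repsP F br') _ _ _ => /= [z|z1 z2 _ _|w hw]; first by rewrite subKr.
    split=> [/cong_sub1|]; last exact: cong_sub1.
    by rewrite !subKr.
  by exists (1 - w) => //; rewrite subKr /cong subrr ball0.
have tS : transversal (cong r') [set w | shell e (1 - w)]
    [seq w <- [seq 1 - z | z <- reps F e r'] | shell e (1 - w)].
  have hP (w1 w2 : F) : [set w | ball e (1 - w)] w1 ->
      [set w | ball e (1 - w)] w2 -> cong r' w1 w2 ->
      shell e (1 - w1) = shell e (1 - w2).
    move=> _ _ h; apply: (@shell_cong F r'); first lia.
    exact: cong_sub1.
  have := transversal_filter (p := fun w => shell e (1 - w)) (tB e er') hP.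
  congr (transversal _ _ _); apply/seteqP; split=> w /= => [[]//|h].
  by split=> //; move: h; rewrite shellE => /andP[].
rewrite (transversal_sum (cong_equiv F r') sA tS (fun x1 x2 _ _ => @gA x1 x2)).
have k1 : \sum_(w <- [seq 1 - z | z <- reps F e r']) g y k w = 0.
  apply: g_kill (tB _ er') _ _ => /= [x1 x2 _ _|a w a0 va ha hw]; first exact: gA.
  have -> : 1 - a * w = (1 - w) - (a - 1) * w by ring.
  apply: ballB => //; rewrite eE; apply: ballMr => //.
  rewrite -[w](subKr 1); apply: ballB; first exact: ball1.
  by apply: ballW hw; lia.
rewrite big_filter big_map.
have := @sum_shell F C e r' e (fun z => g y k (1 - z)) (lexx _).
under eq_bigl do rewrite subKr.
move=> ->; last lia.
rewrite (@sum_reps_sub F C) //; last first.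
  by move=> x1 x2 _ _ h; apply: gA; exact: cong_sub1.
move: k1; rewrite big_map => ->; rewrite eE subrK sub0r.
rewrite (@sum_reps_sub F C) //; [|lia|]; last first.
  by move=> x1 x2 _ _ h; apply: gA; exact: cong_sub1.
have -> : \sum_(z <- reps F n%:Z r') g y k (1 - z) =
    \sum_(z <- reps F n%:Z r') 1 * ((ball (- k) y)%:R * theta ^ (2 * k)).
  rewrite [LHS]big_seq [RHS]big_seq; apply: eq_bigr => z /(mem_reps nr') hz.
  by rewrite mul1r g_near1 //; [lia|rewrite addrAC subrr add0r ballN].
rewrite -mulr_suml sum1_reps //.
have -> : r' - n%:Z = r + k - 1 by rewrite r'E; ring.
by rewrite /= ?mulr1n; ring.
Qed.

End BigCell.

(** ** The integral over the other two coordinates *)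

Section JacquetSum.
Variables (F : localField) (C : numFieldType).
Implicit Types (x y z w : F).
Local Notation v := (@ord F).
Local Notation q := ((resq F)%:R : C).
Variables (n : nat) (theta : C) (mu : F -> C).
Hypothesis n0 : (0 < n)%N.
Hypothesis theta0 : theta != 0.
Hypothesis muM : forall x y, x != 0 -> y != 0 -> mu (x * y) = mu x * mu y.
Hypothesis mu_n : forall x, ball n%:Z (x - 1) -> mu x = 1.
Hypothesis mu_prim : exists a : F,
  [/\ a != 0, v a = 0, ball (n%:Z - 1) (a - 1) & mu a != 1].
Variables (chi : F -> C) (m r : nat) (c1 c2 : F).
Hypothesis hchi : unramified_char chi.
Hypothesis nr : (n < r)%N.
Hypothesis c10 : c1 != 0.
Hypothesis vc1 : v c1 = m%:Z - n%:Z.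
Hypothesis c20 : c2 != 0.
Hypothesis vc2 : v c2 = m%:Z.

Local Notation bigcell := (bigcell n theta mu).
Let A : int := r%:Z + m%:Z - n%:Z.
Let B : int := r%:Z + m%:Z.
Let M : nat := `|A + B|.

Let ME : M%:Z = A + B.
Proof. by rewrite /M /A /B; lia. Qed.

(** p^(-N) is the disjoint union of o and of the shells of valuation -1, ..., -N. *)
Lemma ball_shell_split (N : nat) z : ball (- N%:Z) z ->
  (1 : C) = (ball 0 z)%:R + \sum_(1 <= k < N.+1) (shell (- k%:Z) z)%:R.
Proof.
elim: N => [|N IH]; first by rewrite oppr0 => ->; rewrite big_geq // addr0.
case: (boolP (ball (- N%:Z) z)) => hz hz1.
  rewrite big_nat_recr //= addrA -IH // /shell.
  have -> : (z != 0) && (v z == - N.+1%:Z) = false.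
    by have [//|z0] := eqVneq z 0; move: hz; rewrite ballE // => hz; lia.
  by rewrite addr0.
have [z0 vz] := notball hz; move: hz1; rewrite ballE // => hz1.
rewrite ballE //; have -> : (0 <= v z) = false by lia.
rewrite add0r big_nat_recr //= /shell z0 big_nat big1 ?add0r /=.
  by have -> : v z == - N.+1%:Z by lia.
by move=> k /andP[k1 kN]; have -> : (v z == - k%:Z) = false by lia.
Qed.

Let zsum x y :
  \sum_(z <- reps F (- (A + B)) r) bigcell x y z =
  q ^ r%:Z * ((ball n%:Z x)%:R * (ball 0 y)%:R) +
  \sum_(1 <= k < M.+1) theta ^ (2 * k%:Z) * q ^ (r%:Z + k%:Z - 1) *
  ((ball (n%:Z - k%:Z) x)%:R * (ball (- k%:Z) y)%:R *
   (q * (ball (n%:Z - k%:Z) (x * y))%:R - (ball (n%:Z - k%:Z - 1) (x * y))%:R)).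
Proof.
have ABr : - (A + B) <= r%:Z by rewrite /A /B; lia.
have -> : \sum_(z <- reps F (- (A + B)) r) bigcell x y z =
    \sum_(z <- reps F (- (A + B)) r | ball 0 z) bigcell x y z +
    \sum_(1 <= k < M.+1)
      \sum_(z <- reps F (- (A + B)) r | shell (- k%:Z) z) bigcell x y z.
  rewrite [X in _ = X + _]big_mkcond /=.
  under [X in _ = _ + X]eq_bigr do rewrite big_mkcond /=.
  rewrite exchange_big -big_split /= [LHS]big_seq [RHS]big_seq.
  apply: eq_bigr => z /(mem_reps ABr); rewrite -ME => /ball_shell_split hz.
  rewrite -[LHS]mul1r hz mulrDl mulr_suml; congr (_ + _).
    by case: ifP; rewrite ?mul1r ?mul0r.
  by apply: eq_bigr => k _; case: ifP; rewrite ?mul1r ?mul0r.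
congr (_ + _).
  rewrite (eq_bigr (fun=> 1 * ((ball n%:Z x)%:R * (ball 0 y)%:R))); last first.
    by move=> z hz; rewrite /bigcell hz mul1r -natrM mulnb.
  rewrite (@sum_reps_sub F C) //; last by rewrite /A /B; lia.
  by rewrite -mulr_suml sum1_reps // subr0.
rewrite big_nat [RHS]big_nat; apply: eq_bigr => k /andP[k1 kM].
apply: sum_bigcell_shell => //. all: try (rewrite -ME; lia). all: try lia.
Qed.

Let ysum (j : int) : 0 <= j ->
  \sum_(y <- reps F (- B) r) chi (c2 * y) * (ball (- j) y)%:R
    = q ^ (r%:Z + j) * (j <= m%:Z)%R%:R.
Proof.
move=> j0; rewrite (sum_char hchi) // ?vc2 /B; try lia.
have -> : (0 <= m%:Z - j) = (j <= m%:Z) by lia.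
by rewrite opprK.
Qed.

Let xsum (i : int) : 0 <= i ->
  \sum_(x <- reps F (- A) r) chi (c1 * x) * (ball (n%:Z - i) x)%:R
    = q ^ (r%:Z - n%:Z + i) * (i <= m%:Z)%R%:R.
Proof.
move=> i0; rewrite (sum_char hchi) // ?vc1 /A; try lia.
have -> : (0 <= m%:Z - n%:Z + (n%:Z - i)) = (i <= m%:Z) by lia.
by congr (q ^ _ * _); ring.
Qed.

(* For x of valuation n - i with 1 <= i <= k the two indicators cut out the
   balls p^(i-k) and p^(i-k-1) of y, and q ysum (k - i) = ysum (k - i + 1)
   unless k - i = m; this is why only one shell of x survives besides p^n. *)
Let ysum_shell x (k : nat) : (0 < k)%N -> ball (n%:Z - k%:Z) x ->
  \sum_(y <- reps F (- B) r) chi (c2 * y) * ((ball (- k%:Z) y)%:R *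
   (q * (ball (n%:Z - k%:Z) (x * y))%:R - (ball (n%:Z - k%:Z - 1) (x * y))%:R))
  = q ^ r%:Z * ((q - 1) * q ^ k%:Z * (k <= m)%N%:R * (ball n%:Z x)%:R
     + q ^ m.+1%:Z * (m < k)%N%:R *
       ((ball (n%:Z - (k%:Z - m%:Z)) x)%:R - (ball (n%:Z - (k%:Z - m%:Z - 1)) x)%:R)).
Proof.
move=> k0 hx.
have split_sum p1 p2 : (forall y, (ball (- k%:Z) y)%:R *
   (q * (ball (n%:Z - k%:Z) (x * y))%:R - (ball (n%:Z - k%:Z - 1) (x * y))%:R)
   = q * (ball (- p1) y)%:R - (ball (- p2) y)%:R :> C) -> 0 <= p1 -> 0 <= p2 ->
  \sum_(y <- reps F (- B) r) chi (c2 * y) * ((ball (- k%:Z) y)%:R *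
   (q * (ball (n%:Z - k%:Z) (x * y))%:R - (ball (n%:Z - k%:Z - 1) (x * y))%:R))
  = q * (q ^ (r%:Z + p1) * (p1 <= m%:Z)%R%:R) - q ^ (r%:Z + p2) * (p2 <= m%:Z)%R%:R.
  move=> h p10 p20; rewrite -!ysum // mulr_sumr -sumrB.
  by apply: eq_bigr => y _; rewrite h; ring.
case: (boolP (ball n%:Z x)) => hnx.
  rewrite (split_sum k%:Z k%:Z) //; last first.
    move=> y; case: (boolP (ball (- k%:Z) y)) => hy; last first.
      by rewrite /= mulr0n; ring.
    have hxy : ball (n%:Z - k%:Z) (x * y) by exact: ballM.
    by rewrite hxy (@ballW F _ _ _ _ hxy) /= ?mulr1n; [ring|lia].
  rewrite expfzDr ?q_neq0 // lez_nat; case: (ltnP m k) => mk.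
    rewrite !(@ballW F _ _ _ _ hnx) /= ?mulr1n; try lia.
    by rewrite mulr0n; ring.
  by rewrite /= mulr0n mulr1n; ring.
have [x0 vx] := notball hnx.
have [i iP] : exists i : nat, v x = n%:Z - i%:Z by exists `|n%:Z - v x|%N; lia.
have ik : (i <= k)%N by move: hx; rewrite ballE //; lia.
have i0 : (0 < i)%N by lia.
rewrite (split_sum (k%:Z - i%:Z) (k%:Z - i%:Z + 1)); try lia; last first.
  move=> y; rewrite !ball_Ml // iP.
  have -> : n%:Z - k%:Z - (n%:Z - i%:Z) = - (k%:Z - i%:Z) by ring.
  have -> : n%:Z - k%:Z - 1 - (n%:Z - i%:Z) = - (k%:Z - i%:Z + 1) by ring.
  case: (boolP (ball (- k%:Z) y)) => hy; first by rewrite /= mulr1n mul1r.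
  have nb p : - k%:Z <= p -> ball p y = false.
    by move=> kp; apply: contraNF hy; exact: ballW.
  by rewrite !nb; [rewrite /= mulr0n; ring|lia|lia].
rewrite !ballE // iP /= mulr0n mulr0 add0r.
have -> : q ^ (r%:Z + (k%:Z - i%:Z + 1)) = q * q ^ (r%:Z + (k%:Z - i%:Z)).
  by rewrite addrA expfzDr ?q_neq0 // expr1z mulrC.
have [e|ne] := eqVneq k (i + m)%N.
  have -> : (k%:Z - i%:Z <= m%:Z) by lia.
  have -> : (k%:Z - i%:Z + 1 <= m%:Z) = false by lia.
  have -> : (m < k)%N by lia.
  have -> : (n%:Z - (k%:Z - m%:Z) <= n%:Z - i%:Z) by lia.
  have -> : (n%:Z - (k%:Z - m%:Z - 1) <= n%:Z - i%:Z) = false by lia.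
  have -> : k%:Z - i%:Z = m%:Z by lia.
  rewrite expfzDr ?q_neq0 // -addn1 PoszD expfzDr ?q_neq0 // expr1z.
  by rewrite /= mulr0n mulr1n; ring.
have -> : (k%:Z - i%:Z + 1 <= m%:Z) = (k%:Z - i%:Z <= m%:Z) by lia.
case: (ltnP m k) => mk; last by rewrite /= mulr0n; ring.
have -> : (n%:Z - (k%:Z - m%:Z - 1) <= n%:Z - i%:Z) =
          (n%:Z - (k%:Z - m%:Z) <= n%:Z - i%:Z) by lia.
by ring.
Qed.

Let xysum (k : nat) : (0 < k)%N ->
  \sum_(x <- reps F (- A) r) chi (c1 * x) * ((ball (n%:Z - k%:Z) x)%:R *
  \sum_(y <- reps F (- B) r) chi (c2 * y) * ((ball (- k%:Z) y)%:R *
   (q * (ball (n%:Z - k%:Z) (x * y))%:R - (ball (n%:Z - k%:Z - 1) (x * y))%:R)))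
  = q ^ (2 * r%:Z - n%:Z + k%:Z) *
    ((q - 1) * (k <= 2 * m)%N%:R - (k == (2 * m).+1)%:R).
Proof.
move=> k0; pose b (i : int) x : C := (ball (n%:Z - i) x)%:R.
transitivity (\sum_(x <- reps F (- A) r) (
    q ^ r%:Z * ((q - 1) * q ^ k%:Z * (k <= m)%N%:R) * (chi (c1 * x) * b 0 x)
    + q ^ r%:Z * (q ^ m.+1%:Z * (m < k)%N%:R) * (chi (c1 * x) * b (k%:Z - m%:Z) x)
    - q ^ r%:Z * (q ^ m.+1%:Z * (m < k)%N%:R) * (chi (c1 * x) * b (k%:Z - m%:Z - 1) x))).
  apply: eq_bigr => x _; rewrite /b subr0.
  case: (boolP (ball (n%:Z - k%:Z) x)) => hx.
    by rewrite ysum_shell //= mulr1n; ring.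
  have nb p : n%:Z - k%:Z <= p -> ball p x = false.
    by move=> kp; apply: contraNF hx; exact: ballW.
  rewrite (nb n%:Z); last lia.
  rewrite (nb (n%:Z - (k%:Z - m%:Z))); last lia.
  case: (ltnP m k) => mk; last by rewrite /= mulr0n; ring.
  rewrite (nb (n%:Z - (k%:Z - m%:Z - 1))); last lia.
  by rewrite /= mulr0n; ring.
rewrite sumrB big_split /= -!mulr_sumr xsum //.
have e1 : q ^ (2 * r%:Z - n%:Z + k%:Z) = q ^ r%:Z * q ^ (r%:Z - n%:Z) * q ^ k%:Z.
  by rewrite -!expfzDr ?q_neq0 //; congr (_ ^ _); ring.
case: (ltnP m k) => mk; last first.
  rewrite e1 addr0 /= mulr0n.
  have -> : (k <= 2 * m)%N by lia.
  have -> : (k == (2 * m).+1) = false by lia.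
  by rewrite /= ?mulr0n ?mulr1n; ring.
rewrite !xsum; try lia.
have -> : (k%:Z - m%:Z <= m%:Z) = (k <= 2 * m)%N by lia.
have -> : (k%:Z - m%:Z - 1 <= m%:Z) = (k <= (2 * m).+1)%N by lia.
have e2 : q ^ (r%:Z - n%:Z + (k%:Z - m%:Z)) * q ^ m.+1%:Z
    = q ^ (r%:Z - n%:Z) * q ^ k%:Z * q.
  rewrite -[X in _ = _ * X]expr1z -!expfzDr ?q_neq0 //; congr (_ ^ _); lia.
have e3 : q ^ (r%:Z - n%:Z + (k%:Z - m%:Z - 1)) * q ^ m.+1%:Z
    = q ^ (r%:Z - n%:Z) * q ^ k%:Z.
  by rewrite -!expfzDr ?q_neq0 //; congr (_ ^ _); lia.
rewrite /= mulr0n mulr1n e1.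
set a1 := q ^ (_ + (_ - _)) in e2 *; set a2 := q ^ (_ + (_ - _ - _)) in e3 *.
transitivity (q ^ r%:Z * (a1 * q ^ m.+1%:Z) * (k <= 2 * m)%N%:R
   - q ^ r%:Z * (a2 * q ^ m.+1%:Z) * (k <= (2 * m).+1)%N%:R); first by ring.
rewrite e2 e3 [in RHS]leq_eqVlt.
have -> : (k <= (2 * m).+1)%N%:R = (k <= 2 * m)%N%:R + (k == (2 * m).+1)%:R :> C.
  rewrite [(k <= (2 * m).+1)%N]leq_eqVlt ltnS; case: eqVneq => [->|_] /=.
    by rewrite ltnn mulr0n add0r.
  by rewrite mulr0n addr0.
by rewrite -leq_eqVlt; ring.
Qed.

(** With T = (theta q)^2 the shell ord z = -k contributes T^k (1 - 1/q) for
    1 <= k <= 2 m, then - T^(2m+1) / q, then nothing; together with the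
    contribution 1 of o this is (1 - T / q) (1 + T + ... + T^(2m)). *)
Lemma jacquet_sum :
  \sum_(x <- reps F (- A) r) \sum_(y <- reps F (- B) r)
    \sum_(z <- reps F (- (A + B)) r) chi (c1 * x) * chi (c2 * y) * bigcell x y z
  = q ^ (3 * r%:Z - n%:Z) * (1 - theta ^+ 2 * q) *
    \sum_(l < (2 * m).+1) (theta ^+ 2 * q ^+ 2) ^+ l.
Proof.
set T := theta ^+ 2 * q ^+ 2.
transitivity (\sum_(x <- reps F (- A) r) (
    q ^ r%:Z * (q ^ r%:Z * (chi (c1 * x) * (ball (n%:Z - 0) x)%:R)) +
  \sum_(1 <= k < M.+1) theta ^ (2 * k%:Z) * q ^ (r%:Z + k%:Z - 1) *
  (chi (c1 * x) * ((ball (n%:Z - k%:Z) x)%:R *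
  \sum_(y <- reps F (- B) r) chi (c2 * y) * ((ball (- k%:Z) y)%:R *
   (q * (ball (n%:Z - k%:Z) (x * y))%:R - (ball (n%:Z - k%:Z - 1) (x * y))%:R)))))).
  apply: eq_bigr => x _.
  under eq_bigr do rewrite -mulr_sumr zsum mulrDr mulr_sumr.
  rewrite big_split /= exchange_big /=; congr (_ + _).
    have := ysum (lexx 0); rewrite oppr0 addr0 le0z_nat mulr1 => Y0.
    rewrite -[X in _ = _ * (X * _)]Y0 subr0 mulr_suml mulr_sumr.
    by apply: eq_bigr => y _; ring.
  apply: eq_bigr => k _; rewrite !mulr_sumr; apply: eq_bigr => y _; ring.
rewrite big_split /= -!mulr_sumr xsum // addr0 le0z_nat mulr1 exchange_big /=.
rewrite (eq_big_nat _ _ (F2 := fun k => q ^ (3 * r%:Z - n%:Z) *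
    (T ^+ k * (1 - q^-1) * (k <= 2 * m)%N%:R
      - T ^+ k * q^-1 * (k == (2 * m).+1)%:R))); last first.
  move=> k /andP[k1 kM]; rewrite -mulr_sumr xysum //.
  have -> : 3 * r%:Z - n%:Z = r%:Z + (2 * r%:Z - n%:Z) by ring.
  have -> : q ^ (r%:Z + k%:Z - 1) = q ^ r%:Z * q ^ k%:Z * q^-1.
    by rewrite !expfzDr ?q_neq0 // exprN1.
  rewrite !(expfzDr _ _ (q_neq0 F C)) /T exprMn -!exprM.
  have -> : theta ^ (2 * k%:Z) = theta ^+ (2 * k) by [].
  have -> : q ^+ (2 * k) = q ^ k%:Z * q ^ k%:Z.
    by rewrite -expfzDr ?q_neq0 // mulSn mul1n exprnP PoszD.
  by field; rewrite q_neq0.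
rewrite -big_distrr /= -[X in _ + X]mulrC -{1}[q ^ r%:Z * _]mul1r.
have -> : q ^ r%:Z * (q ^ r%:Z * q ^ (r%:Z - n%:Z)) = q ^ (3 * r%:Z - n%:Z).
  by rewrite -!expfzDr ?q_neq0 //; congr (_ ^ _); ring.
have MM : ((2 * m).+2 <= M.+1)%N by have := ME; rewrite /A /B; lia.
set S := \sum_(l < _) _.
have -> : \sum_(1 <= k < M.+1) (T ^+ k * (1 - q^-1) * (k <= 2 * m)%N%:R
      - T ^+ k * q^-1 * (k == (2 * m).+1)%:R) =
    (S - 1) * (1 - q^-1) - T ^+ (2 * m).+1 * q^-1.
  rewrite (@big_cat_nat _ _ _ (2 * m).+2) //= [X in _ + X]big_nat.
  rewrite [X in _ + X]big1 ?addr0; last first.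
    move=> k /andP[k1 _]; have -> : (k <= 2 * m)%N = false by lia.
    have -> : (k == (2 * m).+1) = false by lia.
    by rewrite /= mulr0n !mulr0 subr0.
  rewrite big_nat_recr //= eqxx ltnn mulr0n mulr1n mulr0 sub0r mulr1; congr (_ - _).
  rewrite /S big_ord_recl expr0 addrAC subrr add0r mulr_suml big_add1 /=.
  rewrite big_mkord; apply: eq_bigr => l _.
  have -> : (l < 2 * m)%N by [].
  have -> : (l.+1 == (2 * m).+1) = false by have := ltn_ord l; lia.
  by rewrite /= mulr0n mulr0 subr0 mulr1n mulr1.
have TS : T ^+ (2 * m).+1 = 1 + (T - 1) * S.
  by rewrite /S -subrX1 addrC subrK.
rewrite TS; have -> : theta ^+ 2 * q = T * q^-1.
  by rewrite /T; field; rewrite q_neq0.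
by field; rewrite q_neq0.
Qed.

End JacquetSum.

(** * Integral matrices *)

Section Matrix3.
Variable F : fieldType.
Implicit Types (A B : 'M[F]_3) (g h : GL3 F).

Definition mx3 (a b c d e f p s t : F) : 'M[F]_3 :=
  \matrix_(i < 3, j < 3) (nth [::] [:: [:: a; b; c]; [:: d; e; f]; [:: p; s; t]] i)`_j.

Lemma mx3E a b c d e f p s t : let A := mx3 a b c d e f p s t in
  (((A 0 0 = a) * (A 0 1 = b) * (A 0 2 = c)) *
  ((A 1 0 = d) * (A 1 1 = e) * (A 1 2 = f)) *
  ((A 2 0 = p) * (A 2 1 = s) * (A 2 2 = t)))%type.
Proof. by rewrite /= !mxE. Qed.

Lemma I3P (P : 'I_3 -> Prop) : P 0 -> P 1 -> P 2 -> forall i, P i.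
Proof.
move=> p0 p1 p2 [[|[|[|//]]] h].
- by rewrite (_ : Ordinal h = 0) //; apply: val_inj.
- by rewrite (_ : Ordinal h = 1) //; apply: val_inj.
- by rewrite (_ : Ordinal h = 2) //; apply: val_inj.
Qed.

Lemma eq_mx3 A B :
  A 0 0 = B 0 0 -> A 0 1 = B 0 1 -> A 0 2 = B 0 2 ->
  A 1 0 = B 1 0 -> A 1 1 = B 1 1 -> A 1 2 = B 1 2 ->
  A 2 0 = B 2 0 -> A 2 1 = B 2 1 -> A 2 2 = B 2 2 -> A = B.
Proof. by move=> *; apply/matrixP; do 2 (apply: I3P). Qed.

Lemma sum3 (V : nmodType) (f : 'I_3 -> V) : \sum_i f i = f 0 + f 1 + f 2.
Proof.
rewrite !big_ord_recl big_ord0 addr0 addrA; congr (_ + f _ + f _);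
  by apply: val_inj.
Qed.

Lemma mulmx3E A B i j : (A *m B) i j = A i 0 * B 0 j + A i 1 * B 1 j + A i 2 * B 2 j.
Proof. by rewrite mxE sum3. Qed.

Lemma mx3_eta A : A = mx3 (A 0 0) (A 0 1) (A 0 2) (A 1 0) (A 1 1) (A 1 2)
  (A 2 0) (A 2 1) (A 2 2).
Proof. by apply: eq_mx3; rewrite mx3E. Qed.

Lemma det3 A : \det A =
  A 0 0 * (A 1 1 * A 2 2 - A 1 2 * A 2 1) -
  A 0 1 * (A 1 0 * A 2 2 - A 1 2 * A 2 0) +
  A 0 2 * (A 1 0 * A 2 1 - A 1 1 * A 2 0).
Proof.
rewrite (expand_det_row _ 0) sum3 /cofactor.
have det2 (X : 'M[F]_2) : \det X = X 0 0 * X 1 1 - X 0 1 * X 1 0.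
  rewrite (expand_det_row _ 0) !big_ord_recl big_ord0 addr0 /cofactor.
  rewrite !det_mx11 !mxE /= expr0 expr1 mul1r mulN1r mulrN.
  by congr (_ * X _ _ - X _ _ * X _ _); apply: val_inj.
rewrite !det2 !mxE /= expr0 expr1 expr2 mulrNN !mul1r mulN1r mulrN.
by congr (_ * (A _ _ * A _ _ - A _ _ * A _ _) - _ * (A _ _ * A _ _ - A _ _ * A _ _)
  + _ * (A _ _ * A _ _ - A _ _ * A _ _)); apply: val_inj.
Qed.

Lemma gl3M g h : gl3_mx (g * h)%g = gl3_mx g *m gl3_mx h.
Proof. by []. Qed.

Lemma gl3V g : gl3_mx (g^-1)%g = invmx (gl3_mx g).
Proof. by []. Qed.

Lemma gl3_det g : \det (gl3_mx g) != 0.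
Proof. by rewrite -unitfE -unitmxE gl3_unit. Qed.

Lemma gl3_inj g h : gl3_mx g = gl3_mx h -> g = h.
Proof. by move=> e; apply: val_inj. Qed.

(** Equal to 1 (a junk value) unless A is invertible. *)
Definition mkGL A : GL3 F := insubd (1%g : GL3 F) A.

Lemma val_mkGL A : \det A != 0 -> gl3_mx (mkGL A) = A.
Proof.
by move=> hA; rewrite /mkGL -[LHS]/(val _) val_insubd unitmxE unitfE hA.
Qed.

Definition um (x y z : F) : GL3 F := mkGL (mx3 1 x z 0 1 y 0 0 1).

Lemma val_um x y z : gl3_mx (um x y z) = mx3 1 x z 0 1 y 0 0 1.
Proof.
apply: val_mkGL; rewrite det3 !mx3E.
by rewrite (_ : _ + _ = 1) ?oner_neq0 //; ring.
Qed.

Definition w0 : GL3 F := mkGL (mx3 0 0 1 0 1 0 1 0 0).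

Lemma val_w0 : gl3_mx w0 = mx3 0 0 1 0 1 0 1 0 0.
Proof.
apply: val_mkGL; rewrite det3 !mx3E.
by rewrite (_ : _ + _ = - 1) ?oppr_eq0 ?oner_neq0 //; ring.
Qed.

Lemma diag3E (a b c : F) : diag3 a b c = mx3 a 0 0 0 b 0 0 0 c.
Proof. by apply: eq_mx3; rewrite !mx3E !mxE /=. Qed.

Lemma val_diag a b c : a != 0 -> b != 0 -> c != 0 ->
  gl3_mx (diagGL a b c) = mx3 a 0 0 0 b 0 0 0 c.
Proof. by move=> *; rewrite val_diagGL // diag3E. Qed.

Lemma borelP g : borel g <-> [/\ g 1 0 = 0, g 2 0 = 0 & g 2 1 = 0].
Proof.
split=> [h|[h10 h20 h21]]; first by split; apply: h.
by do 2 (apply: I3P).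
Qed.

End Matrix3.

Section IntegralMatrices.
Variable F : localField.
Implicit Types (A B : 'M[F]_3) (g h k : GL3 F).
Local Notation v := (@ord F).

Definition ball_mx (r : int) A : Prop := forall i j, ball r (A i j).

Lemma ball_mxW (a b : int) A : b <= a -> ball_mx a A -> ball_mx b A.
Proof. by move=> ba h i j; apply: ballW (h i j). Qed.

Lemma ball_mxD r A B : ball_mx r A -> ball_mx r B -> ball_mx r (A + B).
Proof. by move=> hA hB i j; rewrite mxE; apply: ballD. Qed.

Lemma ball_mxN r A : ball_mx r A -> ball_mx r (- A).
Proof. by move=> hA i j; rewrite mxE ballN. Qed.

Lemma ball_mxM (a b : int) A B :
  ball_mx a A -> ball_mx b B -> ball_mx (a + b) (A *m B).
Proof.
by move=> hA hB i j; rewrite mxE; apply: ball_sum => l _; apply: ballM.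
Qed.

Lemma ball_mxMl r A B : ball_mx 0 A -> ball_mx r B -> ball_mx r (A *m B).
Proof. by move=> hA hB; have := ball_mxM hA hB; rewrite add0r. Qed.

Lemma ball_mxMr r A B : ball_mx r A -> ball_mx 0 B -> ball_mx r (A *m B).
Proof. by move=> hA hB; have := ball_mxM hA hB; rewrite addr0. Qed.

Lemma ball_mx1 : ball_mx 0 1%:M.
Proof. by move=> i j; rewrite mxE; case: eqP => _; rewrite ?ball1 ?ball0. Qed.

Lemma ball_mx3 (r : int) a b c d e f p s t :
  (ball_mx r (mx3 a b c d e f p s t)) <->
  [/\ [/\ ball r a, ball r b & ball r c], [/\ ball r d, ball r e & ball r f]
    & [/\ ball r p, ball r s & ball r t]].
Proof.
split=> [h|[[ha hb hc] [hd he hf] [hp hs ht]]].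
  split; split.
  - by have := h 0 0; rewrite mx3E.
  - by have := h 0 1; rewrite mx3E.
  - by have := h 0 2; rewrite mx3E.
  - by have := h 1 0; rewrite mx3E.
  - by have := h 1 1; rewrite mx3E.
  - by have := h 1 2; rewrite mx3E.
  - by have := h 2 0; rewrite mx3E.
  - by have := h 2 1; rewrite mx3E.
  - by have := h 2 2; rewrite mx3E.
by do 2 (apply: I3P); rewrite mx3E.
Qed.

Lemma ball_det A : ball_mx 0 A -> ball 0 (\det A).
Proof.
by move=> h; rewrite det3; apply: ballD; [apply: ballB|];
  apply: ballMl => //; apply: ballB; apply: ballMl.
Qed.

Lemma ball_invmx A : ball_mx 0 A -> \det A != 0 -> v (\det A) = 0 ->
  ball_mx 0 (invmx A).
Proof.
move=> h d0 vd i j; rewrite /invmx unitmxE unitfE d0 !mxE.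
rewrite ball_Ml ?invr_eq0 // ordV // vd oppr0 subr0 /cofactor.
have sgn (l : nat) : ball 0 ((-1) ^+ l : F).
  by elim: l => [|l IH]; rewrite ?expr0 ?ball1 // exprS mulN1r ballN.
apply: ballMl => //; rewrite /determinant; apply: ball_sum => p _.
by apply: ballMl => //; apply: ball_prod => l _; rewrite !mxE.
Qed.

(** The group GL_3(o). *)
Definition Kint k : Prop := ball_mx 0 (gl3_mx k) /\ ball_mx 0 (invmx (gl3_mx k)).

Lemma KintM k h : Kint k -> Kint h -> Kint (k * h)%g.
Proof.
move=> [k1 k2] [h1 h2]; split; first exact: ball_mxMl.
have -> : invmx (gl3_mx (k * h)%g) = invmx (gl3_mx h) *m invmx (gl3_mx k).
  by rewrite -!gl3V invgM.
exact: ball_mxMl.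
Qed.

Lemma KintV k : Kint k -> Kint (k^-1)%g.
Proof. by move=> [k1 k2]; split => //; rewrite gl3V invmxK. Qed.

Lemma Kint_of_det k : ball_mx 0 (gl3_mx k) -> v (\det (gl3_mx k)) = 0 -> Kint k.
Proof. by move=> h hd; split => //; apply: ball_invmx => //; exact: gl3_det. Qed.

Lemma Kint_det k : Kint k -> v (\det (gl3_mx k)) = 0.
Proof.
move=> [h1 h2].
have aux (d : F) : d != 0 -> ball 0 d -> ball 0 d^-1 -> v d = 0.
  by move=> d0; rewrite !ballE ?invr_eq0 // ordV //; lia.
apply: aux (gl3_det k) (ball_det h1) _.
by have := ball_det h2; rewrite det_inv.
Qed.

(** The principal congruence subgroup of level r, for 1 <= r. *)
Definition Gam (r : int) k : Prop := ball_mx r (gl3_mx k - 1%:M).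

Lemma Gam1 r : Gam r 1%g.
Proof. by move=> i j; rewrite /= subrr mxE ball0. Qed.

Lemma GamW a b k : b <= a -> Gam a k -> Gam b k.
Proof. exact: ball_mxW. Qed.

Lemma Gam_int r k : 0 <= r -> Gam r k -> ball_mx 0 (gl3_mx k).
Proof.
move=> r0 h; rewrite -(subrK 1%:M (gl3_mx k)).
by apply: ball_mxD; [apply: ball_mxW h|exact: ball_mx1].
Qed.

Lemma ball_prod_near (r : int) (x y : F) : 0 <= r -> ball 0 x -> ball r (x - 1) ->
  ball r (y - 1) -> ball r (x * y - 1).
Proof.
move=> r0 hx hx1 hy1; have -> : x * y - 1 = x * (y - 1) + (x - 1) by ring.
by apply: ballD => //; exact: ballMl.
Qed.

(** Modulo p the determinant is that of the identity matrix. *)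
Lemma Gam_Kint r k : 1 <= r -> Gam r k -> Kint k.
Proof.
move=> r1 h; have hi : ball_mx 0 (gl3_mx k) by apply: Gam_int h; lia.
apply: Kint_of_det => //; set A := gl3_mx k in h hi *.
have h1 : ball_mx 1 (A - 1%:M) by apply: ball_mxW h.
have hd i : ball 1 (A i i - 1) by have := h1 i i; rewrite !mxE eqxx.
have ho i j : i != j -> ball 1 (A i j).
  by have := h1 i j; rewrite !mxE => + /negbTE ij; rewrite ij subr0.
suff /ord_near1[] // : ball 1 (\det A - 1) by [].
have -> : \det A - 1 = (A 0 0 * (A 1 1 * A 2 2) - 1)
  - A 0 0 * (A 1 2 * A 2 1) - A 0 1 * (A 1 0 * A 2 2 - A 1 2 * A 2 0)
  + A 0 2 * (A 1 0 * A 2 1 - A 1 1 * A 2 0) by rewrite det3; ring.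
apply: ballD; [apply: ballB; [apply: ballB|]|].
- by do 2 (apply: ball_prod_near => //).
- by apply: ballMl => //; apply: ballMr => //; exact: ho.
- by apply: ballMr; [exact: ho|apply: ballB; apply: ballMl].
- by apply: ballMr; [exact: ho|apply: ballB; apply: ballMl].
Qed.

Lemma GamM r k h : 0 <= r -> Gam r k -> Gam r h -> Gam r (k * h)%g.
Proof.
move=> r0 hk hh; rewrite /Gam gl3M.
have -> : gl3_mx k *m gl3_mx h - 1%:M =
    gl3_mx k *m (gl3_mx h - 1%:M) + (gl3_mx k - 1%:M).
  by rewrite mulmxBr mulmx1 addrA subrK.
by apply: ball_mxD => //; apply: ball_mxMl => //; exact: Gam_int hk.
Qed.

Lemma GamV r k : 1 <= r -> Gam r k -> Gam r (k^-1)%g.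
Proof.
move=> r1 hk; have [_ hi] := Gam_Kint r1 hk; rewrite /Gam gl3V.
have -> : invmx (gl3_mx k) - 1%:M = - (invmx (gl3_mx k) *m (gl3_mx k - 1%:M)).
  by rewrite mulmxBr mulVmx ?gl3_unit // mulmx1 opprB.
by apply: ball_mxN; exact: ball_mxMl.
Qed.

Lemma Gam_conj r k h : Kint h -> Gam r k -> Gam r (h^-1 * k * h)%g.
Proof.
move=> [h1 h2] hk; rewrite /Gam !gl3M gl3V.
have -> : invmx (gl3_mx h) *m gl3_mx k *m gl3_mx h - 1%:M =
    invmx (gl3_mx h) *m (gl3_mx k - 1%:M) *m gl3_mx h.
  by rewrite mulmxBr mulmxBl mulmx1 mulVmx ?gl3_unit.
by apply: ball_mxMr => //; exact: ball_mxMl.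
Qed.

(** M bounds the denominators of g and of its inverse. *)
Lemma Gam_conj_any g : exists M : nat, forall (r : int) k,
  Gam (r + M%:Z) k -> Gam r (g^-1 * k * g)%g.
Proof.
have bnd A : exists M : nat, ball_mx (- M%:Z) A.
  exists (\sum_i \sum_j `|v (A i j)|)%N => i j.
  have [->|a0] := eqVneq (A i j) 0; first exact: ball0.
  rewrite ballE // (bigD1 i) //= (bigD1 j) //=; lia.
have [M1 h1] := bnd (gl3_mx g); have [M2 h2] := bnd (invmx (gl3_mx g)).
exists (M1 + M2)%N => r k hk; rewrite /Gam !gl3M gl3V.
have -> : invmx (gl3_mx g) *m gl3_mx k *m gl3_mx g - 1%:M =
    invmx (gl3_mx g) *m (gl3_mx k - 1%:M) *m gl3_mx g.
  by rewrite mulmxBr mulmxBl mulmx1 mulVmx ?gl3_unit.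
have := ball_mxM (ball_mxM h2 hk) h1.
by apply: ball_mxW; lia.
Qed.

(** ** The Iwasawa decomposition *)

(** One step of the Euclidean algorithm, trivial over a valuation ring: the
    entry of larger valuation is a multiple of the other. *)
Lemma clear_pair (a b : F) : exists p s t u : F,
  [/\ a * p + b * t = 0, p * u - s * t = 1
    & [/\ ball 0 p, ball 0 s, ball 0 t & ball 0 u]].
Proof.
have [->|a0] := eqVneq a 0.
  exists 1, 0, 0, 1; rewrite ball1 ball0 !mul0r mulr0 addr0; split => //; ring.
case: (boolP ((b == 0) || (v a < v b))) => hab.
  exists (- b / a), (-1), 1, 0; rewrite ballN ball1 ball0; split => //.
  - by rewrite mulrCA divff //; ring.
  - by ring.
  - split => //; rewrite mulNr ballN ball_Mr ?invr_eq0 // ordV // opprK add0r.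
    by case/orP: hab => [/eqP ->|hab]; rewrite ?ball0 // /ball; apply/orP; right; lia.
move: hab; rewrite negb_or -leNgt => /andP[b0 hab].
exists 1, 0, (- a / b), 1; rewrite ball1 ball0; split => //.
- by rewrite mulrCA divff //; ring.
- by ring.
- by split => //; rewrite mulNr ballN ballE ?mulf_neq0 ?invr_eq0 // ord_div //; lia.
Qed.

Lemma Kint_mkGL A : ball_mx 0 A -> \det A = 1 -> Kint (mkGL A).
Proof.
move=> hA dA; have e : gl3_mx (mkGL A) = A by rewrite val_mkGL // dA oner_neq0.
by apply: Kint_of_det; rewrite e // dA ord1.
Qed.

(** Integral column operations clear the last row of g, then the middle one. *)
Lemma iwasawa g : exists b k, [/\ borel b, Kint k & g = (b * k)%g].
Proof.
have col01 (a b : F) : exists2 k, Kint k & exists p s t u,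
    gl3_mx k = mx3 p s 0 t u 0 0 0 1 /\ a * p + b * t = 0.
  have [p [s [t [u [h1 h2 [hp hs ht hu]]]]]] := clear_pair a b.
  have dA : \det (mx3 p s 0 t u 0 0 0 1) = 1 by rewrite det3 !mx3E -[RHS]h2; ring.
  exists (mkGL (mx3 p s 0 t u 0 0 0 1)).
    by apply: Kint_mkGL => //; apply/ball_mx3; rewrite !ball0 ball1.
  by exists p, s, t, u; rewrite val_mkGL // dA oner_neq0.
have col12 (a b : F) : exists2 k, Kint k & exists p s t u,
    gl3_mx k = mx3 1 0 0 0 p s 0 t u /\ a * p + b * t = 0.
  have [p [s [t [u [h1 h2 [hp hs ht hu]]]]]] := clear_pair a b.
  have dA : \det (mx3 1 0 0 0 p s 0 t u) = 1 by rewrite det3 !mx3E -[RHS]h2; ring.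
  exists (mkGL (mx3 1 0 0 0 p s 0 t u)).
    by apply: Kint_mkGL => //; apply/ball_mx3; rewrite !ball0 ball1.
  by exists p, s, t, u; rewrite val_mkGL // dA oner_neq0.
have [k1 K1 [p1 [s1 [t1 [u1 [e1 h1]]]]]] := col01 (g 2 0) (g 2 1).
pose g1 := (g * k1)%g.
have [k2 K2 [p2 [s2 [t2 [u2 [e2 h2]]]]]] := col12 (g1 2 1) (g1 2 2).
pose g2 := (g1 * k2)%g.
have [k3 K3 [p3 [s3 [t3 [u3 [e3 h3]]]]]] := col01 (g2 1 0) (g2 1 1).
have z1 : g1 2 0 = 0 by rewrite mulmx3E e1 !mx3E mulr0 addr0.
have z2 : g2 2 0 = 0 by rewrite mulmx3E e2 !mx3E z1; ring.
have z3 : g2 2 1 = 0 by rewrite mulmx3E e2 !mx3E mulr0 add0r.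
pose k := (k1 * k2 * k3)%g.
exists (g * k)%g, (k^-1)%g; split; last by rewrite mulgK.
  have -> : (g * k)%g = (g2 * k3)%g by rewrite /g2 /g1 /k !mulgA.
  apply/borelP; split; rewrite mulmx3E e3 !mx3E.
  - by rewrite mulr0 addr0.
  - by rewrite z2 z3; ring.
  - by rewrite z2 z3; ring.
by apply: KintV; do 2 (apply: KintM => //).
Qed.

End IntegralMatrices.

(** * Unipotent cosets *)

Section UnipotentCosets.
Variable F : localField.
Implicit Types (x y z : F) (g h k u : GL3 F).
Local Notation v := (@ord F).

Lemma umM x y z x' y' z' :
  (um x y z * um x' y' z')%g = um (x + x') (y + y') (z + z' + x * y').
Proof.
apply: gl3_inj; rewrite gl3M !val_um.
by apply: eq_mx3; rewrite mulmx3E !mx3E; ring.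
Qed.

Lemma um0 : um (0 : F) 0 0 = 1%g.
Proof.
apply: gl3_inj; rewrite val_um.
by apply: eq_mx3; rewrite mx3E /= !mxE.
Qed.

Lemma umV x y z : ((um x y z)^-1)%g = um (- x) (- y) (x * y - z).
Proof.
apply/eqP; rewrite -(inj_eq (@mulgI _ (um x y z))) mulgV umM -um0.
by apply/eqP; congr um; ring.
Qed.

Lemma um_unipotent x y z : unipotent (um x y z).
Proof.
split; last by move=> i; rewrite /= val_um; move: i; apply: I3P; rewrite mx3E.
by apply/borelP; rewrite val_um !mx3E.
Qed.

Lemma um_entries x y z : um x y z 0 1 = x /\ um x y z 1 2 = y.
Proof. by rewrite /= val_um !mx3E. Qed.

Lemma Gam_um (r : int) x y z :
  Gam r (um x y z) <-> [/\ ball r x, ball r y & ball r z].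
Proof.
rewrite /Gam val_um; have -> : mx3 1 x z 0 1 y 0 0 1 - 1%:M = mx3 0 x z 0 0 y 0 0 0.
  by apply: eq_mx3; rewrite !mxE /= ?subrr ?subr0.
split=> [/ball_mx3[[_ hx hz] [_ _ hy] _]//|[hx hy hz]].
by apply/ball_mx3; rewrite !ball0.
Qed.

Lemma diagV (a b c : F) : a != 0 -> b != 0 -> c != 0 ->
  ((diagGL a b c)^-1)%g = diagGL a^-1 b^-1 c^-1.
Proof.
move=> a0 b0 c0; apply/eqP; rewrite -(inj_eq (@mulgI _ (diagGL a b c))) mulgV.
apply/eqP/esym/gl3_inj; rewrite gl3M !val_diag ?invr_eq0 //.
by apply: eq_mx3; rewrite mulmx3E !mx3E /= !mxE /=; field; rewrite ?a0 ?b0 ?c0.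
Qed.

Lemma diag1 : diagGL (1 : F) 1 1 = 1%g.
Proof.
apply: gl3_inj; rewrite val_diag ?oner_neq0 //.
by apply: eq_mx3; rewrite mx3E /= !mxE.
Qed.

Lemma diag_conj (a b c : F) g i j : a != 0 -> b != 0 -> c != 0 ->
  ((diagGL a b c)^-1 * g * diagGL a b c)%g i j =
  g i j * ([:: a; b; c]`_j / [:: a; b; c]`_i).
Proof.
move=> a0 b0 c0; rewrite diagV //= !val_diagGL ?invr_eq0 //.
rewrite !mulmx3E !diag3E.
by move: i j; do 2 (apply: I3P); rewrite !mx3E /=; ring.
Qed.

Definition Uball (j : int) : set (GL3 F) :=
  [set u | exists x y z, [/\ ball j x, ball j y, ball j z & u = um x y z]].

Lemma Uball_Kint j u : 0 <= j -> Uball j u -> Kint u.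
Proof.
move=> j0 [x [y [z [hx hy hz ->]]]]; apply: Kint_of_det.
  rewrite val_um; apply/ball_mx3; rewrite !ball0 !ball1.
  by rewrite !(@ballW F j 0).
by rewrite val_um det3 !mx3E (_ : _ + _ = 1) ?ord1 //; ring.
Qed.

Lemma UballM j u u' : 0 <= j -> Uball j u -> Uball j u' -> Uball j (u * u')%g.
Proof.
move=> j0 [x [y [z [hx hy hz ->]]]] [x' [y' [z' [hx' hy' hz' ->]]]].
exists (x + x'), (y + y'), (z + z' + x * y'); rewrite umM; split => //.
- exact: ballD.
- exact: ballD.
- by apply: ballD; [exact: ballD|apply: ballMl => //; exact: ballW hx].
Qed.

Lemma UballV j u : 0 <= j -> Uball j u -> Uball j (u^-1)%g.
Proof.
move=> j0 [x [y [z [hx hy hz ->]]]].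
exists (- x), (- y), (x * y - z); rewrite umV !ballN; split => //.
by apply: ballB => //; apply: ballMl => //; exact: ballW hx.
Qed.

(** Equality of the cosets u1 t Gam and u2 t Gam. *)
Definition coset_eq (r : int) (t u1 u2 : GL3 F) : Prop :=
  Gam r (t^-1 * u1^-1 * u2 * t)%g.

Lemma coset_eq_equiv r t : 1 <= r -> equivalence (coset_eq r t).
Proof.
move=> r1; rewrite /coset_eq; split=> [u|u1 u2 h|u1 u2 u3 h1 h2].
- by rewrite -(mulgA (t^-1)%g) mulVg mulg1 mulVg; exact: Gam1.
- by have := GamV r1 h; rewrite !invgM !invgK !mulgA.
- have r0 : 0 <= r by lia.
  by have := GamM r0 h1 h2; rewrite !mulgA !mulgK.
Qed.

Lemma coset_eqP r t u1 u2 : coset_eq r t u1 u2 ->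
  exists2 k, Gam r k & (u2 * t = u1 * t * k)%g.
Proof. by move=> h; exists (t^-1 * u1^-1 * u2 * t)%g; rewrite // !mulgA mulgK mulgV mul1g. Qed.

Lemma coset_eq_intro r t u1 u2 k : Gam r k -> (u2 * t = u1 * t * k)%g ->
  coset_eq r t u1 u2.
Proof.
by move=> hk e; rewrite /coset_eq -[(_ * u2 * t)%g]mulgA e !mulgA mulgVK mulVg mul1g.
Qed.

Variables (r : int) (t1 t2 t3 : F).
Hypotheses (r1 : 1 <= r) (t10 : t1 != 0) (t20 : t2 != 0) (t30 : t3 != 0).
Let t := diagGL t1 t2 t3.
Let a := v t1 - v t2.
Let b := v t2 - v t3.

Lemma coset_eq_um x y z x' y' z' :
  coset_eq r t (um x y z) (um x' y' z') <->
  [/\ ball (r + a) (x' - x), ball (r + b) (y' - y)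
    & ball (r + (a + b)) (z' - z - x * (y' - y))].
Proof.
rewrite /coset_eq.
have -> : (t^-1 * (um x y z)^-1 * um x' y' z' * t =
    um ((x' - x) * (t2 / t1)) ((y' - y) * (t3 / t2))
       ((z' - z - x * (y' - y)) * (t3 / t1)))%g.
  rewrite umV -(mulgA (t^-1)%g) umM; apply: gl3_inj; rewrite val_um.
  apply: eq_mx3; rewrite diag_conj // val_um !mx3E /=; try ring.
  - by field; rewrite t10.
  - by field; rewrite t20.
  - by field; rewrite t30.
rewrite Gam_um !ball_Mr ?mulf_neq0 ?invr_eq0 // !ord_div //.
have -> : r - (v t2 - v t1) = r + a by rewrite /a; ring.
have -> : r - (v t3 - v t2) = r + b by rewrite /b; ring.
by have -> : r - (v t3 - v t1) = r + (a + b) by rewrite /a /b; ring.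
Qed.

Definition umlist (sx sy sz : seq F) : seq (GL3 F) :=
  [seq um p.1 p.2 z | p <- [seq (x, y) | x <- sx, y <- sy], z <- sz].

Lemma sum_umlist (M : nmodType) (sx sy sz : seq F) (f : GL3 F -> M) :
  \sum_(u <- umlist sx sy sz) f u =
  \sum_(x <- sx) \sum_(y <- sy) \sum_(z <- sz) f (um x y z).
Proof. by rewrite /umlist !big_allpairs_dep. Qed.

(** Although the relation twists z by x (y' - y), a product of coordinatewise
    representatives works: choose those of x and y first, then that of the
    corrected z. *)
Lemma umlist_transversal (j : int) (sx sy sz : seq F) : 0 <= j ->
  transversal (cong (r + a)) [set x | ball j x] sx ->
  transversal (cong (r + b)) [set x | ball j x] sy ->
  transversal (cong (r + (a + b))) [set x | ball j x] sz ->
  transversal (coset_eq r t) (Uball j) (umlist sx sy sz).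
Proof.
move=> j0 [ux xA xE xS] [uy yA yE yS] [uz zA zE zS].
have key x y z x' y' z' : x \in sx -> y \in sy -> z \in sz ->
    x' \in sx -> y' \in sy -> z' \in sz ->
    coset_eq r t (um x y z) (um x' y' z') -> [/\ x = x', y = y' & z = z'].
  move=> hx hy hz hx' hy' hz' /coset_eq_um[cx cy cz].
  have ex : x = x' by apply: xE => //; rewrite /cong ballBC.
  have ey : y = y' by apply: yE => //; rewrite /cong ballBC.
  split => //; apply: zE => //; rewrite /cong ballBC.
  by move: cz; rewrite ey subrr mulr0 subr0.
have mem u : u \in umlist sx sy sz -> exists x y z,
    [/\ x \in sx, y \in sy, z \in sz & u = um x y z].
  move=> /allpairsP[[[x y] z] /= [/allpairsP[[x' y'] /= [hx hy [-> ->]]] hz ->]].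
  by exists x', y', z.
split.
- apply: allpairs_uniq => //; first by apply: allpairs_uniq => // -[? ?] [? ?].
  move=> -[[x y] z] [[x' y'] z'] /=.
  move=> /allpairsP[[[? ?] ?] /= [/allpairsP[[? ?] /= [hx hy [-> ->]]] hz [-> -> ->]]].
  move=> /allpairsP[[[? ?] ?] /= [/allpairsP[[? ?] /= [hx' hy' [-> ->]]] hz' [-> -> ->]]].
  move=> e; have [|-> -> ->] // := key _ _ _ _ _ _ hx hy hz hx' hy' hz'.
  by rewrite e; have [E _ _] := coset_eq_equiv t r1; exact: E.
- move=> u /mem[x [y [z [hx hy hz ->]]]]; exists x, y, z.
  by split => //; [exact: xA|exact: yA|exact: zA].
- move=> _ _ /mem[x [y [z [hx hy hz ->]]]] /mem[x' [y' [z' [hx' hy' hz' ->]]]].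
  by move=> /key[] // -> -> ->.
- move=> _ [x [y [z [hx hy hz ->]]]].
  have [x' sx' cx] := xS x hx; have [y' sy' cy] := yS y hy.
  have [|z' sz' cz] := zS (z + x * (y' - y)).
    apply: ballD => //; apply: ballMl; first exact: ballW hx.
    by apply: ballB => //; exact: yA.
  exists (um x' y' z').
    apply/allpairsP; exists ((x', y'), z') => /=; split => //.
    by apply/allpairsP; exists (x', y').
  apply/coset_eq_um; split; [by rewrite ballBC|by rewrite ballBC|].
  have -> : z' - z - x * (y' - y) = z' - (z + x * (y' - y)) by ring.
  by rewrite ballBC.
Qed.

End UnipotentCosets.

Lemma GamP (F : localField) (r : int) (k : GL3 F) :
  Gam r k <-> forall i j : 'I_3, ball r (k i j - (i == j)%:R).
Proof.
have e i j : (gl3_mx k - 1%:M) i j = k i j - (i == j)%:R by rewrite !mxE.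
by split=> h i j; have := h i j; rewrite e.
Qed.

(** * The principal series at finite level *)

Section PrincipalSeries.
Variables (R : realType) (F : localField).
Implicit Types (x y z : F) (g h k u b : GL3 F).
Local Notation C := (R[i]).
Local Notation v := (@ord F).
Variables (theta : C) (mu : F -> C).

(** The inducing character times the square root of the modulus character,
    when theta is the value at a uniformizer of |.|^(alpha + 1). *)
Definition chi b : C := theta ^ (v (b 0 0) - v (b 2 2)) * mu (b 1 1).

Definition prin : set (GL3 F -> C) :=
  [set f | smooth f /\ forall b g, borel b -> f (b * g)%g = chi b * f g].

(** Functions of the principal series fixed by the congruence subgroup of
    level r. *)
Definition prin_level (r : int) : set (GL3 F -> C) :=
  [set f | (forall b g, borel b -> f (b * g)%g = chi b * f g) /\
           forall g k, Gam r k -> f (g * k)%g = f g].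

Lemma prin_levelP (r : int) f : prin_level r f -> prin f.
Proof.
move=> [fb fr]; split => //; exists `|r|%N => k hk; apply/funext => g.
by apply: fr => i j; apply: ballW (introT (ballP _ _) (hk i j)); lia.
Qed.

Lemma prin_rtrans h f : prin f -> prin (rtrans h f).
Proof.
move=> [[N fN] fb]; split; last first.
  by move=> b g hb; have := fb b (g * h)%g hb; rewrite mulgA.
have [M hM] := Gam_conj_any h.
exists (N + M)%N => k hk; apply/funext => g; rewrite /rtrans.
have -> : (g * k * h = g * h * (h^-1 * k * h))%g by rewrite !mulgA mulgK.
have hk' : Gam (N.+1%:Z + M%:Z) k.
  by move=> i j; apply: ballW (introT (ballP _ _) (hk i j)); lia.
have h2 := hM _ _ hk'.
have /(_ _)/(congr1 (@^~ (g * h)%g)) := fN (h^-1 * k * h)%g.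
apply=> i j; apply/ballP; exact: h2.
Qed.

Lemma prin_lin (a : C) f1 f2 : prin f1 -> prin f2 ->
  prin (fun g => a * f1 g + f2 g).
Proof.
move=> [[N1 h1] b1] [[N2 h2] b2]; split; last first.
  by move=> b g hb; rewrite b1 // b2 //; ring.
exists (N1 + N2)%N => k hk; apply/funext => g; rewrite /rtrans.
have e1 : f1 (g * k)%g = f1 g.
  have /(_ _)/(congr1 (@^~ g)) := h1 k; apply=> i j; apply/ballP.
  by apply: ballW (introT (ballP _ _) (hk i j)); lia.
have e2 : f2 (g * k)%g = f2 g.
  have /(_ _)/(congr1 (@^~ g)) := h2 k; apply=> i j; apply/ballP.
  by apply: ballW (introT (ballP _ _) (hk i j)); lia.
by rewrite e1 e2.
Qed.

Lemma prin0 : prin (fun=> 0).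
Proof. by split=> [|b g _]; [exists 0%N|rewrite mulr0]. Qed.

Lemma prin_sum (T : Type) (s : seq T) (c : T -> C) (f : T -> GL3 F -> C) :
  (forall i, prin (f i)) -> prin (fun g => \sum_(i <- s) c i * f i g).
Proof.
move=> hf; elim: s => [|i s IH].
  by rewrite (_ : (fun _ => _) = fun=> 0); [exact: prin0|
    apply/funext => g; rewrite big_nil].
rewrite (_ : (fun _ => _) = fun g => c i * f i g + \sum_(j <- s) c j * f j g).
  exact: prin_lin.
by apply/funext => g; rewrite big_cons.
Qed.

(** ** Hecke operators preserve the level *)

Section Hecke.
Variables (r : int) (t1 t2 t3 : F).
Hypotheses (r1 : 1 <= r) (t10 : t1 != 0) (t20 : t2 != 0) (t30 : t3 != 0).
Hypotheses (t12 : v t2 <= v t1) (t23 : v t3 <= v t2).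
Let t := diagGL t1 t2 t3.

(* Gam is the product of U(p^r) and of its lower triangular part, and
   conjugation by the inverse of a dominant t contracts the latter. The factor u
   clears the entries of h above the diagonal, by Cramer's rule. *)
Let Gam_factor h : Gam r h ->
  exists2 u, Uball r u & Gam r (t^-1 * u^-1 * h * t)%g.
Proof.
move=> hh; have hi := Gam_int (le_trans ler01 r1) hh.
have hd i : ball r (h i i - 1) by have := hh i i; rewrite !mxE eqxx.
have ho i j : i != j -> ball r (h i j).
  by have := hh i j; rewrite !mxE => + /negbTE ij; rewrite ij subr0.
have r0 : 0 <= r by lia.
have [u22 v22] := ord_near1 r1 (hd 2).
pose D := h 1 1 * h 2 2 - h 1 2 * h 2 1.
have [D0 vD] : D != 0 /\ v D = 0.
  apply: (@ord_near1 _ r) => //.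
  have -> : D - 1 = (h 1 1 * h 2 2 - 1) - h 1 2 * h 2 1 by rewrite /D; ring.
  apply: ballB; first exact: ball_prod_near.
  by apply: ballMr => //; exact: ho.
pose y' := - (h 1 2 / h 2 2).
pose x' := - ((h 0 1 * h 2 2 - h 0 2 * h 2 1) / D).
pose z' := - ((h 1 1 * h 0 2 - h 0 1 * h 1 2) / D).
have hu' : Uball r (um x' y' z').
  exists x', y', z'; split=> //; rewrite ballN; apply: ball_divu => //.
  - by apply: ballB; apply: ballMr => //; exact: ho.
  - exact: ho.
  - by apply: ballB; [apply: ballMl|apply: ballMr] => //; exact: ho.
exists ((um x' y' z')^-1)%g; first exact: UballV.
rewrite invgK; have hg : Gam r (um x' y' z' * h)%g.
  apply: GamM => //; apply/Gam_um; case: hu' => [x [y [z [hx hy hz e]]]].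
  have [e1 e2] := um_entries x y z; have [e3 e4] := um_entries x' y' z'.
  have e5 : um x y z 0 2 = z by rewrite /= val_um !mx3E.
  have e6 : um x' y' z' 0 2 = z' by rewrite /= val_um !mx3E.
  by move: e3 e4 e6; rewrite e e1 e2 e5 => <- <- <-.
set l := (um x' y' z' * h)%g in hg.
have l01 : l 0 1 = 0.
  by rewrite mulmx3E val_um !mx3E /x' /z' /D; field; rewrite -/D D0.
have l02 : l 0 2 = 0.
  by rewrite mulmx3E val_um !mx3E /x' /z' /D; field; rewrite -/D D0.
have l12 : l 1 2 = 0.
  by rewrite mulmx3E val_um !mx3E /y'; field; rewrite u22.
rewrite -(mulgA (t^-1)%g) -/l; move/GamP: hg => hg; apply/GamP => i j.
rewrite diag_conj //.
have low (s1 s2 : F) c : s1 != 0 -> s2 != 0 -> v s2 <= v s1 -> ball r (c - 0) ->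
    ball r (c * (s1 / s2) - 0).
  move=> s10 s20 s12; rewrite !subr0 => hc; apply: ballMr => //.
  by rewrite ballE ?mulf_neq0 ?invr_eq0 // ord_div //; lia.
have dia (s1 c : F) : s1 != 0 -> ball r (c - 1) -> ball r (c * (s1 / s1) - 1).
  by move=> s10 hc; rewrite divff // mulr1.
move: i j; do 2 (apply: I3P) => /=;
  rewrite ?l01 ?l02 ?l12 ?mul0r ?subr0 ?ball0 //.
- exact: dia t10 (hg 0 0).
- by have := low t1 t2 _ t10 t20 t12 (hg 1 0); rewrite subr0.
- exact: dia t20 (hg 1 1).
- by have := low t1 t3 _ t10 t30 (le_trans t23 t12) (hg 2 0); rewrite subr0.
- by have := low t2 t3 _ t20 t30 t23 (hg 2 1); rewrite subr0.
- exact: dia t30 (hg 2 2).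
Qed.

Definition hecke (s : seq (GL3 F)) (f : GL3 F -> C) : GL3 F -> C :=
  fun g => \sum_(u <- s) 1 * rtrans (u * t)%g f g.

Lemma coset_eq_fun (f : GL3 F -> C) : prin_level r f ->
  forall g u1 u2, coset_eq r t u1 u2 -> f (g * u1 * t)%g = f (g * u2 * t)%g.
Proof.
move=> [_ fr] g u1 u2 /coset_eqP[k hk e].
by rewrite -!(mulgA g) e (mulgA g (u1 * t)%g k) (fr _ k).
Qed.

(** By Gam_factor, Gam t Gam is the disjoint union of the cosets u t Gam over
    the representatives u, so hecke sums the right translates of f over
    Gam t Gam / Gam, which left multiplication by Gam permutes. *)
Lemma hecke_level (s : seq (GL3 F)) (f : GL3 F -> C) :
  transversal (coset_eq r t) (Uball r) s -> prin_level r f ->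
  prin_level r (hecke s f).
Proof.
move=> sU hf; have r0 : 0 <= r by lia.
have [fb fr] := hf; split=> [b g hb|g k hk].
  rewrite /hecke mulr_sumr; apply: eq_bigr => u _; rewrite /rtrans !mul1r.
  by rewrite -(mulgA b) (fb b).
have sgP k' : Gam r k' -> forall u, exists u', Uball r u ->
    Uball r u' /\ exists2 k1, Gam r k1 & (k' * u * t = u' * t * k1)%g.
  move=> hk' u; have [hu|] := pselect (Uball r u); last by exists 1%g.
  have hku : Gam r (k' * u)%g.
    apply: GamM => //; case: hu => [x [y [z [hx hy hz ->]]]].
    exact/Gam_um.
  have [u' hu' h1] := Gam_factor hku; exists u' => _; split=> //.
  by exists (t^-1 * u'^-1 * (k' * u) * t)%g; rewrite // !mulgA mulgK mulgV mul1g.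
have /choice[sg sgE] := sgP k hk.
have /choice[sg' sgE'] := sgP _ (GamV r1 hk).
have ms : transversal (coset_eq r t) (Uball r) (map sg s).
  apply: transversal_map (coset_eq_equiv _ r1) (coset_eq_equiv _ r1) sU _ _ _.
  - by move=> u /sgE[].
  - move=> u1 u2 /sgE[_ [k1 hk1 e1]] /sgE[_ [k2 hk2 e2]].
    have e1' : (sg u1 * t = k * u1 * t * k1^-1)%g by rewrite e1 mulgK.
    have e2' : (sg u2 * t = k * u2 * t * k2^-1)%g by rewrite e2 mulgK.
    split=> /coset_eqP[k3 hk3 e3].
      apply: (@coset_eq_intro _ r t u1 u2 (k1^-1 * k3 * k2)%g).
        by do 2 (apply: GamM => //); exact: GamV.
      by apply: (@mulgI _ k); rewrite !mulgA e2 e3 e1'.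
    apply: (@coset_eq_intro _ r t _ _ (k1 * k3 * k2^-1)%g).
      by apply: GamM; [|exact: GamM|exact: GamV].
    by rewrite e2' e1' -(mulgA k) e3 !mulgA mulgVK.
  - move=> y hy; have [hu0 [k0 hk0 e0]] := sgE' y hy.
    exists (sg' y) => //; have [_ [k1 hk1 e1]] := sgE _ hu0.
    apply: (@coset_eq_intro _ r t _ _ (k0^-1 * k1^-1)%g).
      by apply: GamM => //; exact: GamV.
    have -> : (y * t = k * (k^-1 * y * t))%g by rewrite !mulgA mulgV mul1g.
    by rewrite e0 !mulgA e1 !mulgK.
rewrite /hecke /rtrans; under eq_bigr do rewrite mul1r mulgA.
under [RHS]eq_bigr do rewrite mul1r mulgA.
rewrite [RHS](transversal_sum (coset_eq_equiv t r1) sU ms); last first.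
  by move=> u1 u2 _ _; exact: coset_eq_fun.
rewrite big_map [LHS]big_seq [RHS]big_seq; apply: eq_bigr => u us.
have [_ sA _ _] := sU; have [_ [k1 hk1 e1]] := sgE _ (sA _ us).
have -> : (g * k * u * t = g * (sg u * t) * k1)%g.
  by rewrite -(mulgA g (sg u * t)%g) -e1 !mulgA.
by rewrite (fr _ k1) // mulgA.
Qed.

End Hecke.
End PrincipalSeries.

(** * Uniqueness of Whittaker functionals at finite level *)

(** Representatives of U(o) / U(p^r). *)
Definition U0list (F : localField) (r : int) : seq (GL3 F) :=
  umlist (reps F 0 r) (reps F 0 r) (reps F 0 r).

Lemma U0list_transversal (F : localField) (r : int) : 1 <= r ->
  transversal (coset_eq r 1%g) (Uball 0) (U0list F r).
Proof.
move=> r1; have r0 : 0 <= r by apply: le_trans r1.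
have one0 := oner_neq0 F.
have := @umlist_transversal F r 1 1 1 r1 one0 one0 one0 0
  (reps F 0 r) (reps F 0 r) (reps F 0 r) (lexx _).
by rewrite diag1 subrr !addr0; apply; exact: repsP.
Qed.

Section FiniteLevelUniqueness.
Variables (R : realType) (F : localField).
Implicit Types (x y z : F) (g h k u b : GL3 F).
Local Notation C := (R[i]).
Local Notation v := (@ord F).
Variables (n : nat) (theta : C) (mu : F -> C).
Hypothesis n0 : (0 < n)%N.
Hypothesis mu_n : forall x, ball n%:Z (x - 1) -> mu x = 1.
Local Notation chi := (chi theta mu).
Local Notation prin_level := (prin_level theta mu).

Variables (r : int) (Psi : F -> C).
Hypothesis nr : n%:Z + 1 <= r.
Hypothesis PsiD : forall x y, Psi (x + y) = Psi x * Psi y.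
Hypothesis Psi_r : forall x, ball r x -> Psi x = 1.
Hypothesis Psi_prim : exists2 s, ball (r - 1) s & Psi s != 1.

Let r1 : 1 <= r. Proof. by apply: le_trans nr; rewrite lerDr. Qed.

Definition Upsi (u : GL3 F) : C := Psi (u 0 1 + u 1 2).

Lemma Upsi_um x y z : Upsi (um x y z) = Psi (x + y).
Proof. by have [e1 e2] := um_entries x y z; rewrite /Upsi e1 e2. Qed.

Lemma Psi0 : Psi 0 = 1.
Proof. by apply: Psi_r; rewrite ball0. Qed.

Lemma Psi_neq0 x : Psi x != 0.
Proof.
apply/eqP => e; have := PsiD x (- x); rewrite subrr Psi0 e mul0r => /eqP.
by rewrite oner_eq0.
Qed.

Lemma UpsiM (j : int) u u' : Uball j u -> Uball j u' ->
  Upsi (u * u')%g = Upsi u * Upsi u'.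
Proof.
move=> [x [y [z [_ _ _ ->]]]] [x' [y' [z' [_ _ _ ->]]]].
by rewrite umM !Upsi_um -PsiD; congr Psi; ring.
Qed.

(** The psi-isotypic average over U(o). *)
Definition Uavg (f : GL3 F -> C) : GL3 F -> C :=
  fun g => \sum_(u <- (U0list F r)) (Upsi u)^-1 * f (g * u)%g.

Section Fixed.
Variable f : GL3 F -> C.
Hypothesis hf : prin_level r f.

Let f_coset g u1 u2 : coset_eq r 1%g u1 u2 -> f (g * u1)%g = f (g * u2)%g.
Proof.
move=> /coset_eqP[k hk]; rewrite !mulg1 => ->.
by have [_ fr] := hf; rewrite mulgA (fr _ k).
Qed.

Let Upsi_coset u1 u2 : Uball 0 u1 -> Uball 0 u2 -> coset_eq r 1%g u1 u2 ->
  Upsi u1 = Upsi u2.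
Proof.
move=> [x [y [z [_ _ _ ->]]]] [x' [y' [z' [_ _ _ ->]]]] h.
move: h; rewrite -(diag1 F) => /(coset_eq_um r (oner_neq0 F) (oner_neq0 F) (oner_neq0 F)).
rewrite subrr !addr0 => -[hx hy _]; rewrite !Upsi_um.
have -> : x' + y' = x + y + ((x' - x) + (y' - y)) by ring.
by rewrite [RHS]PsiD (Psi_r (ballD hx hy)) mulr1.
Qed.

Lemma Uavg_borel b g : borel b -> Uavg f (b * g)%g = chi b * Uavg f g.
Proof.
move=> hb; rewrite /Uavg mulr_sumr; apply: eq_bigr => u _.
by have [fb _] := hf; rewrite -mulgA (fb b) // mulrCA.
Qed.

Lemma Uavg_unip g u0 : Uball 0 u0 -> Uavg f (g * u0)%g = Upsi u0 * Uavg f g.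
Proof.
move=> hu0; have Ee := coset_eq_equiv (1%g : GL3 F) r1.
have U0 : Upsi u0 != 0 by exact: Psi_neq0.
have tm : transversal (coset_eq r 1%g) (Uball 0) [seq (u0 * u)%g | u <- (U0list F r)].
  apply: (transversal_map Ee Ee (U0list_transversal F r1)).
  - by move=> u; exact: UballM.
  - move=> u1 u2 _ _; rewrite /coset_eq.
    by rewrite invg1 !mul1g !mulg1 invgM !mulgA mulgVK.
  - move=> u hu; exists (u0^-1 * u)%g; first by apply: UballM => //; exact: UballV.
    by rewrite mulgA mulgV mul1g; have [E _ _] := Ee.
have -> : Uavg f g = \sum_(u <- [seq (u0 * u)%g | u <- (U0list F r)])
    (Upsi u)^-1 * f (g * u)%g.
  apply: (transversal_sum Ee (U0list_transversal F r1) tm) => u1 u2 h1 h2 e.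
  by rewrite (f_coset _ e) (Upsi_coset h1 h2 e).
rewrite big_map mulr_sumr [LHS]big_seq [RHS]big_seq; apply: eq_bigr => u us.
have [_ sA _ _] := (U0list_transversal F r1).
rewrite (UpsiM hu0 (sA _ us)) mulgA; field.
by rewrite U0 Psi_neq0.
Qed.

(* The Borel factor is the upper triangular part of h; its diagonal lies in
   1 + p^n, where chi is trivial. *)
Let near_borel h : ball_mx (r - 1) (gl3_mx h - 1%:M) ->
  ball r (h 1 0) -> ball r (h 2 0) -> ball r (h 2 1) ->
  exists b k, [/\ borel b, chi b = 1, Gam r k & h = (b * k)%g].
Proof.
move=> hh h10 h20 h21.
have hd i : ball (r - 1) (h i i - 1) by have := hh i i; rewrite !mxE eqxx.
have hu i : h i i != 0 /\ v (h i i) = 0 by apply: ord_near1 (hd i); lia.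
have hi : ball_mx 0 (gl3_mx h).
  rewrite -(subrK 1%:M (gl3_mx h)); apply: ball_mxD; last exact: ball_mx1.
  by apply: ball_mxW hh; lia.
pose B := mx3 (h 0 0) (h 0 1) (h 0 2) 0 (h 1 1) (h 1 2) 0 0 (h 2 2).
have dB : \det B = h 0 0 * h 1 1 * h 2 2 by rewrite det3 !mx3E; ring.
have dB0 : \det B != 0 by rewrite dB !mulf_neq0 //; case: (hu 0) (hu 1) (hu 2) => ? _ [? _] [? _].
have vB : gl3_mx (mkGL B) = B by exact: val_mkGL.
have [_ KV] : Kint (mkGL B).
  apply: Kint_of_det; rewrite vB.
    by apply/ball_mx3; rewrite !ball0 !hi.
  have [[? e0] [? e1] [? e2]] := And3 (hu 0) (hu 1) (hu 2).
  by rewrite dB !ordM ?mulf_neq0 // e0 e1 e2.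
exists (mkGL B), ((mkGL B)^-1 * h)%g; split.
- by apply/borelP; rewrite vB !mx3E.
- rewrite /chi vB !mx3E; have [_ ->] := hu 0; have [_ ->] := hu 2.
  rewrite subrr expr0z mul1r; apply: mu_n; apply: ballW (hd 1); lia.
- rewrite /Gam gl3M gl3V vB -[1%:M](mulVmx (gl3_unit (mkGL B))) vB -mulmxBr.
  apply: ball_mxMl; first by rewrite -vB.
  rewrite (mx3_eta (gl3_mx h - B)) /B; apply/ball_mx3.
  by rewrite !mxE /= !subrr !ball0 !subr0.
- by rewrite mulgA mulgV mul1g.
Qed.

(* Translation by um x y z multiplies the average at g by Psi (x + y), but
   also leaves it unchanged, because g conjugates um x y z into B Gam with
   trivial chi. Here X is um x y z - 1. *)
Let Uavg_kill g x y z : Kint g -> ball (r - 1) x -> ball (r - 1) y ->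
  ball (r - 1) z -> Psi (x + y) != 1 ->
  let X := mx3 0 x z 0 0 y 0 0 0 in
  let Y := gl3_mx g *m X *m invmx (gl3_mx g) in
  ball r (Y 1 0) -> ball r (Y 2 0) -> ball r (Y 2 1) ->
  Uavg f g = 0.
Proof.
move=> Kg hx hy hz hPsi X Y Y10 Y20 Y21.
have r0 : 0 <= r - 1 by lia.
have hu0 : Uball 0 (um x y z).
  by exists x, y, z; split => //; exact: ballW r0 _.
have eY : gl3_mx (g * um x y z * g^-1)%g - 1%:M = Y.
  rewrite !gl3M gl3V /Y -[X in _ - X](mulmxV (gl3_unit g)) -mulmxBl; congr (_ *m _).
  rewrite -[X in _ - X]mulmx1 -mulmxBr; congr (_ *m _); rewrite val_um.
  by apply: eq_mx3; rewrite !mxE /= ?subrr ?subr0.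
have hY : ball_mx (r - 1) Y.
  case: Kg => K1 K2; apply: ball_mxMr => //; apply: ball_mxMl => //.
  by apply/ball_mx3; rewrite !ball0.
have eYij i j : i != j -> (g * um x y z * g^-1)%g i j = Y i j.
  by move=> /negbTE ij; rewrite -eY !mxE ij subr0.
have [|||| b [k [hb cb hk e]]] := @near_borel (g * um x y z * g^-1)%g.
- by rewrite eY.
- by rewrite eYij.
- by rewrite eYij.
- by rewrite eYij.
have inv : Uavg f (g * um x y z)%g = Uavg f g.
  rewrite /Uavg [LHS]big_seq [RHS]big_seq; apply: eq_bigr => u us; congr (_ * _).
  have [_ sA _ _] := (U0list_transversal F r1).
  have Kgu : Kint (g * u)%g by apply: KintM => //; exact: Uball_Kint (sA _ us).
  have -> : (g * um x y z * u = b * (g * u * ((g * u)^-1 * k * (g * u))))%g.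
    have -> : (g * u * ((g * u)^-1 * k * (g * u)) = k * (g * u))%g.
      by rewrite -(mulgA (g * u)^-1%g) mulVKg.
    by rewrite !mulgA -e mulgVK.
  have [fb fr] := hf; rewrite (fb b) // cb mul1r (fr _ ((g * u)^-1 * k * (g * u))%g) //.
  exact: Gam_conj.
have := Uavg_unip g hu0; rewrite inv Upsi_um => /eqP.
rewrite -subr_eq0 -{1}[Uavg f g]mul1r -mulrBl mulf_eq0 subr_eq0 eq_sym.
by rewrite (negbTE hPsi) => /eqP.
Qed.

(** The average lives on B w0 U(o). Off this set, the flag spanned modulo p by
    the last row and the last two rows of g is preserved by some nilpotent upper
    triangular X with X01 + X12 != 0, and Uavg_kill applies to 1 + X. *)
Lemma Uavg_support g : Kint g ->
  ball 1 (g 2 0) || ball 1 (g 1 0 * g 2 1 - g 1 1 * g 2 0) -> Uavg f g = 0.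
Proof.
move=> Kg; have [hg hV] := Kg; set k := gl3_mx (g^-1)%g.
have [s hs Ps] := Psi_prim.
have gk i j : (gl3_mx g *m k) i j = (i == j)%:R.
  by rewrite /k gl3V mulmxV ?gl3_unit // mxE.
have hk : ball_mx 0 k by rewrite /k gl3V.
have r1' : r = (r - 1) + 1 by ring.
have gXk x y z i j :
    (gl3_mx g *m mx3 0 x z 0 0 y 0 0 0 *m invmx (gl3_mx g)) i j =
    g i 0 * x * k 1 j + (g i 0 * z + g i 1 * y) * k 2 j.
  by rewrite !mulmx3E !mx3E -/k; ring.
have row (i j : 'I_3) : i != j ->
    g i 0 * k 0 j + g i 1 * k 1 j + g i 2 * k 2 j = 0.
  by move=> /negbTE ij; have := gk i j; rewrite mulmx3E ij.
have bs x y : ball 0 x -> ball 1 y -> ball r (x * s * y).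
  by move=> hx hy; rewrite r1'; apply: ballM => //; exact: ballMl.
case: (boolP (ball 1 (g 2 0))) => /= h20 hM; last first.
  have [g20 v20] := unit_ball (hg 2 0) h20.
  (* X kills the last row; modulo p the plane of the last two rows contains
     (0, 0, 1), which X kills as well. *)
  apply: (@Uavg_kill g 0 s (- (s * g 2 1 / g 2 0))) => //; rewrite ?ball0 ?add0r //.
  - by rewrite ballN; apply: ball_divu => //; apply: ballMr.
  - rewrite gXk; have -> : g 1 0 * 0 * k 1 0 +
        (g 1 0 * - (s * g 2 1 / g 2 0) + g 1 1 * s) * k 2 0 =
      k 2 0 * s * (- ((g 1 0 * g 2 1 - g 1 1 * g 2 0) / g 2 0)) by field.
    by apply: bs => //; rewrite ballN; exact: ball_divu.
  - rewrite gXk (_ : _ + _ = 0) ?ball0 //; field; exact: g20.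
  - rewrite gXk (_ : _ + _ = 0) ?ball0 //; field; exact: g20.
case: (boolP (ball 1 (g 2 1))) => h21.
  have [g22 v22] : g 2 2 != 0 /\ v (g 2 2) = 0.
    apply: unit_ball; first exact: hg.
    apply/negP => h22; have : ball 1 (1 : F).
      have <- : g 2 0 * k 0 2 + g 2 1 * k 1 2 + g 2 2 * k 2 2 = 1.
        by rewrite -mulmx3E gk.
      by apply: ballD; [apply: ballD|]; apply: ballMr => //; exact: hk.
    by rewrite ballE ?oner_neq0 // ord1.
  (* Modulo p the last row spans the image of X and is killed by X. *)
  apply: (@Uavg_kill g 0 s 0) => //; rewrite ?ball0 ?add0r // gXk !mulr0 mul0r !add0r.
  - apply: bs => //; have e : k 2 0 = - (g 2 0 * k 0 0 + g 2 1 * k 1 0) / g 2 2.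
      have h := row 2 0 isT; apply: (mulIf g22); rewrite divfK //.
      by apply/eqP; rewrite -addr_eq0 -[X in _ == X]h; apply/eqP; ring.
    by rewrite e; apply: ball_divu => //; rewrite ballN; apply: ballD; apply: ballMr.
  - by rewrite [g 2 1 * s * _](_ : _ = k 2 0 * s * g 2 1); [exact: bs|ring].
  - by rewrite [g 2 1 * s * _](_ : _ = k 2 1 * s * g 2 1); [exact: bs|ring].
have [g21 v21] := unit_ball (hg 2 1) h21.
have bz : ball 0 (g 2 2 / g 2 1) by exact: ball_divu.
(* Again modulo p the last row, a multiple of (0, g 2 1, g 2 2), spans the image
   of X and is killed by X. *)
apply: (@Uavg_kill g s 0 (s * (g 2 2 / g 2 1))) => //;
  rewrite ?ball0 ?addr0 //; first exact: ballMr.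
- rewrite gXk; have -> : g 1 0 * s * k 1 0 + (g 1 0 * (s * (g 2 2 / g 2 1)) + g 1 1 * 0) * k 2 0
    = g 1 0 * s * ((g 2 0 * k 0 0 + g 2 1 * k 1 0 + g 2 2 * k 2 0 - g 2 0 * k 0 0) / g 2 1).
    by field.
  rewrite (row 2 0 isT) sub0r; apply: bs => //; apply: ball_divu => //.
  by rewrite ballN; exact: ballMr.
- rewrite gXk; have -> : g 2 0 * s * k 1 0 + (g 2 0 * (s * (g 2 2 / g 2 1)) + g 2 1 * 0) * k 2 0
    = (k 1 0 + g 2 2 / g 2 1 * k 2 0) * s * g 2 0 by ring.
  by apply: bs => //; apply: ballD => //; exact: ballMl.
- rewrite gXk; have -> : g 2 0 * s * k 1 1 + (g 2 0 * (s * (g 2 2 / g 2 1)) + g 2 1 * 0) * k 2 1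
    = (k 1 1 + g 2 2 / g 2 1 * k 2 1) * s * g 2 0 by ring.
  by apply: bs => //; apply: ballD => //; exact: ballMl.
Qed.

End Fixed.

(** The value at w0 of Uavg f: a finite Jacquet integral. *)
Definition jacquet (f : GL3 F -> C) : C :=
  \sum_(u <- (U0list F r)) (Upsi u)^-1 * f (w0 F * u)%g.

(** The entries of um x y z are ratios of entries of the last row of g and of
    minors of its last two rows. *)
Lemma bigcell_decomp g : Kint g -> ~~ ball 1 (g 2 0) ->
  ~~ ball 1 (g 1 0 * g 2 1 - g 1 1 * g 2 0) ->
  exists b u, [/\ borel b, Uball 0 u & g = (b * w0 F * u)%g].
Proof.
move=> [hg _] h20 hD.
have [g20 v20] := unit_ball (hg 2 0) h20.
set D := _ - _ in hD; have [D0 vD] : D != 0 /\ v D = 0.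
  by apply: unit_ball => //; apply: ballB; apply: ballMl.
pose x := g 2 1 / g 2 0; pose z := g 2 2 / g 2 0.
pose y := (g 1 0 * g 2 2 - g 1 2 * g 2 0) / D.
have hu : Uball 0 (um x y z).
  exists x, y, z; split => //; apply: ball_divu => //.
  by apply: ballB; apply: ballMl.
exists (g * (um x y z)^-1 * (w0 F)^-1)%g, (um x y z); split => //; last first.
  by rewrite mulgVK mulgVK.
set b := (_ * _ * _)%g; have e : (b * w0 F = g * um (- x) (- y) (x * y - z))%g.
  by rewrite /b mulgVK umV.
have bw i j : (b * w0 F)%g i j = b i (2 - j).
  rewrite mulmx3E val_w0; move: j; apply: I3P; rewrite !mx3E ?mulr0 ?mulr1 ?addr0 ?add0r;
  by congr (b i _); apply: val_inj.
have ge i j : (b * w0 F)%g i j = (g * um (- x) (- y) (x * y - z))%g i j by rewrite e.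
apply/borelP; split.
- rewrite (_ : b 1 0 = (b * w0 F)%g 1 2) ?bw; last first.
    by congr (b _ _); apply: val_inj.
  rewrite -bw ge mulmx3E val_um !mx3E /x /y /z /D; field; by rewrite -/D D0 g20.
- rewrite (_ : b 2 0 = (b * w0 F)%g 2 2) ?bw; last first.
    by congr (b _ _); apply: val_inj.
  rewrite -bw ge mulmx3E val_um !mx3E /x /z; field; exact: g20.
- rewrite (_ : b 2 1 = (b * w0 F)%g 2 1) ?bw; last first.
    by congr (b _ _); apply: val_inj.
  rewrite -bw ge mulmx3E val_um !mx3E /x; field; exact: g20.
Qed.

(** Both averages transform in the same way under B and U(o) and vanish off
    B w0 U(o), so they are proportional, with ratio the ratio of their values
    at w0. *)
Lemma jacquet_compare f1 f2 g : prin_level r f1 -> prin_level r f2 ->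
  jacquet f2 * Uavg f1 g = jacquet f1 * Uavg f2 g.
Proof.
move=> h1 h2; have [b [k [hb hk ->]]] := iwasawa g.
rewrite !(Uavg_borel _ _ hb) //.
case: (boolP (ball 1 (k 2 0) || ball 1 (k 1 0 * k 2 1 - k 1 1 * k 2 0))) => hs.
  by rewrite !Uavg_support // !mulr0.
move: hs; rewrite negb_or => /andP[hs1 hs2].
have [b' [u [hb' hu ->]]] := bigcell_decomp hk hs1 hs2.
rewrite (Uavg_unip h1 _ hu) (Uavg_unip h2 _ hu).
rewrite (Uavg_borel h1 _ hb') (Uavg_borel h2 _ hb').
by rewrite -![Uavg _ (w0 F)]/(jacquet _); ring.
Qed.

(** Averaging over U(o) multiplies L by the number of representatives, so the
    proportionality of jacquet_compare passes to L. This is uniqueness of the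
    Whittaker functional, restricted to the functions of level r. *)
Lemma functional_compare (L : (GL3 F -> C) -> C) f1 f2 :
  (forall (s : seq (GL3 F)) (c : GL3 F -> C) (f : GL3 F -> GL3 F -> C),
     (forall u, prin theta mu (f u)) ->
     L (fun g => \sum_(u <- s) c u * f u g) = \sum_(u <- s) c u * L (f u)) ->
  (forall f x y z, prin theta mu f ->
     L (rtrans (um x y z) f) = Psi (x + y) * L f) ->
  prin_level r f1 -> prin_level r f2 ->
  jacquet f2 * L f1 = jacquet f1 * L f2.
Proof.
move=> Lsum Lum h1 h2.
have avg (c : C) f : prin_level r f ->
    L (fun g => c * Uavg f g) = c * ((size (U0list F r))%:R * L f).
  move=> hf; have pf := prin_levelP hf.
  rewrite (_ : (fun g => _) = fun g =>
      \sum_(u <- (U0list F r)) (c * (Upsi u)^-1) * rtrans u f g); last first.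
    by apply/funext => g; rewrite /Uavg mulr_sumr; apply: eq_bigr => u _; rewrite mulrA.
  rewrite Lsum => [|u]; last exact: prin_rtrans.
  rewrite (eq_big_seq (fun=> c * L f)).
    by rewrite big_const_seq count_predT iter_addr_0 -mulr_natl; ring.
  move=> u us; have [_ sA _ _] := (U0list_transversal F r1).
  have [x [y [z [_ _ _ ->]]]] := sA _ us; rewrite Lum // Upsi_um.
  by field; exact: Psi_neq0.
have size0 : (size (U0list F r))%:R != 0 :> C.
  rewrite pnatr_eq0 size_eq0; have [_ _ _] := (U0list_transversal F r1).
  move=> /(_ 1%g) [|u]; last by case: (U0list F r).
  by rewrite -um0; exists 0, 0, 0; rewrite ball0.
apply: (mulfI size0); rewrite !(mulrCA (_%:R)) -!avg //.
by congr L; apply/funext => g; exact: jacquet_compare.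
Qed.

End FiniteLevelUniqueness.

(** * The newform in the induced model *)

Section Newform.
Variables (R : realType) (F : localField).
Implicit Types (x y z : F) (g h k u b : GL3 F).
Local Notation C := (R[i]).
Local Notation v := (@ord F).

Lemma Kint_row2 k : Kint k -> ball 1 (k 2 0) -> ball 1 (k 2 1) -> ~~ ball 1 (k 2 2).
Proof.
move=> [_ h2] h20 h21; apply/negP => h22; have : ball 1 (1 : F).
  have <- : (gl3_mx k *m invmx (gl3_mx k)) 2 2 = 1.
    by rewrite mulmxV ?gl3_unit // mxE.
  by rewrite mulmx3E; apply: ballD; [apply: ballD|]; apply: ballMr.
by rewrite ballE ?oner_neq0 // ord1.
Qed.

(** Expand the determinant, a unit, along the first row. *)
Lemma Kint_minor k : Kint k -> ball 1 (k 1 0 * k 2 1 - k 1 1 * k 2 0) ->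
  ball 1 (k 1 0 * k 2 2 - k 1 2 * k 2 0) -> ~~ ball 1 (k 1 1 * k 2 2 - k 1 2 * k 2 1).
Proof.
move=> Kk h01 h02; apply/negP => h12; have := Kint_det Kk.
have hd : ball 1 (\det (gl3_mx k)).
  have [h _] := Kk; rewrite det3.
  by apply: ballD; [apply: ballB|]; apply: ballMl.
by move: hd; rewrite ballE ?gl3_det //; lia.
Qed.

Variables (n : nat) (theta : C) (mu : F -> C).
Hypothesis n0 : (0 < n)%N.
Hypothesis muM : forall x y, x != 0 -> y != 0 -> mu (x * y) = mu x * mu y.
Hypothesis mu_n : forall x, ball n%:Z (x - 1) -> mu x = 1.
Hypothesis mu_prim : exists a : F,
  [/\ a != 0, v a = 0, ball (n%:Z - 1) (a - 1) & mu a != 1].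

(** The stabiliser in GL_3(o) of the middle basis column modulo p^n; it is
    conjugate to K_n. *)
Definition Kcol k : Prop :=
  [/\ Kint k, ball n%:Z (k 0 1), ball n%:Z (k 1 1 - 1) & ball n%:Z (k 2 1)].

Variable f : GL3 F -> C.
Hypothesis f_borel : forall b g, borel b -> f (b * g)%g = chi theta mu b * f g.
Hypothesis f_Kcol : forall g k, Kcol k -> f (g * k)%g = f g.

(* If b fixes the middle column of k modulo p^n, then b k lies in k Kcol. *)
Let f_stab k b : Kint k -> Kint b -> borel b ->
  (forall i, ball n%:Z ((b * k)%g i 1 - k i 1)) ->
  f k = chi theta mu b * f k.
Proof.
move=> Kk Kb hb hi; rewrite -f_borel //.
have e : (b * k = k * (k^-1 * b * k))%g by rewrite !mulgA mulgV mul1g.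
rewrite e f_Kcol //.
have key i : ball n%:Z ((k^-1 * b * k)%g i 1 - (i == 1)%:R).
  have -> : (k^-1 * b * k)%g i 1 - (i == 1)%:R =
     k^-1%g i 0 * ((b * k)%g 0 1 - k 0 1) + k^-1%g i 1 * ((b * k)%g 1 1 - k 1 1)
     + k^-1%g i 2 * ((b * k)%g 2 1 - k 2 1).
    have -> : (i == 1)%:R = (gl3_mx (k^-1)%g *m gl3_mx k) i 1.
      by rewrite gl3V mulVmx ?gl3_unit // mxE.
    by rewrite -(mulgA (k^-1)%g) gl3M !(mulmx3E (gl3_mx (k^-1)%g)); ring.
  by case: Kk => _ hV; apply: ballD; [apply: ballD|]; apply: ballMl.
split.
- by do 2 (apply: KintM => //); exact: KintV.
- by have := key 0; rewrite subr0.
- exact: (key 1).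
- by have := key 2; rewrite subr0.
Qed.

(** Unless the middle column of k is (x, unit, 0) modulo p^n, it is fixed modulo
    p^n by some b in B(o) with rows (1, 0, 0), (0, a, y), (0, 0, 1) and
    mu a != 1, so that f k = mu a * f k. *)
Lemma newform_support k : Kint k -> f k != 0 ->
  ball n%:Z (k 2 1) /\ ~~ ball 1 (k 1 1).
Proof.
move=> Kk fk; have [hk _] := Kk; have [a [a0 va ha mua]] := mu_prim.
have hKa y : ball 0 y -> let b := mkGL (mx3 1 0 0 0 a y 0 0 1) in
    (forall i, ball n%:Z ((b * k)%g i 1 - k i 1)) -> False.
  move=> hy b hi; have d : \det (mx3 1 0 0 0 a y 0 0 1) = a.
    by rewrite det3 !mx3E; ring.
  have vb : gl3_mx b = mx3 1 0 0 0 a y 0 0 1 by rewrite val_mkGL // d.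
  have Kb : Kint b.
    apply: Kint_of_det; rewrite vb ?d //; apply/ball_mx3.
    by rewrite !ball0 !ball1 ballE // va.
  have hb : borel b by apply/borelP; rewrite vb !mx3E.
  have := f_stab Kk Kb hb hi; rewrite /chi vb !mx3E subrr expr0z mul1r => /eqP.
  rewrite -subr_eq0 -{1}[f k]mul1r -mulrBl mulf_eq0 subr_eq0 eq_sym (negbTE mua).
  by rewrite (negbTE fk).
have bE y i : ball 0 y -> let b := mkGL (mx3 1 0 0 0 a y 0 0 1) in
    (b * k)%g i 1 - k i 1 = if i == 1 then (a - 1) * k 1 1 + y * k 2 1 else 0.
  move=> hy b; have d : \det (mx3 1 0 0 0 a y 0 0 1) = a.
    by rewrite det3 !mx3E; ring.
  have vb : gl3_mx b = mx3 1 0 0 0 a y 0 0 1 by rewrite val_mkGL // d.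
  by rewrite mulmx3E vb; move: i; apply: I3P; rewrite !mx3E /=; ring.
case: (boolP (ball n%:Z (k 2 1))) => h21; last first.
  (* y is chosen to make the middle column exactly fixed. *)
  exfalso; have [k210 v21] := notball h21.
  have hy : ball 0 (- ((a - 1) * k 1 1) / k 2 1).
    rewrite mulNr ballN ball_Mr ?invr_eq0 // ordV //.
    by apply: ballMr => //; apply: ballW ha; lia.
  apply: (hKa _ hy) => i; rewrite bE //; case: ifP; rewrite ?ball0 // divfK //.
  by rewrite subrr ball0.
split=> //; apply/negP => h11; apply: (hKa 0 (ball0 F 0)) => i.
rewrite bE ?ball0 //; case: ifP; rewrite ?ball0 // mul0r addr0 => _.
have -> : n%:Z = (n%:Z - 1) + 1 by ring.
exact: ballM.
Qed.

(** In the remaining case k lies in b Kcol for the b in B(o) that maps the middle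
    basis column to that of k modulo p^n. *)
Lemma newform_value k : Kint k -> ball n%:Z (k 2 1) -> ~~ ball 1 (k 1 1) ->
  f k = mu (k 1 1) * f 1%g.
Proof.
move=> Kk h21 h11; have [hk _] := Kk.
have [k110 v11] := unit_ball (hk 1 1) h11.
pose b := mkGL (mx3 1 (k 0 1) 0 0 (k 1 1) 0 0 0 1).
have d : \det (mx3 1 (k 0 1) 0 0 (k 1 1) 0 0 0 1) = k 1 1.
  by rewrite det3 !mx3E; ring.
have vb : gl3_mx b = mx3 1 (k 0 1) 0 0 (k 1 1) 0 0 0 1 by rewrite val_mkGL // d.
have Kb : Kint b.
  apply: Kint_of_det; rewrite vb ?d //; apply/ball_mx3.
  by rewrite !ball0 !ball1 !hk.
have hb : borel b by apply/borelP; rewrite vb !mx3E.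
have bV : gl3_mx (b^-1)%g = mx3 1 (- (k 0 1 / k 1 1)) 0 0 (k 1 1)^-1 0 0 0 1.
  have -> : (b^-1)%g = mkGL (mx3 1 (- (k 0 1 / k 1 1)) 0 0 (k 1 1)^-1 0 0 0 1).
    have d' : \det (mx3 1 (- (k 0 1 / k 1 1)) 0 0 (k 1 1)^-1 0 0 0 1) = (k 1 1)^-1.
      by rewrite det3 !mx3E; ring.
    apply/eqP; rewrite -(inj_eq (@mulgI _ b)) mulgV; apply/eqP/gl3_inj.
    rewrite gl3M vb val_mkGL ?d' ?invr_eq0 //.
    by apply: eq_mx3; rewrite mulmx3E !mx3E /= !mxE /=; field.
  by rewrite val_mkGL // det3 !mx3E (_ : _ + _ = (k 1 1)^-1) ?invr_eq0 //; ring.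
have -> : k = (b * (b^-1 * k))%g by rewrite mulgA mulgV mul1g.
rewrite f_borel // {1}/chi vb !mx3E subrr expr0z mul1r mulgA mulgV mul1g.
congr (_ * _); rewrite -[RHS](@f_Kcol 1%g (b^-1 * k)%g) ?mul1g //; split.
- by apply: KintM => //; exact: KintV.
- rewrite mulmx3E bV !mx3E (_ : _ + _ = 0) ?ball0 //; field; exact: k110.
- rewrite mulmx3E bV !mx3E (_ : _ - 1 = 0) ?ball0 //; field; exact: k110.
- by rewrite mulmx3E bV !mx3E !mul0r !add0r mul1r.
Qed.

(** In an Iwasawa decomposition w0 (um x y z) = b k, the entry b 2 2 scales the
    last row of k to (1, x, z) and b 1 1 * b 2 2 scales the minors of the last
    two rows to -1, -y, z - x y. As row and minors of k are primitive, their
    valuations determine those of b and decide whether newform_support allows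
    a nonzero value. *)
Lemma newform_bigcell x y z :
  f (w0 F * um x y z)%g = bigcell n theta mu x y z * f 1%g.
Proof.
have n1 : 1 <= n%:Z by [].
have [b [k [hb Kk e]]] := iwasawa (w0 F * um x y z)%g; have [hk _] := Kk.
have [b10 b20 b21] : [/\ b 1 0 = 0, b 2 0 = 0 & b 2 1 = 0] by apply/borelP.
have gE : gl3_mx (w0 F * um x y z)%g = mx3 0 0 1 0 1 y 1 x z.
  by rewrite gl3M val_w0 val_um; apply: eq_mx3; rewrite mulmx3E !mx3E; ring.
have ent i j : (mx3 0 0 1 0 1 y 1 x z) i j =
    b i 0 * k 0 j + b i 1 * k 1 j + b i 2 * k 2 j.
  by rewrite -gE e gl3M mulmx3E.
have r2 j : (mx3 0 0 1 0 1 y 1 x z) 2 j = b 2 2 * k 2 j.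
  by rewrite ent b20 b21 !mul0r !add0r.
have r1 j : (mx3 0 0 1 0 1 y 1 x z) 1 j = b 1 1 * k 1 j + b 1 2 * k 2 j.
  by rewrite ent b10 mul0r add0r.
have r20 := r2 0; have r21 := r2 1; have r22 := r2 2.
have r10 := r1 0; have r11 := r1 1; have r12 := r1 2.
rewrite !mx3E in r20 r21 r22 r10 r11 r12.
set B := b 2 2 in r20 r21 r22 *; set B1 := b 1 1 in r10 r11 r12 *.
pose m01 := k 1 0 * k 2 1 - k 1 1 * k 2 0.
pose m02 := k 1 0 * k 2 2 - k 1 2 * k 2 0.
pose m12 := k 1 1 * k 2 2 - k 1 2 * k 2 1.
have M01 : - 1 = B1 * B * m01.
  transitivity (0 * x - 1 * 1); first by ring.
  by rewrite {2}r20 r21 r10 {1}r11 /m01; ring.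
have M02 : - y = B1 * B * m02.
  transitivity (0 * z - y * 1); first by ring.
  by rewrite r20 r22 r10 r12 /m02; ring.
have M12 : z - x * y = B1 * B * m12.
  transitivity (1 * z - y * x); first by ring.
  by rewrite r21 r22 r11 r12 /m12; ring.
have B0 : B != 0 by apply: contra_eq_neq r20 => ->; rewrite mul0r oner_neq0.
have B10 : B1 != 0.
  by apply: contra_eq_neq M01 => ->; rewrite !mul0r oppr_eq0 oner_neq0.
pose A := b 0 0.
have detg : - 1 = A * B1 * B * \det (gl3_mx k).
  have <- : \det (mx3 0 0 1 0 1 y 1 x z) = - 1 by rewrite det3 !mx3E; ring.
  rewrite -gE e gl3M det_mulmx; congr (_ * _).
  by rewrite det3 b10 b20 b21 /A /B /B1; ring.
have A0 : A != 0.
  by apply: contra_eq_neq detg => ->; rewrite !mul0r oppr_eq0 oner_neq0.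
pose G := v B1 + v B.
have vA : v A = - G.
  have := congr1 v detg; rewrite ordN ord1 !ordM ?mulf_neq0 ?gl3_det //.
  by rewrite (Kint_det Kk) /G; lia.
have fk0 : f (w0 F * um x y z)%g = theta ^ (- G - v B) * mu B1 * f k.
  by rewrite e f_borel // /chi -/A vA.
have hB (j : int) (X c : F) : X = B * c -> ball j c -> ball (v B + j) X.
  by move=> ->; rewrite ball_Ml //; have -> : v B + j - v B = j by ring.
have hBG (j : int) (X c : F) : X = B1 * B * c -> ball j c -> ball (G + j) X.
  move=> ->; rewrite ball_Ml ?mulf_neq0 // ordM // -/G.
  by have -> : G + j - G = j by ring.
have hBi (j : int) (X c : F) : X = B * c -> ball (v B + j) X -> ball j c.
  by move=> ->; rewrite ball_Ml //; have -> : v B + j - v B = j by ring.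
have hBGi (j : int) (X c : F) : X = B1 * B * c -> ball (G + j) X -> ball j c.
  move=> ->; rewrite ball_Ml ?mulf_neq0 // ordM // -/G.
  by have -> : G + j - G = j by ring.
have hv (X c : F) : X = B * c -> c != 0 -> v X = v B + v c.
  by move=> -> c0; rewrite ordM.
have hvG (X c : F) : X = B1 * B * c -> c != 0 -> v X = G + v c.
  by move=> -> c0; rewrite !ordM ?mulf_neq0.
have k200 : k 2 0 != 0.
  by apply: contra_eq_neq r20 => ->; rewrite mulr0 oner_neq0.
clearbody G B B1 A.
have m01i : ball 0 m01 by apply: ballB; apply: ballMl.
have m02i : ball 0 m02 by apply: ballB; apply: ballMl.
have m12i : ball 0 m12 by apply: ballB; apply: ballMl.
have vB0 : v B <= 0.
  by have := hB 0 _ _ r20 (hk _ _); rewrite ballE ?oner_neq0 // ord1; ord_lia.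
have G0 : G <= 0.
  have := hBG 0 _ _ M01 m01i; rewrite ballE ?oppr_eq0 ?oner_neq0 // ordN ord1; ord_lia.
rewrite /bigcell; case: (boolP (ball 0 z)) => hz.
  case: (boolP (ball n%:Z x && ball 0 y)) => [/andP[hx hy]|hxy].
    have Kg : Kint (w0 F * um x y z)%g.
      apply: Kint_of_det; rewrite gE.
        by apply/ball_mx3; rewrite !ball0 !ball1 hy hz (@ballW F n%:Z).
      have -> : \det (mx3 0 0 1 0 1 y 1 x z) = - 1 by rewrite det3 !mx3E; ring.
      by rewrite ordN ord1.
    rewrite newform_value // gE !mx3E //.
      by rewrite mu_n // subrr ball0.
    by rewrite ballE ?oner_neq0 // ord1.
  rewrite mulr0n mul0r; apply/eqP; apply: contraNT hxy => fg.
  have fk : f k != 0 by move: fg; rewrite fk0 mulf_eq0 negb_or => /andP[].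
  have [k21 k11] := newform_support Kk fk.
  have vBE : v B = 0.
    apply/eqP; rewrite eq_le vB0 leNgt; apply/negP => vBn.
    have k20 : ball 1 (k 2 0).
      by apply: hBi r20 _; apply: ballW (ball1 F); ord_lia.
    have k22 : ball 1 (k 2 2) by apply: hBi r22 _; apply: ballW hz; ord_lia.
    by move: k22; apply/negP/Kint_row2 => //; apply: ballW k21.
  have hx : ball n%:Z x by have := hB n%:Z _ _ r21 k21; rewrite vBE add0r.
  rewrite hx /=; have [k110 vk11] := unit_ball (hk _ _) k11.
  have vk20 : v (k 2 0) = 0 by rewrite -[RHS](ord1 F) (hv _ _ r20 k200) vBE add0r.
  have [m010 vm01] : m01 != 0 /\ v m01 = 0.
    have -> : m01 = - (k 1 1 * k 2 0) + k 1 0 * k 2 1 by rewrite /m01; ring.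
    apply: ord_unit_add; first by rewrite oppr_eq0 mulf_neq0.
      by rewrite ordN ordM // vk11 vk20.
    by apply: ballMl => //; apply: ballW k21.
  have GE : G = 0.
    by have := hvG _ _ M01 m010; rewrite ordN (ord1 F) vm01 addr0 => <-.
  by have := hBG 0 _ _ M02 m02i; rewrite GE ballN.
have [z0 vz] := notball hz.
have Bz : v B <= v z.
  by have := hB 0 _ _ r22 (hk _ _); rewrite ballE //; ord_lia.
have k20 : ball 1 (k 2 0) by apply: hBi r20 _; apply: ballW (ball1 F); ord_lia.
have vBE : ball 1 (k 2 1) -> [/\ k 2 2 != 0, v (k 2 2) = 0 & v B = v z].
  move=> h21; have [k22 vk22] := unit_ball (hk 2 2) (Kint_row2 Kk k20 h21).
  by split => //; have := hv _ _ r22 k22; ord_lia.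
case: ifPn => [/and4P[hx z'0 vz' hy]|hc].
  have k21 : ball n%:Z (k 2 1).
    by apply: hBi r21 _; apply: ballW hx; ord_lia.
  have [k22 vk22 vB] := vBE (ballW n1 k21).
  have m12u : ~~ ball 1 m12.
    apply/negP => h12; have vG : G < v (z - x * y).
      by have := hBG 1 _ _ M12 h12; rewrite ballE //; ord_lia.
    move: h12; apply/negP; apply: Kint_minor => //.
      by apply: hBGi M01 _; rewrite ballN; apply: ballW (ball1 F); ord_lia.
    by apply: hBGi M02 _; rewrite ballN; apply: ballW hy; ord_lia.
  have [m120 vm12] := unit_ball m12i m12u.
  have k11 : ~~ ball 1 (k 1 1).
    apply: contra m12u => h11; apply: ballB; first exact: ballMr.
    by apply: ballMl => //; exact: ballW k21.
  have [k110 vk11] := unit_ball (hk _ _) k11.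
  have GE : v (z - x * y) = G.
    by rewrite (hvG _ _ M12 m120) vm12 addr0.
  have muE : mu ((z - x * y) / z) = mu B1 * mu (k 1 1).
    have -> : (z - x * y) / z = B1 * k 1 1 * (1 - k 1 2 * (k 2 1 / (k 2 2 * k 1 1))).
      by rewrite M12 r22 /m12; field; rewrite B0 k22 k110.
    have hu : ball n%:Z (1 - k 1 2 * (k 2 1 / (k 2 2 * k 1 1)) - 1).
      rewrite addrAC subrr add0r ballN; apply: ballMl => //.
      rewrite ball_Mr ?invr_eq0 ?mulf_neq0 // ordV ?mulf_neq0 // ordM //.
      by apply: ballW k21; rewrite vk22 vk11; ord_lia.
    have [u0 _] := ord_near1 n1 hu.
    by rewrite muM ?mulf_neq0 // muM // (mu_n hu) mulr1.
  rewrite fk0 newform_value // GE vB muE.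
  have -> : - G - v z = - v z - G by rewrite addrC.
  by rewrite !mulrA.
rewrite mul0r; apply/eqP; apply: contraNT hc => fg.
have fk : f k != 0 by move: fg; rewrite fk0 mulf_eq0 negb_or => /andP[].
have [k21 k11] := newform_support Kk fk.
have [k110 vk11] := unit_ball (hk _ _) k11.
have [k22 vk22 vB] := vBE (ballW n1 k21).
have [m120 vm12] : m12 != 0 /\ v m12 = 0.
  apply: ord_unit_add; first by rewrite mulf_neq0.
    by rewrite ordM // vk11 vk22.
  by rewrite ballN; apply: ballMl => //; exact: ballW k21.
have GE : v (z - x * y) = G by rewrite (hvG _ _ M12 m120) vm12 addr0.
apply/and4P; split.
- by have := hB n%:Z _ _ r21 k21; rewrite vB addrC.
- by rewrite M12 !mulf_neq0.
- by rewrite GE.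
- by have := hBG 0 _ _ M02 m02i; rewrite GE ballN addr0.
Qed.

End Newform.

(** * The conductor *)

Section BorelAndKcol.
Variable F : localField.
Implicit Types (x y z : F) (g h k u b : GL3 F).
Local Notation v := (@ord F).

Lemma borel_diag b : borel b -> [/\ b 0 0 != 0, b 1 1 != 0 & b 2 2 != 0].
Proof.
move=> /borelP[b10 b20 b21]; have := gl3_det b; rewrite det3 b10 b20 b21.
have -> : b 0 0 * (b 1 1 * b 2 2 - b 1 2 * 0) - b 0 1 * (0 * b 2 2 - b 1 2 * 0) +
    b 0 2 * (0 * 0 - b 1 1 * 0) = b 0 0 * b 1 1 * b 2 2 by ring.
by rewrite !mulf_eq0 !negb_or => /andP[/andP[]].
Qed.

Lemma borelM b b' : borel b -> borel b' -> borel (b * b')%g.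
Proof.
move=> /borelP[b10 b20 b21] /borelP[c10 c20 c21]; apply/borelP.
by rewrite !mulmx3E b10 b20 b21 c10 c20 c21; split; ring.
Qed.

Lemma borelV b : borel b -> borel (b^-1)%g.
Proof.
move=> hb; have [b00 b11 b22] := borel_diag hb; have /borelP[b10 b20 b21] := hb.
have row2 j : (b^-1)%g 2 j * 1 = (2 == j)%:R / b 2 2.
  have := congr1 (fun A : 'M[F]_3 => A 2 j) (mulmxV (gl3_unit b)).
  rewrite mulmx3E b20 b21 mxE => <-; field; exact: b22.
have row1 j : b 1 1 * (b^-1)%g 1 j + b 1 2 * (b^-1)%g 2 j = (1 == j)%:R.
  have := congr1 (fun A : 'M[F]_3 => A 1 j) (mulmxV (gl3_unit b)).
  by rewrite mulmx3E b10 mxE => <-; rewrite mul0r add0r.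
have z20 : (b^-1)%g 2 0 = 0 by have := row2 0; rewrite mulr1 => ->; rewrite mul0r.
apply/borelP; split=> //.
  by apply: (mulfI b11); have := row1 0; rewrite z20 !mulr0 addr0.
by have := row2 1; rewrite mulr1 => ->; rewrite mul0r.
Qed.

(** The inverse fixes the same column. *)
Lemma Kcol_inv n k : Kcol n k -> Kcol n (k^-1)%g.
Proof.
move=> [Kk k01 k11 k21]; have KV := KintV Kk; have [hV _] := KV.
have key (i : 'I_3) : ball n%:Z (k^-1%g i 1 - (i == 1)%:R).
  have -> : k^-1%g i 1 - (i == 1)%:R =
     - (k^-1%g i 0 * k 0 1 + k^-1%g i 1 * (k 1 1 - 1) + k^-1%g i 2 * k 2 1).
    have -> : (i == 1)%:R = (gl3_mx (k^-1)%g *m gl3_mx k) i 1.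
      by rewrite gl3V mulVmx ?gl3_unit // mxE.
    by rewrite mulmx3E; ring.
  by rewrite ballN; apply: ballD; [apply: ballD|]; apply: ballMl.
split; first by [].
- by have := key 0; rewrite subr0.
- exact: (key 1).
- by have := key 2; rewrite subr0.
Qed.

Lemma Kcol_K_group (w : F) n k : w != 0 -> v w = 1 -> Kcol n k ->
  K_group n ((diagGL (w ^+ n) 1 1)^-1 * k * diagGL (w ^+ n) 1 1)%g.
Proof.
move=> w00 w1 Kk; set d := diagGL _ _ _.
have W0 : w ^+ n != 0 by rewrite expf_neq0.
have vW : v (w ^+ n) = n%:Z by rewrite ordX // w1 mul1r.
have main h : Kcol n h -> mx_of_sets
    (oring (F:=F)) (oring (F:=F)) (pid (F:=F) (- n%:Z))
    (pid (F:=F) n) (one_pid (F:=F) n) (oring (F:=F))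
    (pid (F:=F) n) (pid (F:=F) n) (oring (F:=F)) (gl3_mx (d^-1 * h * d)%g).
  move=> [[hi _] h01 h11 h21].
  have e i j := @diag_conj F (w ^+ n) 1 1 h i j W0 (oner_neq0 F) (oner_neq0 F).
  rewrite /mx_of_sets /one_pid /= !e /= !divr1 !mulr1 mul1r divff // mulr1.
  split; split; apply/ballP => //.
  - by rewrite ball_Mr ?invr_eq0 // ordV // vW opprK add0r.
  - by rewrite ball_Mr ?invr_eq0 // ordV // vW opprK addNr.
  - by rewrite ball_Mr // vW subrr.
  - by rewrite ball_Mr // vW subrr.
split; first exact: main.
have -> : ((d^-1 * k * d)^-1 = d^-1 * k^-1 * d)%g by rewrite !invgM invgK mulgA.
by apply: main; exact: Kcol_inv.
Qed.

Lemma Gam_Kcol (n r : nat) k : (0 < r)%N -> (n <= r)%N -> Gam r%:Z k -> Kcol n k.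
Proof.
move=> r0 nr hk; have Kk : Kint k by apply: Gam_Kint hk; lia.
have h := (GamP _ _).1 (GamW (_ : n%:Z <= r%:Z) hk).
split=> //.
- by have := h nr 0 1; rewrite subr0.
- by have := h nr 1 1; rewrite eqxx.
- by have := h nr 2 1; rewrite subr0.
Qed.

End BorelAndKcol.

Section Conductor.
Variables (R : realType) (F : localField).
Implicit Types (x y z : F) (g h k u b : GL3 F).
Local Notation C := (R[i]).
Local Notation v := (@ord F).
Variables (theta : C) (mu : F -> C).
Hypothesis theta0 : theta != 0.
Hypothesis muM : forall x y, x != 0 -> y != 0 -> mu (x * y) = mu x * mu y.
Hypothesis mu0 : forall x, x != 0 -> mu x != 0.
Local Notation chi := (chi theta mu).
Local Notation prin := (prin theta mu).

Lemma chiM b b' : borel b -> borel b' -> chi (b * b')%g = chi b * chi b'.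
Proof.
move=> hb hb'; have [b00 b11 b22] := borel_diag hb.
have [c00 c11 c22] := borel_diag hb'.
have /borelP[b10 b20 b21] := hb; have /borelP[c10 c20 c21] := hb'.
rewrite /chi !mulmx3E b10 b20 b21 c10 c20 c21 !mulr0 !mul0r !addr0 !add0r.
rewrite !ordM // muM //.
have -> : v (b 0 0) + v (b' 0 0) - (v (b 2 2) + v (b' 2 2)) =
  (v (b 0 0) - v (b 2 2)) + (v (b' 0 0) - v (b' 2 2)) by ring.
by rewrite expfzDr // mulrACA.
Qed.

Lemma mu1 : mu 1 = 1.
Proof.
apply: (mulfI (mu0 (oner_neq0 F))).
by rewrite -muM ?oner_neq0 // !mulr1.
Qed.

Lemma chi1 : chi 1%g = 1.
Proof. by rewrite /chi /= !mxE /= subrr expr0z mul1r mu1. Qed.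

Section FixedVector.
Variables (n : nat) (f : GL3 F -> C).
Hypothesis f_borel : forall b g, borel b -> f (b * g)%g = chi b * f g.
Hypothesis f_Kcol : forall g k, Kcol n k -> f (g * k)%g = f g.
Hypothesis f_neq0 : f <> (fun=> 0).

Lemma newform_K : exists2 k, Kint k & f k != 0.
Proof.
apply: contrapT => H; apply: f_neq0; apply/funext => g.
have [b [k [hb Kk ->]]] := iwasawa g; rewrite f_borel //.
have [->|fk] := eqVneq (f k) 0; first by rewrite mulr0.
by case: H; exists k.
Qed.

(** For b = diag(1, a, 1) and k in GL_3(o), k^-1 b k is congruent to 1 modulo
    p^n, so f is invariant under it, while chi b = mu a. *)
Lemma mu_trivial a : a != 0 -> v a = 0 -> ball n%:Z (a - 1) -> mu a = 1.
Proof.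
move=> a0 va ha; have [k Kk fk] := newform_K; have [hk hV] := Kk.
pose b := diagGL 1 a 1.
have vb : gl3_mx b = mx3 1 0 0 0 a 0 0 0 1 by rewrite val_diag ?oner_neq0.
have db : \det (gl3_mx b) = a by rewrite vb det3 !mx3E; ring.
have Kb : Kint b.
  apply: Kint_of_det; rewrite ?db // vb; apply/ball_mx3.
  by rewrite !ball0 !ball1 ballE // va.
have hb : borel b by apply/borelP; rewrite vb !mx3E.
have cb : chi b = mu a by rewrite /chi vb !mx3E subrr expr0z mul1r.
have key (i : 'I_3) : ball n%:Z ((k^-1 * b * k)%g i 1 - (i == 1)%:R).
  have -> : (k^-1 * b * k)%g i 1 - (i == 1)%:R = k^-1%g i 1 * ((a - 1) * k 1 1).
    have -> : (i == 1)%:R = (gl3_mx (k^-1)%g *m gl3_mx k) i 1.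
      by rewrite gl3V mulVmx ?gl3_unit // mxE.
    rewrite -(mulgA (k^-1)%g) gl3M !(mulmx3E (gl3_mx (k^-1)%g)).
    by rewrite gl3M !(mulmx3E (gl3_mx b)) vb !mx3E; ring.
  by apply: ballMl => //; apply: ballMr.
have Kc : Kcol n (k^-1 * b * k)%g.
  split.
  - by do 2 (apply: KintM => //); exact: KintV.
  - by have := key 0; rewrite subr0.
  - by have := key 1; rewrite eqxx.
  - by have := key 2; rewrite subr0.
have := f_borel k hb; have -> : (b * k = k * (k^-1 * b * k))%g.
  by rewrite !mulgA mulgV mul1g.
rewrite f_Kcol // cb => e; apply: (mulIf fk).
by rewrite mul1r -e.
Qed.

End FixedVector.

(** ** A vector fixed by the group of Jacquet, Piatetski-Shapiro and Shalika *)

Section JPSSVector.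
Variable n : nat.
Hypothesis mu_n : forall a, a != 0 -> v a = 0 -> ball n%:Z (a - 1) -> mu a = 1.

Let J : set (GL3 F) := @JPSS_group F n.

Let JM h k : J h -> J k -> J (h * k)%g.
Proof.
have main (A B : 'M[F]_3) (o := oring (F:=F)) (p := pid (F:=F) n) :
    mx_of_sets o o o o o o p p (one_pid (F:=F) n) A ->
    mx_of_sets o o o o o o p p (one_pid (F:=F) n) B ->
    mx_of_sets o o o o o o p p (one_pid (F:=F) n) (A *m B).
  rewrite /mx_of_sets /one_pid /=.
  move=> [[/ballP a00 /ballP a01 /ballP a02] [/ballP a10 /ballP a11 /ballP a12]
          [/ballP a20 /ballP a21 /ballP a22]].
  move=> [[/ballP b00 /ballP b01 /ballP b02] [/ballP b10 /ballP b11 /ballP b12]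
          [/ballP b20 /ballP b21 /ballP b22]].
  have n0 : (0 : int) <= n%:Z by [].
  have a22' : ball 0 (A 2 2).
    by rewrite -(subrK 1 (A 2 2)); apply: ballD; [exact: ballW a22|exact: ball1].
  have b22' : ball 0 (B 2 2).
    by rewrite -(subrK 1 (B 2 2)); apply: ballD; [exact: ballW b22|exact: ball1].
  have [b20' b21'] := (ballW n0 b20, ballW n0 b21).
  rewrite !mulmx3E; split; split; apply/ballP;
    try by apply: ballD; [apply: ballD|]; apply: ballMl.
  - by apply: ballD; [apply: ballD; apply: ballMr|apply: ballMl].
  - by apply: ballD; [apply: ballD; apply: ballMr|apply: ballMl].
  - rewrite -addrA -addrA; apply: ballD; first exact: ballMr.
    apply: ballD; first exact: ballMr.
    have -> : A 2 2 * B 2 2 - 1 = A 2 2 * (B 2 2 - 1) + (A 2 2 - 1) by ring.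
    by apply: ballD => //; exact: ballMl.
move=> [h1 h2] [k1 k2]; split; first exact: main.
by rewrite invgM; exact: main.
Qed.

Let JV h : J h -> J (h^-1)%g.
Proof. by move=> [h1 h2]; split; rewrite ?invgK. Qed.

Let Gam_J k : Gam n.+1%:Z k -> J k.
Proof.
have main h : Gam n.+1%:Z h -> mx_of_sets (oring (F:=F)) (oring (F:=F)) (oring (F:=F))
    (oring (F:=F)) (oring (F:=F)) (oring (F:=F)) (pid (F:=F) n) (pid (F:=F) n)
    (one_pid (F:=F) n) (gl3_mx h).
  move=> hh; have hi : ball_mx 0 (gl3_mx h) by exact: Gam_int hh.
  have hP := (GamP _ _).1 (GamW (_ : n%:Z <= n.+1%:Z) hh).
  rewrite /mx_of_sets /one_pid /=; split; split; apply/ballP => //.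
  - by have := hP (leqnSn n) 2 0; rewrite subr0.
  - by have := hP (leqnSn n) 2 1; rewrite subr0.
  - by have := hP (leqnSn n) 2 2; rewrite eqxx.
by move=> hk; split; apply: main => //; exact: GamV.
Qed.

(* Exchanging the last two coordinates puts the condition on the last row of J
   where mu sits. *)
Let w : GL3 F := mkGL (mx3 1 0 0 0 0 1 0 1 0).

Let vw : gl3_mx w = mx3 1 0 0 0 0 1 0 1 0.
Proof.
apply: val_mkGL; rewrite det3 !mx3E.
by rewrite (_ : _ + _ = - 1) ?oppr_eq0 ?oner_neq0 //; ring.
Qed.

(* The elements of B that lie in w J w^-1 have unit diagonal entries, the
   middle one in 1 + p^n. *)
Let chi_J b h : borel b -> J h -> (b * w = w * h)%g -> chi b = 1.
Proof.
move=> hb [h1 h2] e; have [b00 b11 b22] := borel_diag hb.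
have [[/ballP a00 /ballP a01 /ballP a02] [/ballP a10 /ballP a11 /ballP a12]
  [/ballP a20 /ballP a21 /ballP a22]] := h1.
have [[/ballP c00 /ballP c01 /ballP c02] [/ballP c10 /ballP c11 /ballP c12]
  [/ballP c20 /ballP c21 /ballP c22]] := h2.
have n0 : (0 : int) <= n%:Z by [].
have near_int x : ball n%:Z (x - 1) -> ball 0 x.
  by move=> hx; rewrite -(subrK 1 x); apply: ballD; [exact: ballW hx|exact: ball1].
have Kh : Kint h.
  split.
    by do 2 (apply: I3P) => //; [exact: ballW a20|exact: ballW a21|exact: near_int].
  by do 2 (apply: I3P) => //; [exact: ballW c20|exact: ballW c21|exact: near_int].
have bw i j : (b * w)%g i j = (w * h)%g i j by rewrite e.
have h00 : b 0 0 = h 0 0.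
  by have := bw 0 0; rewrite !mulmx3E vw !mx3E !mulr0 !mul0r !addr0 mulr1 mul1r.
have h11 : b 1 1 = h 2 2.
  by have := bw 1 2; rewrite !mulmx3E vw !mx3E !mulr0 !mul0r !addr0 !add0r mulr1 mul1r.
have h22 : b 2 2 = h 1 1.
  by have := bw 2 1; rewrite !mulmx3E vw !mx3E !mulr0 !mul0r !addr0 !add0r mulr1 mul1r.
have vdet : v (b 0 0) + v (b 1 1) + v (b 2 2) = 0.
  have := congr1 (fun k : GL3 F => \det (gl3_mx k)) e; rewrite /= !det_mulmx mulrC.
  move/(mulfI (gl3_det w)); have /borelP[b10 b20 b21] := hb.
  rewrite [in LHS]det3 b10 b20 b21 => dE.
  rewrite -!ordM ?mulf_neq0 // -(Kint_det Kh) -dE; congr (v _); ring.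
have u x : x != 0 -> ball 0 x -> 0 <= v x by move=> x0; rewrite ballE.
have := u _ b00; have := u _ b11; have := u _ b22.
rewrite h00 h11 h22 => /(_ a11) p1 /(_ (near_int _ a22)) p2 /(_ a00) p0.
rewrite h00 h11 h22 in vdet b11.
rewrite /chi h00 h11 h22.
have -> : v (h 0 0) = 0 by ord_lia.
have -> : v (h 1 1) = 0 by ord_lia.
by rewrite subrr expr0z mul1r mu_n //; ord_lia.
Qed.

Let support g (bh : GL3 F * GL3 F) : Prop :=
  [/\ borel bh.1, J bh.2 & g = (bh.1 * w * bh.2)%g].

(* The extension of chi to B w J by right J-invariance, and by 0 elsewhere; it is
   well defined by chi_J. *)
Let vec g : C :=
  if pselect (exists bh, support g bh) is left e then chi (projT1 (cid e)).1 else 0.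

Let vecE g b h : borel b -> J h -> g = (b * w * h)%g -> vec g = chi b.
Proof.
move=> hb Jh ge; rewrite /vec; case: pselect => [e|[]]; last by exists (b, h).
case: (cid e) => -[b' h'] /= [/= hb' Jh' ge'].
have hbb : borel (b^-1 * b')%g by apply: borelM => //; exact: borelV.
have : chi (b^-1 * b')%g = 1.
  apply: (@chi_J _ (h * h'^-1)%g) => //; first by apply: JM => //; exact: JV.
  apply: (@mulgI _ b); apply: (@mulIg _ h'); rewrite !mulgA mulgV mul1g mulgVK.
  by rewrite -ge' ge.
move=> cb; have -> : b' = (b * (b^-1 * b'))%g by rewrite mulgA mulgV mul1g.
by rewrite chiM // cb mulr1.
Qed.

Let vec0 g : ~ (exists bh, support g bh) -> vec g = 0.
Proof. by rewrite /vec; case: pselect. Qed.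

Lemma has_JPSS_vector : has_fixed_vector prin (@JPSS_group F n).
Proof.
have vJ g k : J k -> vec (g * k)%g = vec g.
  move=> Jk; have [[[b h] /= [hb Jh ge]]|hN] := pselect (exists bh, support g bh).
    rewrite (vecE hb Jh ge) (@vecE _ b (h * k)%g) //; first exact: JM.
    by rewrite ge !mulgA.
  rewrite !vec0 // => -[[b h] /= [hb Jh ge]]; apply: hN.
  exists (b, (h * k^-1)%g); split => //=; first by apply: JM => //; exact: JV.
  by rewrite mulgA -ge mulgK.
exists vec; last first.
  move=> /(congr1 (@^~ w)) /eqP; rewrite (@vecE _ 1%g 1%g).
  - by rewrite chi1 oner_eq0.
  - by move=> i j ij; rewrite /= mxE; case: eqP ij => // ->; rewrite ltnn.
  - by apply: Gam_J; exact: Gam1.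
  - by rewrite mul1g mulg1.
split; last by move=> k Jk; apply/funext => g; exact: vJ.
split.
  exists n => k hk; apply/funext => g; apply: vJ; apply: Gam_J => i j.
  by apply/ballP; exact: hk.
move=> b g hb; have [[[b' h] /= [hb' Jh ge]]|hN] := pselect (exists bh, support g bh).
  rewrite (vecE hb' Jh ge) (@vecE _ (b * b')%g h) ?chiM //; first exact: borelM.
  by rewrite ge !mulgA.
rewrite !vec0 ?mulr0 // => -[[b' h] /= [hb' Jh ge]]; apply: hN.
exists ((b^-1 * b')%g, h); split => //=; first by apply: borelM => //; exact: borelV.
by rewrite -[LHS](mulKg b) ge !mulgA.
Qed.

End JPSSVector.
End Conductor.

(** * Whittaker values of the newform *)

Section WhittakerValues.
Variables (R : realType) (F : localField).
Implicit Types (x y z : F) (g k u b : GL3 F).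
Local Notation C := (R[i]).
Local Notation v := (@ord F).
Local Notation q := ((resq F)%:R : C).
Variables (theta : C) (mu : F -> C) (w : F) (n : nat).
Hypothesis w_neq0 : w != 0.
Hypothesis vw : v w = 1.
Hypothesis theta0 : theta != 0.
Hypothesis muM : forall x y, x != 0 -> y != 0 -> mu (x * y) = mu x * mu y.
Hypothesis mu0 : forall x, x != 0 -> mu x != 0.
Hypothesis n0 : (0 < n)%N.
Hypothesis mu_n : forall x, ball n%:Z (x - 1) -> mu x = 1.
Hypothesis mu_prim : exists a : F,
  [/\ a != 0, v a = 0, ball (n%:Z - 1) (a - 1) & mu a != 1].
Local Notation chi := (chi theta mu).
Local Notation prin := (prin theta mu).
Local Notation prin_level := (prin_level theta mu).

Lemma diagM (a b c a' b' c' : F) : a != 0 -> b != 0 -> c != 0 ->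
  a' != 0 -> b' != 0 -> c' != 0 ->
  (diagGL a b c * diagGL a' b' c')%g = diagGL (a * a') (b * b') (c * c').
Proof.
move=> *; apply: gl3_inj; rewrite gl3M !val_diag ?mulf_neq0 //.
by apply: eq_mx3; rewrite mulmx3E !mx3E; ring.
Qed.

Lemma diag_um (a b c : F) x y z : a != 0 -> b != 0 -> c != 0 ->
  (diagGL a b c * um x y z = um (a / b * x) (b / c * y) (a / c * z) * diagGL a b c)%g.
Proof.
move=> a0 b0 c0; apply: gl3_inj; rewrite !gl3M !val_diag // !val_um.
apply: eq_mx3; rewrite !mulmx3E !mx3E; field; by rewrite ?a0 ?b0 ?c0.
Qed.

Lemma borel_um_diag b : borel b -> exists x y z,
  b = (um x y z * diagGL (b 0 0 : F)%R (b 1 1 : F)%R (b 2 2 : F)%R)%g.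
Proof.
move=> hb; have [b00 b11 b22] := borel_diag hb.
have /borelP[b10 b20 b21] := hb.
exists (b 0 1 / b 1 1), (b 1 2 / b 2 2), (b 0 2 / b 2 2); apply: gl3_inj.
rewrite gl3M val_um val_diag //.
apply: eq_mx3; rewrite !mulmx3E !mx3E ?b10 ?b20 ?b21; try ring;
  by field; rewrite ?b11 ?b22.
Qed.

(** ** Composing the two averages *)

Section Tower.
Variables (r : int) (t1 t2 t3 : F).
Hypotheses (r1 : 1 <= r) (t10 : t1 != 0) (t20 : t2 != 0) (t30 : t3 != 0).
Hypotheses (t12 : v t2 <= v t1) (t23 : v t3 <= v t2).
Let t := diagGL t1 t2 t3.

Lemma coset_eq_fine u1 u2 : Uball 0 u1 -> Uball 0 u2 -> coset_eq r t u1 u2 ->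
  coset_eq r 1%g u1 u2 /\ ball r (u2 0 1 - u1 0 1 + (u2 1 2 - u1 1 2)).
Proof.
move=> [x [y [z [hx hy hz ->]]]] [x' [y' [z' [hx' hy' hz' ->]]]].
move=> /(coset_eq_um r t10 t20 t30)[h1 h2 h3].
have h1' : ball r (x' - x) by apply: ballW h1; ord_lia.
have h2' : ball r (y' - y) by apply: ballW h2; ord_lia.
split; last first.
  have [-> ->] := um_entries x y z; have [-> ->] := um_entries x' y' z'.
  exact: ballD.
rewrite -(diag1 F); apply/(coset_eq_um r (oner_neq0 F) (oner_neq0 F) (oner_neq0 F)).
rewrite subrr !addr0; split=> //; apply: ballW h3; ord_lia.
Qed.

Lemma coset_eq_mull h u1 u2 : coset_eq r t (h * u1)%g (h * u2)%g = coset_eq r t u1 u2.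
Proof. by rewrite /coset_eq invgM !mulgA mulgVK. Qed.

(** For dominant t the relation u1 t Gam = u2 t Gam refines u1 Gam = u2 Gam, and
    U(p^r) is the class of 1 for the latter in U(o). *)
Lemma tower_transversal (s0 s : seq (GL3 F)) :
  transversal (coset_eq r 1%g) (Uball 0) s0 ->
  transversal (coset_eq r t) (Uball r) s ->
  transversal (coset_eq r t) (Uball 0) [seq (u * u')%g | u <- s0, u' <- s].
Proof.
move=> [u0 A0 E0 S0] [us As Es Ss]; have r0 : 0 <= r by ord_lia.
have Ut u : Uball r u -> Uball 0 u.
  move=> [x [y [z [hx hy hz ->]]]]; exists x, y, z.
  by rewrite !(@ballW F r 0).
have [R1 S1 T1] := coset_eq_equiv (1%g : GL3 F) r1.
have [Rt St Tt] := coset_eq_equiv t r1.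
have c1 u u' : Uball r u' -> coset_eq r 1%g u (u * u')%g.
  move=> [x [y [z [hx hy hz ->]]]].
  by rewrite /coset_eq invg1 mulg1 mul1g mulKg; apply/Gam_um.
have key (u u' x x' : GL3 F) : u \in s0 -> u' \in s0 -> x \in s -> x' \in s ->
    coset_eq r t (u * x)%g (u' * x')%g -> u = u' /\ x = x'.
  move=> hu hu' hx hx' h.
  have U1 := UballM (lexx 0) (A0 _ hu) (Ut _ (As _ hx)).
  have U2 := UballM (lexx 0) (A0 _ hu') (Ut _ (As _ hx')).
  have [h1 _] := coset_eq_fine U1 U2 h.
  have e : u = u'.
    apply: E0 => //; apply: (T1 _ _ _ (c1 _ _ (As _ hx))).
    by apply: (T1 _ _ _ h1); apply/S1/c1/As.
  by split=> //; apply: Es => //; move: h; rewrite e coset_eq_mull.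
split.
- apply: allpairs_uniq => // -[u x] [u' x'].
  move=> /allpairsP[[? ?] /= [hu hx [-> ->]]] /allpairsP[[? ?] /= [hu' hx' [-> ->]]].
  move=> e; have [|-> ->] // := key _ _ _ _ hu hu' hx hx'.
  by rewrite e; exact: Rt.
- move=> _ /allpairsP[[u x] /= [hu hx ->]].
  by apply: UballM => //; [exact: A0|exact/Ut/As].
- move=> _ _ /allpairsP[[u x] /= [hu hx ->]] /allpairsP[[u' x'] /= [hu' hx' ->]].
  by move=> /key[] // -> ->.
- move=> y hy; have [u hu yu] := S0 y hy.
  have hz : Uball r (u^-1 * y)%g.
    have [a [b [c [_ _ _ e]]]] := UballM (lexx 0) (UballV (lexx 0) (A0 _ hu)) hy.
    have := S1 _ _ yu; rewrite /coset_eq invg1 mulg1 mul1g e => /Gam_um[ha hb hc].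
    by exists a, b, c.
  have [x hx zx] := Ss _ hz; exists (u * x)%g.
    by apply/allpairsP; exists (u, x).
  by have := coset_eq_mull u (u^-1 * y)%g x; rewrite mulgA mulgV mul1g => ->.
Qed.

End Tower.

Variables (psi : F -> C) (Phi : (GL3 F -> C) -> (GL3 F -> C)) (f : GL3 F -> C).
Hypothesis psiD : forall x y, psi (x + y) = psi x * psi y.
Hypothesis psi_o : forall x, ball 0 x -> psi x = 1.
Hypothesis psi_prim : exists2 x, ball (-1) x & psi x != 1.
Hypothesis hPhi : whittaker_embedding psi prin Phi.
Hypothesis f_borel : forall b g, borel b -> f (b * g)%g = chi b * f g.
Hypothesis f_Kcol : forall g k, Kcol n k -> f (g * k)%g = f g.
Hypothesis f_neq0 : f <> (fun=> 0).
Hypothesis theta_q : 1 - theta ^+ 2 * q != 0.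

Let r : nat := n.+1.
Let r1 : 1 <= r%:Z. Proof. by []. Qed.
Let nr : n%:Z + 1 <= r%:Z. Proof. by rewrite /r; ord_lia. Qed.
Let W (k : int) : w ^ k != 0. Proof. by rewrite expfz_neq0. Qed.
Let vW (k : int) : v (w ^ k) = k. Proof. by rewrite ordXz // vw mul1r. Qed.

Let f_level : prin_level r f.
Proof.
by split=> // g k hk; apply: f_Kcol; apply: (@Gam_Kcol _ n r).
Qed.

(* Conjugation by tr turns psi into a character of conductor p^r, as required
   for functional_compare. *)
Let tr := diagGL (w ^ (- r%:Z)) 1 (w ^ r%:Z).
Let L (h : GL3 F -> C) : C := Phi h tr.
Let Psi x : C := psi (w ^ (- r%:Z) * x).

Let PsiD x y : Psi (x + y) = Psi x * Psi y.
Proof. by rewrite /Psi mulrDr psiD. Qed.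

Let Psi_r x : ball r x -> Psi x = 1.
Proof. by move=> hx; apply: psi_o; rewrite ball_Ml // vW opprK add0r. Qed.

Let Psi_prim : exists2 s, ball (r%:Z - 1) s & Psi s != 1.
Proof.
have [s hs Ps] := psi_prim; exists (w ^ r%:Z * s).
  by rewrite ball_Ml // vW; apply: ballW hs; ord_lia.
by rewrite /Psi mulrA -expfzDr // addNr expr0z mul1r.
Qed.

Let Phi0 : Phi (fun=> 0) = fun=> 0.
Proof.
have [Pl _ _ _] := hPhi; have := Pl (-1) _ _ (prin0 theta mu) (prin0 theta mu).
rewrite (_ : (fun g => _) = fun=> 0); last by apply/funext => g; rewrite mulr0 addr0.
by move=> {1}->; apply/funext => g; rewrite mulN1r addNr.
Qed.

Let Phi_sum (s : seq (GL3 F)) (c : GL3 F -> C) (h : GL3 F -> GL3 F -> C) :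
  (forall u, prin (h u)) ->
  Phi (fun g => \sum_(u <- s) c u * h u g) = fun g => \sum_(u <- s) c u * Phi (h u) g.
Proof.
move=> hh; have [Pl _ _ _] := hPhi; elim: s => [|u s IH].
  rewrite (_ : (fun g => _) = fun=> 0); last by apply/funext => g; rewrite big_nil.
  by rewrite Phi0; apply/funext => g; rewrite big_nil.
rewrite (_ : (fun g => _) = fun g => c u * h u g + \sum_(u <- s) c u * h u g).
  rewrite Pl //; first by rewrite IH; apply/funext => g; rewrite big_cons.
  exact: prin_sum.
by apply/funext => g; rewrite big_cons.
Qed.

Let Phi_um h x y z g : prin h -> Phi h (um x y z * g)%g = psi (x + y) * Phi h g.
Proof.
move=> hh; have [_ _ _ Pu] := hPhi; rewrite Pu //; last exact: um_unipotent.
by have [-> ->] := um_entries x y z.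
Qed.

Let Phi_rtrans h g k : prin h -> Phi (rtrans k h) g = Phi h (g * k)%g.
Proof. by move=> hh; have [_ Pr _ _] := hPhi; rewrite Pr. Qed.

Let tr_um x y z : (tr * um x y z =
  um (w ^ (- r%:Z) * x) (w ^ (- r%:Z) * y) (w ^ (- r%:Z) / w ^ r%:Z * z) * tr)%g.
Proof.
rewrite diag_um ?oner_neq0 // divr1 mul1r.
by rewrite -invr_expz.
Qed.

Let L_um h x y z : prin h -> L (rtrans (um x y z) h) = Psi (x + y) * L h.
Proof.
by move=> hh; rewrite /L Phi_rtrans // tr_um Phi_um // -mulrDr.
Qed.

Let L_sum (s : seq (GL3 F)) (c : GL3 F -> C) (h : GL3 F -> GL3 F -> C) :
  (forall u, prin (h u)) ->
  L (fun g => \sum_(u <- s) c u * h u g) = \sum_(u <- s) c u * L (h u).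
Proof. by move=> hh; rewrite /L Phi_sum. Qed.

(* The translations by u in U(p^r) act on L by Psi = 1. *)
Let L_hecke (t1 t2 t3 : F) s h : prin h ->
  (forall u, u \in s -> Uball r u) ->
  L (hecke t1 t2 t3 s h) = (size s)%:R * Phi h (tr * diagGL t1 t2 t3)%g.
Proof.
move=> hh sU; rewrite /hecke L_sum; last by move=> u; exact: prin_rtrans.
rewrite (eq_big_seq (fun=> Phi h (tr * diagGL t1 t2 t3)%g)).
  by rewrite big_const_seq count_predT iter_addr_0 mulr_natl.
move=> u /sU[x [y [z [hx hy hz ->]]]]; rewrite mul1r.
have -> : rtrans (um x y z * diagGL t1 t2 t3)%g h =
    rtrans (um x y z) (rtrans (diagGL t1 t2 t3) h).
  by apply/funext => g; rewrite /rtrans mulgA.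
rewrite L_um; last exact: prin_rtrans.
by rewrite Psi_r ?mul1r /L ?Phi_rtrans //; exact: ballD.
Qed.

Let slist (a b : int) : seq (GL3 F) :=
  umlist (reps F r (r%:Z + a)) (reps F r (r%:Z + b)) (reps F r (r%:Z + (a + b))).

Let slist_transversal (t1 t2 t3 : F) : t1 != 0 -> t2 != 0 -> t3 != 0 ->
  v t2 <= v t1 -> v t3 <= v t2 ->
  transversal (coset_eq r (diagGL t1 t2 t3)) (Uball r)
    (slist (v t1 - v t2) (v t2 - v t3)).
Proof.
move=> t10 t20 t30 t12 t23; apply: umlist_transversal => //; apply: repsP; ord_lia.
Qed.

Let size_slist (a b : int) : 0 <= a -> 0 <= b ->
  (size (slist a b))%:R = q ^ (2 * (a + b)) :> C.
Proof.
move=> a0 b0.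
have sr (c d : int) : c <= d -> (size (reps F c d))%:R = q ^ (d - c) :> C.
  by move=> cd; rewrite -sum1_reps // big_const_seq count_predT iter_addr_0.
rewrite /slist /umlist !size_allpairs !natrM !sr ?lerDl ?addr_ge0 //.
rewrite -!expfzDr ?q_neq0 //; congr (_ ^ _); ring.
Qed.

Section Translate.
Variable m : nat.
Let A : int := r%:Z + m%:Z - n%:Z.
Let B : int := r%:Z + m%:Z.
Let t := diagGL (w ^ A) 1 (w ^ (- B)).

Let A0 : 0 <= A. Proof. by rewrite /A /r; ord_lia. Qed.
Let B0 : 0 <= B. Proof. by []. Qed.

(** A vector of level r whose image under L is a multiple of the value of Phi f at
    diag(w^(m-n), 1, w^(-m)). *)
Definition translate : GL3 F -> C :=
  hecke (w ^ A) 1 (w ^ (- B)) (slist A B) f.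

Let vt12 : v (w ^ A) - v 1 = A. Proof. by rewrite vW ord1 subr0. Qed.
Let vt23 : v 1 - v (w ^ (- B)) = B. Proof. by rewrite vW ord1 sub0r opprK. Qed.
Let vt12' : v 1 <= v (w ^ A). Proof. by rewrite vW ord1. Qed.
Let vt23' : v (w ^ (- B)) <= v 1. Proof. by rewrite vW ord1 oppr_le0. Qed.

Let slist_tr : transversal (coset_eq r t) (Uball r) (slist A B).
Proof.
by have := slist_transversal (W A) (oner_neq0 F) (W (- B)) vt12' vt23'; rewrite vt12 vt23.
Qed.

Lemma translate_level : prin_level r translate.
Proof. by apply: hecke_level => //; rewrite ?oner_neq0 // ord1 vW ?oppr_le0. Qed.

Lemma translate_L : L translate =
  q ^ (2 * (A + B)) * Phi f (diagGL (w ^ (m%:Z - n%:Z)) 1 (w ^ (- m%:Z))).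
Proof.
rewrite /translate L_hecke; last first.
- by have [_ sA _ _] := slist_tr.
- exact: prin_levelP f_level.
rewrite size_slist // /tr diagM ?oner_neq0 // -!expfzDr // mulr1.
by congr (_ * Phi f (diagGL (w ^ _) 1 (w ^ _))); rewrite /A /B; ring.
Qed.

Let scaled (c : int) : 0 <= c ->
  transversal (cong (r%:Z + c)) [set x | ball 0 x] [seq w ^ c * x | x <- reps F (- c) r].
Proof.
move=> c0; have cr : - c <= r%:Z by ord_lia.
apply: transversal_map (cong_equiv F _) (cong_equiv F _) (repsP F cr) _ _ _ => /=.
- by move=> x hx; rewrite ball_Ml // vW sub0r.
- move=> x y _ _; rewrite /cong -mulrBr ball_Ml // vW.
  by have -> : r%:Z + c - c = r by ring.
- move=> y hy; exists (w ^ (- c) * y); first by rewrite ball_Ml // vW subrr.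
  by rewrite mulrA -expfzDr // subrr expr0z mul1r /cong subrr ball0.
Qed.

Let big_list : seq (GL3 F) :=
  umlist [seq w ^ A * x | x <- reps F (- A) r] [seq w ^ B * x | x <- reps F (- B) r]
    [seq w ^ (A + B) * x | x <- reps F (- (A + B)) r].

Let big_list_tr : transversal (coset_eq r t) (Uball 0) big_list.
Proof.
apply: umlist_transversal; rewrite ?oner_neq0 ?vt12 ?vt23 //; apply: scaled => //.
exact: addr_ge0.
Qed.

Let Upsi_Uball u : Uball r u -> Upsi Psi u = 1.
Proof.
by move=> [x [y [z [hx hy hz ->]]]]; rewrite Upsi_um Psi_r //; exact: ballD.
Qed.

(* The sums over U(o) / U(p^r) and U(p^r) / t U(p^r) t^-1 combine; for the
   quotient the representatives are rescaled so that moving t to the left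
   across them gives the coordinates of jacquet_sum. *)
Let jacquet_tower : jacquet r Psi translate =
  \sum_(u <- big_list) (Upsi Psi u)^-1 * f (w0 F * u * t)%g.
Proof.
have U0r := U0list_transversal F r1.
rewrite (transversal_sum (coset_eq_equiv t r1) big_list_tr
   (tower_transversal r1 (W A) (oner_neq0 F) (W (- B)) vt12' vt23' U0r slist_tr)); last first.
  move=> u1 u2 h1 h2 e; rewrite (coset_eq_fun f_level _ e).
  have [_ h] := coset_eq_fine r1 (W A) (oner_neq0 F) (W (- B)) vt12' vt23' h1 h2 e.
  rewrite /Upsi; have -> : u2 0 1 + u2 1 2 =
     (u1 0 1 + u1 1 2) + (u2 0 1 - u1 0 1 + (u2 1 2 - u1 1 2)) by ring.
  by rewrite [in RHS]PsiD (Psi_r h) mulr1.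
rewrite big_allpairs_dep /jacquet big_seq [RHS]big_seq; apply: eq_bigr => u us.
rewrite /translate /hecke mulr_sumr big_seq [RHS]big_seq; apply: eq_bigr => u' us'.
have [_ sA0 _ _] := U0r; have [_ sA _ _] := slist_tr.
have Ur : Uball 0 u'.
  have [x [y [z [hx hy hz ->]]]] := sA _ us'; exists x, y, z.
  by rewrite !(@ballW F r 0).
rewrite (UpsiM PsiD (sA0 _ us) Ur) (Upsi_Uball (sA _ us')) mulr1 mul1r.
by rewrite /rtrans !mulgA.
Qed.

Lemma jacquet_translate : jacquet r Psi translate =
  theta ^ (- (A + B)) * f 1%g * (q ^ (3 * r%:Z - n%:Z) * (1 - theta ^+ 2 * q) *
    \sum_(l < (2 * m).+1) (theta ^+ 2 * q ^+ 2) ^+ l).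
Proof.
pose psi' x : C := (psi x)^-1.
have psi_neq0 x : psi x != 0.
  apply/eqP => e; have := psiD x (- x); rewrite subrr psi_o ?ball0 // e mul0r => /eqP.
  by rewrite oner_eq0.
have hpsi' : unramified_char psi'.
  split=> [x y|x hx|]; rewrite /psi'.
  - by rewrite psiD invfM.
  - by rewrite psi_o // invr1.
  - by have [x hx Px] := psi_prim; exists x => //; rewrite invr_eq1.
have fE x y z : f (w0 F * um (w ^ A * x) (w ^ B * y) (w ^ (A + B) * z) * t)%g =
    theta ^ (- (A + B)) * f 1%g * bigcell n theta mu x y z.
  have -> : (w0 F * um (w ^ A * x) (w ^ B * y) (w ^ (A + B) * z) * t =
      diagGL (w ^ (- B)) 1 (w ^ A) * (w0 F * um x y z))%g.
    apply: gl3_inj; rewrite !gl3M val_w0 !val_um !val_diag ?oner_neq0 //.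
    rewrite expfzDr // -!invr_expz.
    by apply: eq_mx3; rewrite !mulmx3E !mx3E; field; rewrite ?W.
  have hb : borel (diagGL (w ^ (- B)) 1 (w ^ A)).
    by apply/borelP; rewrite val_diag ?oner_neq0 // !mx3E.
  rewrite f_borel // (newform_bigcell n0 muM mu_n mu_prim f_borel f_Kcol).
  rewrite /chi val_diag ?oner_neq0 // !mx3E !vW.
  rewrite (mu1 muM mu0) mulr1; have -> : - B - A = - (A + B) by ring.
  by ring.
have -> : jacquet r Psi translate = theta ^ (- (A + B)) * f 1%g *
    \sum_(x <- reps F (- A) r) \sum_(y <- reps F (- B) r)
    \sum_(z <- reps F (- (A + B)) r)
      psi' (w ^ (m%:Z - n%:Z) * x) * psi' (w ^ m%:Z * y) * bigcell n theta mu x y z.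
  rewrite jacquet_tower sum_umlist mulr_sumr big_map; apply: eq_bigr => x _.
  rewrite mulr_sumr big_map; apply: eq_bigr => y _.
  rewrite mulr_sumr big_map; apply: eq_bigr => z _.
  rewrite fE Upsi_um PsiD /Psi !mulrA -!expfzDr //.
  have -> : - r%:Z + A = m%:Z - n%:Z by rewrite /A; ring.
  have -> : - r%:Z + B = m%:Z by rewrite /B; ring.
  by rewrite invfM /psi'; ring.
by congr (_ * _); apply: jacquet_sum.
Qed.

End Translate.

Let f1_neq0 : f 1%g != 0.
Proof.
have [k Kk fk] := newform_K f_borel f_neq0.
have [k21 k11] := newform_support n0 mu_prim f_borel f_Kcol Kk fk.
apply: contra_neq fk => f10.
by rewrite (newform_value f_borel f_Kcol Kk k21 k11) f10 mulr0.
Qed.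

(* Suppose L vanishes at level r. By the Iwasawa decomposition Phi f is
   determined by the values of Phi h on the torus for the K-translates h of f.
   At tr t with t dominant this value is a multiple of L of a Hecke translate,
   hence 0; at the other torus elements it is 0 because there psi is nontrivial
   on conjugates of U(p^r), which fixes h. So Phi f = 0, against injectivity. *)
Let L_nonzero : exists2 h, prin_level r h & L h != 0.
Proof.
apply: contrapT => H.
have L0 h : prin_level r h -> L h = 0.
  by move=> hh; apply: contrapT => Lh; apply: H; exists h => //; apply/eqP.
apply: f_neq0; have [_ _ Pinj _] := hPhi.
apply: Pinj; first exact: prin_levelP f_level.
apply/funext => g; have [b [k [hb Kk ->]]] := iwasawa g.
have [x [y [z ->]]] := borel_um_diag hb.
have [b00 b11 b22] := borel_diag hb.
move: (b 0 0) (b 1 1) (b 2 2) b00 b11 b22 => b0 b1 b2 b00 b11 b22.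
rewrite -mulgA Phi_um; last exact: prin_levelP f_level.
rewrite -Phi_rtrans; last exact: prin_levelP f_level.
pose h := rtrans k f; have hh : prin_level r h.
  have [fb fr] := f_level; split=> [b' g' hb'|g' k' hk'].
    by have := fb b' (g' * k)%g hb'; rewrite mulgA.
  have e : (g' * k' * k = g' * k * (k^-1 * k' * k))%g.
    by rewrite !mulgA mulgK.
  by rewrite /h /rtrans e (fr _ (k^-1 * k' * k)%g) //; exact: Gam_conj.
have ph := prin_levelP hh; rewrite -/h.
suff -> : Phi h (diagGL b0 b1 b2) = 0 by rewrite mulr0.
have [s0 hs0 Ps0] := psi_prim.
have kill x' y' : ball r x' -> ball r y' -> psi (b0 / b1 * x' + b1 / b2 * y') != 1 ->
    Phi h (diagGL b0 b1 b2) = 0.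
  move=> hx hy Pne; have : Phi (rtrans (um x' y' 0) h) (diagGL b0 b1 b2) =
      psi (b0 / b1 * x' + b1 / b2 * y') * Phi h (diagGL b0 b1 b2).
    by rewrite Phi_rtrans // diag_um // Phi_um.
  have -> : rtrans (um x' y' 0) h = h.
    apply/funext => g'; have [_ hr] := hh; apply: hr; apply/Gam_um.
    by rewrite ball0.
  move=> /eqP; rewrite -subr_eq0 -{1}[Phi h _]mul1r -mulrBl mulf_eq0 subr_eq0.
  by rewrite eq_sym (negbTE Pne) => /eqP.
pose t1 := b0 * w ^ r%:Z; pose t3 := b2 * w ^ (- r%:Z).
have t10 : t1 != 0 by rewrite mulf_neq0.
have t30 : t3 != 0 by rewrite mulf_neq0.
have vt1 : v t1 = v b0 + r%:Z by rewrite ordM // vW.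
have vt3 : v t3 = v b2 - r%:Z by rewrite ordM // vW.
case: (lerP (v b1) (v t1)) => h12; last first.
  apply: (@kill (b1 / b0 * s0) 0); rewrite ?ball0 //.
    by rewrite ball_Ml ?mulf_neq0 ?invr_eq0 // ord_div //; apply: ballW hs0; ord_lia.
  by rewrite mulr0 addr0 (_ : b0 / b1 * _ = s0) //; field; rewrite b00 b11.
case: (lerP (v t3) (v b1)) => h23; last first.
  apply: (@kill 0 (b2 / b1 * s0)); rewrite ?ball0 //.
    by rewrite ball_Ml ?mulf_neq0 ?invr_eq0 // ord_div //; apply: ballW hs0; ord_lia.
  by rewrite mulr0 add0r (_ : b1 / b2 * _ = s0) //; field; rewrite b22 b11.
pose s := slist (v t1 - v b1) (v b1 - v t3).
have sT := slist_transversal t10 b11 t30 h12 h23.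
have := L0 _ (hecke_level r1 t10 b11 t30 h12 h23 sT hh).
rewrite L_hecke //; last by have [_ sA _ _] := sT.
have -> : (tr * diagGL t1 b1 t3)%g = diagGL b0 b1 b2.
  rewrite diagM ?oner_neq0 // mul1r /t1 /t3 -!invr_expz.
  by congr diagGL; field; rewrite ?W.
move=> /eqP; rewrite mulf_eq0 size_slist ?subr_ge0 // expfz_eq0 (negbTE (q_neq0 F C)).
by rewrite andbF => /eqP.
Qed.

(** Compare translate m with translate 0 through functional_compare; L is
    nonzero on translate 0 because it is nonzero somewhere and the Jacquet
    integral of translate 0 does not vanish. *)
Lemma whittaker_values :
  Phi f (diagGL (w ^ (- n%:Z)) 1 1) != 0 /\
  forall m : nat, Phi f (diagGL (w ^ (m%:Z - n%:Z)) 1 (w ^ (- m%:Z))) =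
    theta ^- (2 * m) * q ^- (4 * m) *
    (\sum_(l < (2 * m).+1) (theta ^+ 2 * q ^+ 2) ^+ l) *
    Phi f (diagGL (w ^ (- n%:Z)) 1 1).
Proof.
have cmp h1 h2 : prin_level r h1 -> prin_level r h2 ->
    jacquet r Psi h2 * L h1 = jacquet r Psi h1 * L h2.
  move=> H1 H2; apply: (functional_compare n0 mu_n _ PsiD Psi_r Psi_prim L_sum L_um H1 H2).
  exact: nr.
have S1 : \sum_(l < (2 * 0).+1) (theta ^+ 2 * q ^+ 2) ^+ l = 1.
  by rewrite muln0 big_ord_recl big_ord0 expr0 addr0.
have j0 : jacquet r Psi (translate 0) != 0.
  rewrite jacquet_translate S1 mulr1.
  by rewrite !mulf_neq0 // expfz_neq0 // q_neq0.
have tl0 := translate_L 0; rewrite sub0r oppr0 expr0z in tl0.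
have L00 : L (translate 0) != 0.
  have [h hh Lh] := L_nonzero.
  have := cmp _ _ hh (translate_level 0) => e.
  have : jacquet r Psi (translate 0) * L h != 0 by rewrite mulf_neq0.
  by rewrite e mulf_eq0 negb_or => /andP[].
split; first by move: L00; rewrite tl0 mulf_eq0 negb_or => /andP[].
move=> m; have := cmp _ _ (translate_level m) (translate_level 0).
rewrite translate_L tl0 !jacquet_translate S1 mulr1.
set S := \sum_(l < (2 * m).+1) _; set P := Phi f _; set P0 := Phi f _.
set X := q ^ (3 * r%:Z - n%:Z) * (1 - theta ^+ 2 * q).
set N0 := r%:Z + 0%N%:Z - n%:Z + (r%:Z + 0%N%:Z).
set N1 := r%:Z + m%:Z - n%:Z + (r%:Z + m%:Z).
have N1E : N1 = N0 + (2 * m)%N%:Z by rewrite /N1 /N0 PoszM; ring.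
have X0 : X != 0 by rewrite mulf_neq0 // expfz_neq0 // q_neq0.
have e1 : theta ^ (- N0) = theta ^ (- N1) * theta ^+ (2 * m).
  by rewrite [theta ^+ _]exprnP -expfzDr // N1E; congr (_ ^ _); ring.
have e2 : q ^ (2 * N1) = q ^ (2 * N0) * q ^+ (4 * m).
  rewrite [q ^+ _]exprnP -expfzDr ?q_neq0 // N1E; congr (_ ^ _).
  by rewrite !PoszM; ring.
rewrite e1 e2 => E.
have T0 : theta ^ (- N1) != 0 by rewrite expfz_neq0.
have Q0 : q ^ (2 * N0) != 0 by rewrite expfz_neq0 // q_neq0.
have Tm : theta ^+ (2 * m) != 0 by rewrite expf_neq0.
have Qm : q ^+ (4 * m) != 0 by rewrite expf_neq0 // q_neq0.
have f10 := f1_neq0.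
have Y0 : theta ^ (- N1) * f 1%g * X * q ^ (2 * N0) != 0.
  by do 3 (apply: mulf_neq0 => //).
apply: (mulfI Tm); apply: (mulfI Qm); apply: (mulfI Y0).
transitivity (theta ^ (- N1) * theta ^+ (2 * m) * f 1%g * X *
    (q ^ (2 * N0) * q ^+ (4 * m) * P)); first by ring.
by rewrite E; field; rewrite Tm Qm.
Qed.

End WhittakerValues.

(** * The representation of the theorem *)

Section InducingCharacter.
Variables (R : realType) (F : localField).
Implicit Types (x y z : F) (g k u b : GL3 F).
Local Notation C := (R[i]).
Local Notation v := (@ord F).
Local Notation q := ((resq F)%:R : R).
Variables (alpha : R) (mu : F -> C).
Let tau : R := q^-1 `^ alpha.

Let q0 : 0 < q. Proof. by rewrite ltr0n ltnW ?resq_gt1. Qed.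

Lemma absvE x : x != 0 -> absv R x = q^-1 ^ v x.
Proof. by move=> /negbTE x0; rewrite /absv x0 -exprz_inv. Qed.

Lemma abs_powerE x : x != 0 -> abs_power alpha x = (tau ^ v x)%:C.
Proof.
move=> x0; rewrite /abs_power absvE //; congr (_%:C).
have qV : 0 <= q^-1 by rewrite invr_ge0 ltW.
by rewrite -powR_intmul // -powRrM mulrC powRrM powR_intmul // powR_ge0.
Qed.

Lemma abs_powerNE x : x != 0 -> abs_power (- alpha) x = (tau ^ (- v x))%:C.
Proof.
move=> x0; rewrite /abs_power powRN; have := abs_powerE x0.
rewrite /abs_power => /complexI ->; congr (_%:C).
by rewrite -invr_expz.
Qed.

Lemma IndE : Ind (abs_power alpha) mu (abs_power (- alpha)) =
  prin (tau / q)%:C mu.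
Proof.
have tau0 : tau != 0 by rewrite gt_eqF // powR_gt0 // invr_gt0.
have e b : borel b -> abs_power alpha (b 0 0) * mu (b 1 1) *
    abs_power (- alpha) (b 2 2) * (Num.sqrt (modulus R b))%:C =
    chi (tau / q)%:C mu b.
  move=> hb; have [b00 b11 b22] := borel_diag hb.
  rewrite abs_powerE // abs_powerNE // /modulus sqrtr_sqr !absvE //.
  rewrite ger0_norm; last by rewrite divr_ge0 // exprz_ge0 // invr_ge0 ltW.
  have qV0 : q^-1 != 0 by rewrite invr_eq0 gt_eqF.
  rewrite /chi -fmorphXz expfzMl !(expfzDr _ _ tau0) !(expfzDr _ _ qV0) !rmorphM.
  by rewrite invr_expz /=; ring.
apply/seteqP; split=> f [fs fb]; split=> // b g hb.
  by rewrite fb // e.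
by rewrite fb // e.
Qed.

End InducingCharacter.

Theorem theorem1p3 (R : realType) (F : localField) (varpi : F)
    (hvarpi : uniformizer varpi)
    (alpha : R) (halpha0 : 0 < alpha) (halpha1 : alpha < 1 / 2)
    (mu2 : F -> R[i]) (hmu2 : unitary_character mu2) (hmu2r : ramified mu2)
    (psi : F -> R[i]) (hpsi : additive_character psi)
    (hpsiu : unramified_additive psi)
    (c : nat) :
  let pi := Ind (abs_power alpha) mu2 (abs_power (- alpha)) in
  forall (hc : is_conductor pi c)
    (Phi : (GL3 F -> R[i]) -> (GL3 F -> R[i]))
    (hPhi : whittaker_embedding psi pi Phi)
    (v : GL3 F -> R[i]) (hv : invariants pi (@K_group F c) v)
    (hv0 : v <> (fun=> 0)),
  let Wc := Phi v in
  let q : R := (resq F)%:R in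
  let t1 : R := absv R varpi `^ alpha in
  Wc 1%g <> 0 /\
  forall m : nat,
    Wc (diagGL (varpi ^+ m) 1 (varpi ^- m)) =
      (q ^- (2 * m) / (t1 - t1^-1)
         * (t1 ^+ (2 * m).+1 - t1 ^- (2 * m).+1))%:C * Wc 1%g.
Proof.
move=> pi hc Phi hPhi v hv hv0 Wc q t1.
have [w0' vw] := hvarpi.
have q1 : 1 < q by rewrite /q ltr1n resq_gt1.
have q0 : 0 < q by apply: lt_trans q1.
have t1E : t1 = q^-1 `^ alpha.
  by rewrite /t1 absvE // vw expr1z.
have t10 : 0 < t1 by rewrite t1E powR_gt0 // invr_gt0.
have t11 : t1 < 1.
  have e1 : 1 `^ alpha = 1 :> R by rewrite powR1.
  rewrite t1E -[X in _ < X]e1; apply: gt0_ltr_powR => //.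
  - by rewrite nnegrE invr_ge0 ltW.
  - by rewrite nnegrE ler01.
  - by rewrite invf_lt1.
pose theta : R[i] := (t1 / q)%:C.
have theta0 : theta != 0.
  by rewrite fmorph_eq0 mulf_neq0 ?invr_eq0 // gt_eqF.
have [muM mu_norm _] := hmu2.
have mu0 x : x != 0 -> mu2 x != 0.
  by move=> x0; rewrite -normr_eq0 mu_norm // oner_eq0.
have piE : pi = prin theta mu2 by rewrite /pi IndE -t1E.
move: hc hPhi hv; rewrite piE => hc hPhi [vpi vK].
pose d : GL3 F := diagGL (varpi ^+ c) 1 1.
pose f := rtrans d v.
have pf : prin theta mu2 f by exact: prin_rtrans.
have f_borel b g : borel b -> f (b * g)%g = chi theta mu2 b * f g.
  by case: pf => _; exact.
have f_Kcol g k : Kcol c k -> f (g * k)%g = f g.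
  move=> /(Kcol_K_group w0' vw)/vK/(congr1 (@^~ (g * d)%g)).
  by rewrite /f /rtrans -/d !mulgA mulgK.
have f0 : f <> (fun=> 0).
  move=> e; apply: hv0; apply/funext => g.
  by have := congr1 (@^~ (g * d^-1)%g) e; rewrite /f /rtrans mulgVK.
have mu_c a := mu_trivial f_borel f_Kcol f0 (a := a).
have c0 : (0 < c)%N.
  rewrite lt0n; apply/eqP => ec; have [x [x0 vx]] := hmu2r.
  move=> /eqP; apply; apply: mu_c => //; rewrite ec.
  by apply: ballB; [rewrite ballE // vx|exact: ball1].
have mu_n (x : F) : ball c%:Z (x - 1) -> mu2 x = 1.
  by move=> hx; have [x0 vx] := @ord_near1 F c%:Z x c0 hx; exact: mu_c.
have mu_prim : exists a : F,
    [/\ a != 0, ord a = 0, ball (c%:Z - 1) (a - 1) & mu2 a != 1].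
  apply: contrapT => H; have [_ /(_ c.-1)] := hc.
  move=> h; have {h} := h (@has_JPSS_vector R F theta mu2 theta0 muM mu0 c.-1 _).
  rewrite leqNgt prednK // leqnn => /(_ _) h; apply: notF; apply: h.
  move=> a a0 va ha; apply: contrapT => /eqP mua; apply: H; exists a; split => //.
  by apply: ballW ha; ord_lia.
have [psiD _ _] := hpsi.
have [psi_o psi_p] := hpsiu.
have psi_o' (x : F) : ball 0 x -> psi x = 1 by move=> /ballP; exact: psi_o.
have psi_p' : exists2 x : F, ball (-1) x & psi x != 1.
  by have [x /ballP hx Px] := psi_p; exists x.
have qC : (resq F)%:R = q%:C :> R[i] by rewrite /q rmorph_nat.
clearbody q.
have thq : 1 - theta ^+ 2 * (resq F)%:R != 0 :> R[i].
  rewrite qC -rmorphXn -rmorphM -[1](rmorph1 (real_complex R)) -rmorphB fmorph_eq0.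
  rewrite gt_eqF // subr_gt0.
  have -> : (t1 / q) ^+ 2 * q = t1 ^+ 2 / q by field; rewrite gt_eqF.
  rewrite ltr_pdivrMr // mul1r; apply: lt_trans q1.
  by rewrite exprn_ilt1 // ltW.
have [W0 Wm] := @whittaker_values R F theta mu2 varpi c w0' vw theta0 muM mu0 c0
  mu_n mu_prim psi Phi f psiD psi_o' psi_p' hPhi f_borel f_Kcol f0 thq.
have Wnz (k : int) : varpi ^ k != 0 by rewrite expfz_neq0.
have PhiE (j l : int) : Phi f (diagGL (varpi ^ (j - c%:Z)) 1 (varpi ^ l)) =
    Wc (diagGL (varpi ^ j) 1 (varpi ^ l)).
  have [_ Pr _ _] := hPhi; rewrite /f Pr // /rtrans /d diagM ?oner_neq0 ?expf_neq0 //.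
  by rewrite [varpi ^+ c]exprnP -expfzDr // subrK !mulr1.
have P0 : Phi f (diagGL (varpi ^ (- c%:Z)) 1 1) = Wc 1%g.
  by have := PhiE 0 0; rewrite sub0r expr0z diag1.
rewrite P0 in W0 Wm; split; first exact/eqP.
move=> m; have := Wm m; rewrite PhiE -invr_expz -exprnP => ->; congr (_ * _).
have -> : \sum_(l < (2 * m).+1) (theta ^+ 2 * (resq F)%:R ^+ 2) ^+ l =
    (\sum_(l < (2 * m).+1) (t1 ^+ 2) ^+ l)%:C.
  rewrite rmorph_sum; apply: eq_bigr => l _; rewrite rmorphXn; congr (_ ^+ _).
  rewrite qC /theta -!rmorphXn -rmorphM; congr (_%:C); field.
  by rewrite gt_eqF.
rewrite qC /theta -!rmorphXn -!fmorphV -!rmorphM; congr (_%:C).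
have t1n0 : t1 != 0 by rewrite gt_eqF.
have qn0 : q != 0 by rewrite gt_eqF.
have t12 : t1 ^+ 2 != 1 by rewrite lt_eqF // exprn_ilt1 // ltW.
have S1 : \sum_(l < (2 * m).+1) (t1 ^+ 2) ^+ l =
    ((t1 ^+ 2) ^+ (2 * m).+1 - 1) / (t1 ^+ 2 - 1).
  by rewrite subrX1 mulrC mulKf // subr_eq0.
rewrite S1 exprAC exprMn exprVn.
have -> : q ^+ (4 * m) = q ^+ (2 * m) * q ^+ (2 * m).
  by rewrite -exprD -mulnDl.
rewrite [t1 ^+ (2 * m).+1]exprS; set a := t1 ^+ (2 * m); set e := q ^+ (2 * m).
have a0 : a != 0 by rewrite expf_neq0.
have e0 : e != 0 by rewrite expf_neq0.
have d0 : t1 ^+ 2 - 1 != 0 by rewrite subr_eq0.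
by field; rewrite ?a0 ?e0 ?d0 ?t1n0.
Qed.
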